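(* Let $q(t)$ be a sub-Riemannian trajectory corresponding to a control $u\in L^2([0,T],\mathbb{R}^l)$. Assume that a covector $\phi_0\in T^*_{q(T)}M$ satisfies the conditions: (i) $\phi_0$ annihilates the image $\operatorname{Im}D_u\mathrm{End}^T$; (ii) the negative index of the quadratic map $\langle\phi_0,D^2_u\mathrm{End}^T\rangle\big|_{\ker D_u\mathrm{End}^T}:\ker D_u\mathrm{End}^T\to\mathbb{R}$ is zero. Then there exists an $n$-tuple $(\phi^1,\dots,\phi^n)\in\mathbb{R}^n\setminus\{0\}$ such that the Pontryagin covector $\phi(t)=\sum_{a=1}^n\phi^a\Phi_a^{(1)}(t)\in T^*_{q(t)}M$ satisfies the conditions $$\langle\phi(t),X_i(q(t))\rangle=0\quad\text{and}\quad\langle\phi(t),[X_i,X_j](q(t))\rangle=0\qquad\text{for all }i,j=1,2,\dots,l\text{ and all }t\in[0,T].$$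
   Context: $M$ is a smooth $n$-dimensional manifold, $X_1,\dots,X_l$ are smooth, pointwise linearly independent vector fields on $M$, $T>0$ and $q_0\in M$ is fixed. Sub-Riemannian trajectories are Carathéodory solutions on $[0,T]$ of $\dot q(t)=\sum_{i=1}^lu_i(t)X_i(q(t))$, $q(0)=q_0$, with controls $u\in\Omega=L^2([0,T],\mathbb{R}^l)$; the end-point map is $\mathrm{End}^t(u)=q(t)$. $D_u\mathrm{End}^T$ is its first derivative at $u$ and $D^2_u\mathrm{End}^T[\Delta u]=\frac{d^2}{ds^2}\big|_{s=0}\mathrm{End}^T[u+s\Delta u]$ is the second derivative computed in any local coordinates around $q(T)$; the quadratic map $\Delta u\mapsto\langle\phi_0,D_u^2\mathrm{End}^T[\Delta u]\rangle$ restricted to $\ker D_u\mathrm{End}^T$ does not depend on these coordinates. The negative index of a quadratic map is the maximal dimension of a subspace on which it is negative definite. $\Phi^{(1)}(t)=(\Phi^{(1)}_a(t))_{a=1,\dots,n}:T_{q(t)}M\to\mathbb{R}^n$ is the family of linear maps such that $\{\Phi^{(1)}_a(0)\}_{a=1,\dots,n}$ is a fixed basis of $T^*_{q(0)}M$ and, in local coordinates, $\dot\Phi^{(1)}_a(t)[b]+\sum_{i=1}^lu_i(t)\,\Phi^{(1)}_a(t)\big[D_{q(t)}X_i[b]\big]=0$ for every $b\in T_{q(t)}M$. A Pontryagin covector is a covector $\phi(t)\in T^*_{q(t)}M$ evolving by $\langle\dot\phi(t),b\rangle+\langle\phi(t),\sum_iu_i(t)D_{q(t)}X_i[b]\rangle=0$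 for every $b\in T_{q(t)}M$; every combination $\sum_a\phi^a\Phi^{(1)}_a(t)$ with constant coefficients is one.
   Formalization: The covector φ_0 is additionally assumed to be nonzero; for φ_0 = 0 conditions (i) and (ii) hold trivially for every trajectory and the conclusion can fail (e.g. M = R, X_1 = d/dx). *)

(* Defs.v *)
From HB Require Import structures.
From mathcomp Require Import all_boot all_order all_algebra.
From mathcomp Require Import all_classical all_reals all_analysis.

Set Implicit Arguments.
Unset Strict Implicit.
Unset Printing Implicit Defensive.

Import Order.TTheory GRing.Theory Num.Theory.
Import numFieldNormedType.Exports.

Local Open Scope classical_set_scope.
Local Open Scope ring_scope.

(** * C^oo maps between normed spaces *)

Fixpoint iter_derive {R : realType} {V W : normedModType R} (vs : seq V)
    (f : V -> W) : V -> W :=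
  if vs is v :: vs' then 'D_v (iter_derive vs' f) else f.

(* Meant for [U] open. *)
Definition smooth_on {R : realType} {V W : normedModType R} (U : set V)
    (f : V -> W) : Prop :=
  forall (vs : seq V) (x : V), U x -> differentiable (iter_derive vs f) x.

(** * Smooth manifolds *)

(* [param] is the inverse of the coordinate map; [coords] and [param] are total
   functions whose values outside [dom] and [coords @` dom] are irrelevant. *)
Record chart (R : realType) (n : nat) (M : topologicalType) := Chart {
  dom : set M;
  coords :> M -> 'rV[R]_n;
  param : 'rV[R]_n -> M;
  open_dom : open dom;
  open_codom : open (coords @` dom);
  coordsK : forall p, dom p -> param (coords p) = p;
  continuous_coords : forall p, dom p -> {for p, continuous coords};
  continuous_param : forall x, (coords @` dom) x -> {for x, continuous param}
}.

(* The choice [chart_at] of one chart around every point is auxiliary: it only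
   serves to write tangent vectors and covectors at a point as elements of R^n
   (see below). *)
Record smooth_manifold (R : realType) (n : nat) := SmoothManifold {
  points :> topologicalType;
  manifold_hausdorff : hausdorff_space points;
  manifold_second_countable : @second_countable points;
  atlas : set (chart R n points);
  chart_at : points -> chart R n points;
  chart_at_atlas : forall p, atlas (chart_at p);
  mem_chart_at : forall p, dom (chart_at p) p;
  transition_smooth : forall c c', atlas c -> atlas c' ->
    smooth_on (c @` (dom c `&` dom c')) (c' \o param c)
}.

(** * Tangent vectors, covectors, vector fields *)

(* A tangent vector at [p] is given by its components, a row vector, in the
   coordinates [chart_at p]; a covector at [p] by its components, a column
   vector, in the dual basis.  Accordingly a vector field is a map
   [X : M -> 'rV_n] where [X p] is expressed in the chart [chart_at p];
   [tangent_in], [cotangent_in] and [vfield_in] give the components in an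
   arbitrary chart. *)

Definition pairing {R : realType} {n : nat} (lam : 'cV[R]_n) (v : 'rV[R]_n) : R :=
  (v *m lam) 0 0.

Section Tangent.
Context {R : realType} {n : nat} {M : smooth_manifold R n}.
Implicit Types (p : M) (c : chart R n M).

Definition change_of_chart c c' p : 'M[R]_n := 'J (c' \o param c) (c p).

Definition tangent_in c p (v : 'rV[R]_n) : 'rV[R]_n :=
  v *m change_of_chart (chart_at p) c p.

Definition cotangent_in c p (lam : 'cV[R]_n) : 'cV[R]_n :=
  change_of_chart c (chart_at p) p *m lam.

Definition vfield_in c (X : M -> 'rV[R]_n) : 'rV[R]_n -> 'rV[R]_n :=
  fun x => tangent_in c (param c x) (X (param c x)).

Definition smooth_vfield (X : M -> 'rV[R]_n) : Prop :=
  forall c, atlas c -> smooth_on (c @` dom c) (vfield_in c X).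

(* Sign convention: [X, Y] = DY[X] - DX[Y]. *)
Definition lie_bracket (X Y : M -> 'rV[R]_n) : M -> 'rV[R]_n := fun p =>
  let c := chart_at p in
  'D_(vfield_in c X (c p)) (vfield_in c Y) (c p)
  - 'D_(vfield_in c Y (c p)) (vfield_in c X) (c p).

End Tangent.

(** * Controls, trajectories and the end-point map *)

(* The families of disjoint subintervals are listed from left to right. *)
Definition abs_continuous {R : realType} {V : normedModType R} (a b : R)
    (f : R -> V) : Prop :=
  forall e : R, 0 < e -> exists2 d : R, 0 < d &
    forall (m : nat) (s t : nat -> R),
      (forall i, (i < m)%N -> a <= s i /\ s i <= t i /\ t i <= b) ->
      (forall i j, (i < j < m)%N -> t i <= s j) ->
      \sum_(i < m) (t i - s i) < d ->
      \sum_(i < m) `|f (t i) - f (s i)| < e.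

(* L^2([0,T], R^l).  Elements are functions and not classes modulo almost
   everywhere equality; the trajectories do not distinguish between two
   representatives of a class. *)
Notation control T l :=
  {ffun 'I_l ->
    LfunType (mrestr lebesgue_measure (measurable_itv `[0, T])) (lee1n 2)}.

Section SubRiemannian.
Context {R : realType} {n l : nat} {M : smooth_manifold R n}.
Variables (T : R) (X : 'I_l -> M -> 'rV[R]_n) (q0 : M).
Implicit Types (u v : control T l) (q : R -> M).

(* Curves are total functions of time of which only the restriction to [0, T]
   matters. *)

(* Caratheodory solution: absolutely continuous in local coordinates, and
   satisfying the equation at almost every time.  At time [t] the equation is an
   equality in the tangent space at [q t], hence written in [chart_at (q t)]. *)
Definition trajectory u q : Prop :=
  [/\ q 0 = q0,
      {within `[0, T], continuous q},
      (forall c, atlas c -> forall a b : R, 0 <= a -> a <= b -> b <= T ->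
         (forall t, a <= t <= b -> dom c (q t)) -> abs_continuous a b (c \o q)) &
      {ae @lebesgue_measure R, forall t, 0 <= t <= T ->
         is_derive t (1 : R) (chart_at (q t) \o q)
           (\sum_(i < l) u i t *: X i (q t))}].

(* The default value [q0] is taken only when [u] has no trajectory on [0, T]. *)
Definition End (t : R) u : M :=
  xget q0 [set p | exists2 q, trajectory u q & q t = p].

(* First derivative of End^T at [u] in the direction [v]: component vector in
   [chart_at (End T u)], i.e. a tangent vector at End^T(u).  Both derivatives of
   End^T are taken along the lines [s |-> u + s v]. *)
Definition DEnd u v : 'rV[R]_n :=
  derive1 (fun s : R => chart_at (End T u) (End T (u + s *: v))) 0.

Definition D2End (c : chart R n M) u v : 'rV[R]_n :=
  derive1n 2 (fun s : R => c (End T (u + s *: v))) 0.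

Definition ker_DEnd u : set (control T l) := [set v | DEnd u v = 0].

Definition im_DEnd u : set 'rV[R]_n := range (DEnd u).

(* [phi t] is a covector at [q t]; the equation is understood, as for
   trajectories, in the sense of Caratheodory. *)
Definition pontryagin_covector u q (phi : R -> 'cV[R]_n) : Prop :=
  forall c, atlas c ->
    let phic := fun t => cotangent_in c (q t) (phi t) in
    (forall a b : R, 0 <= a -> a <= b -> b <= T ->
       (forall t, a <= t <= b -> dom c (q t)) -> abs_continuous a b phic) /\
    {ae @lebesgue_measure R, forall t, 0 <= t <= T -> dom c (q t) ->
       derivable phic t 1 /\
       forall b : 'rV[R]_n,
         pairing (derive1 phic t) b
         + \sum_(i < l) u i t
             * pairing (phic t) ('D_b (vfield_in c (X i)) (c (q t))) = 0}.

(* The family Phi^(1), given by its components Phi^(1)_a. *)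
Definition covector_frame u q (Phi : 'I_n -> R -> 'cV[R]_n) : Prop :=
  (forall a, pontryagin_covector u q (Phi a)) /\
  (\matrix_(i < n, a < n) Phi a 0 i 0) \in unitmx.

End SubRiemannian.

(** * Negative index *)

Definition neg_def_subspace {R : realType} {V : lmodType R} (K : set V)
    (Q : V -> R) (k : nat) : Prop :=
  exists w : 'I_k -> V,
    [/\ forall i, K (w i),
        forall a : 'I_k -> R,
          \sum_(i < k) a i *: w i = 0 -> forall i, a i = 0 &
        forall a : 'I_k -> R,
          \sum_(i < k) a i *: w i != 0 -> Q (\sum_(i < k) a i *: w i) < 0].

(* Maximal dimension of a subspace of the linear subspace [K] on which [Q] is
   negative definite, +oo if there are such subspaces of every dimension. *)
Definition negative_index {R : realType} {V : lmodType R} (K : set V)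
    (Q : V -> R) : \bar R :=
  ereal_sup [set (k%:R)%:E | k in [set k : nat | neg_def_subspace K Q k]].

(* Main.v *)
(* Proof idea.  Let W be a primitive of the weight 1 + sum_i |u_i|; with respect to W everything
   in sight is Lipschitz.  A control v supported in a short interval [a, b] perturbs the trajectory
   of u into a family of curves, which after time b is carried to time T by the flow of u.  Pairing
   with a Pontryagin covector is invariant under that transport, to first order in the parameter,
   and to second order when the first variation vanishes at time b.  Hence the pairings of the frame
   at T with D End (v), or with D^2 End [v] when v is critical, can be computed at time b, in one
   chart.

   For v = e_i / (b - a) one finds <phi(a), X_i> up to O(W(b) - W(a)), so (i) and b -> a give the
   first condition.  For the brackets, put (w_i, w_j) = (g, g') with g vanishing to second order at
   a and b (time being rescaled to [0, 1]), and v = w'.  The second variation is then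
   2 <phi(a), [X_i, X_j](a)> int g'^2 up to sign and up to O(|g|^2 (W(b) - W(a))).  As g ranges over
   a space of dimension n + 1, some nonzero g makes the n components of the first variation vanish
   at b, exactly; by (ii) the second variation is nonnegative on it, which bounds the bracket
   pairing by O(W(b) - W(a)) from both sides after exchanging i and j.  Let b -> a again. *)
Require Import Defs.
From HB Require Import structures.
From mathcomp Require Import all_boot all_order all_algebra.
From mathcomp Require Import all_classical all_reals all_analysis.
From mathcomp Require Import measurable_realfun ring lra.

Set Implicit Arguments.
Unset Strict Implicit.
Unset Printing Implicit Defensive.

Import Order.TTheory GRing.Theory Num.Theory.
Import numFieldNormedType.Exports.

Local Open Scope classical_set_scope.
Local Open Scope ring_scope.

(** * Real induction and the fundamental theorem of calculus for absolutely continuous maps *)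

(** The low regularity of u dictates the weight: q need not stay within O(b - a) of q(a), so powers
    of b - a are useless, whereas W is continuous, which is all that the limit b -> a uses. The
    summand 1 makes time itself Lipschitz with respect to W. Hypothesis (ii) speaks only of exactly
    critical controls, hence one test function more than there are linear conditions; the g that
    survives depends on [a, b] in an uncontrolled way, so int g'^2 has to dominate |g|^2 uniformly,
    which compactness of a finite-dimensional unit sphere provides. [End] selects some trajectory
    and both of its derivatives are taken along the lines u + s v: existence, uniqueness and
    differentiability in s, at every small s, are therefore needed on the manifold. They are proved
    in time windows so short that the curve stays in one chart and Picard iteration contracts, and
    real induction on time carries them from window to window. *)

(** The supremum of the good times is good by the first half of the local step; were it below b, the
    second half would produce a good time beyond it. *)
Lemma real_induction (R : realType) (a b : R) (P : R -> Prop) : a <= b ->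
  (forall t, a <= t <= b -> exists2 r, 0 < r & forall s, a <= s <= b ->
     (t - r < s <= t -> P s -> P t) /\ (t <= s < t + r -> P t -> P s)) ->
  P a -> P b.
Proof.
move=> ab step Pa.
pose S := [set t | a <= t <= b /\ P t].
have Sa : S a by split; rewrite ?lexx.
have supS : has_sup S by split; [exists a | exists b => t [/andP[]]].
set m := sup S.
have am : a <= m by apply: ub_le_sup => //; case: supS.
have mb : m <= b by apply: ge_sup => [|t [/andP[]]//]; case: supS.
have mab : a <= m <= b by rewrite am.
have [r r0 stepm] := step m mab.
have Pm : P m.
  have [t [/[dup] tab /andP[at_ tb] Pt] mt] := sup_adherent r0 supS.
  refine ((stepm t tab).1 _ Pt); rewrite mt/=.
  by apply: ub_le_sup; [case: supS | split].
have [->//|mneb] := eqVneq b m.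
have mltb : m < b by rewrite lt_neqAle eq_sym mneb.
pose s := Num.min b (m + r / 2).
have ms : m < s by rewrite lt_min mltb ltrDl divr_gt0.
have sb : s <= b by rewrite ge_min lexx.
have sab : a <= s <= b by rewrite sb (le_trans am (ltW ms)).
have Ps : P s.
  refine ((stepm s sab).2 _ Pm); rewrite (ltW ms)/=.
  by rewrite gt_min ltrD2l ltr_pdivrMr// mulr_natr mulr2n ltrDl r0 orbT.
suff : s <= m by rewrite leNgt ms.
by apply: ub_le_sup; [case: supS | split].
Qed.

Section NegligibleGauge.
Context {R : realType}.
Local Notation mu := (@lebesgue_measure R).

(** Lets a covering argument pay for the points of a null set: [m t] is the measure of the part of U
    left of t, where U is an open set around N of measure less than d. Near a point of N it grows at
    least as fast as time, yet its total increase stays below d. *)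
Lemma negligible_gauge (N : set R) (a b d : R) :
  mu.-negligible N -> 0 < d -> a <= b ->
  exists m : R -> R, [/\ forall s t, s <= t -> m s <= m t, m b - m a < d &
    forall t, N t -> exists2 r, 0 < r & forall s s', t - r < s -> s <= s' ->
      s' < t + r -> a <= s -> s' <= b -> s' - s <= m s' - m s].
Proof.
move=> negN d0 ab.
have le_mu (A B : set R) : measurable A -> measurable B -> A `<=` B ->
    (mu A <= mu B)%E.
  by move=> mA mB AB; apply: le_measure => //; apply: mem_set.
have [A [mA muA NA]] : exists A, [/\ measurable A, mu A = 0%E & N `<=` A].
  by case: negN => B /= [mB B0 NB]; exists B.
have [|U [oU AU]] := lebesgue_regularity_outer mA _ d0; first by move: muA => /= ->; rewrite ltry.
move=> muUA.
have mU : measurable U by exact: measurable_realfun.open_measurable.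
have muU : (mu U < d%:E)%E.
  apply: le_lt_trans muUA.
  rewrite -{1}(setDKU AU) (le_trans (measureU2 _ _ _))//=; first exact: measurableD.
  by rewrite muA adde0.
have muUfin : mu U \is a fin_num by rewrite ge0_fin_numE// (lt_trans muU)// ltry.
pose I t := U `&` `]-oo, t].
have mI t : measurable (I t) by apply: measurableI.
have finI t : mu (I t) \is a fin_num.
  rewrite ge0_fin_numE//; apply: (@le_lt_trans _ _ (mu U)).
    by apply: le_mu => //; apply: subIsetl.
  by rewrite (lt_trans muU)// ltry.
exists (fun t => fine (mu (I t))); split.
- move=> s t st; rewrite fine_le//; apply: le_mu => //.
  by apply: setIS => x /=; rewrite !in_itv/= => /le_trans; apply.
- rewrite (@le_lt_trans _ _ (fine (mu U)))//; last by rewrite -lte_fin fineK.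
  rewrite lerBlDr ler_wpDr ?fine_ge0// fine_le//; apply: le_mu => //.
  exact: subIsetl.
- move=> t Nt; have /oU : U t by exact/AU/NA.
  move=> [r /= r0 rU]; exists r => // s s' trs ss' s'tr _ _.
  have [->|sneqs'] := eqVneq s s'; first by rewrite !subrr.
  have slts' : s < s' by rewrite lt_neqAle sneqs'.
  rewrite lerBrDr -lee_fin EFinD !fineK//.
  have <- : mu (`]s, s'] `|` I s) = ((s' - s)%:E + mu (I s))%E.
    rewrite measureU//=.
    + by rewrite lebesgue_measure_itv/= lte_fin slts' EFinB.
    + by exact: mI.
    + apply/seteqP; split => [x [/=]|//]; rewrite in_itv/= => /andP[sx _] [_] /=.
      by rewrite in_itv/= leNgt sx.
  apply: le_mu => //; first exact: measurableU.
  move=> x [/= |[Ux]]; rewrite /I /= !in_itv/=.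
    move=> /andP[sx xs']; split => //; apply: rU => /=.
    by rewrite ltr_distlC (lt_trans trs sx) (le_lt_trans xs').
  by move=> xs; split => //; exact: le_trans ss'.
Qed.

End NegligibleGauge.

Lemma subr_rearrange (V : zmodType) (x y z p q : V) :
  x - y = (x - z - p) - (y - z - q) + (p - q).
Proof.
have -> : (x - z - p) - (y - z - q) = (x - y) - (p - q).
  by rewrite opprD addrACA opprB subrKA opprK [in RHS]opprB [- p + q]addrC.
by rewrite subrK.
Qed.

Section DeriveEps.
Context {R : realType} {U V : normedModType R}.
Implicit Types (f : U -> V) (x v : U) (df : V).

Lemma is_derive_cvg f x v df : is_derive x v f df <->
  (fun h : R => h^-1 *: ((f \o shift x) (h *: v) - f x)) @ 0^' --> df.
Proof.
split=> [[fd <-]|fdf]; first exact: fd.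
by apply: DeriveDef; [apply/cvg_ex; exists df | exact: cvg_lim fdf].
Qed.

Lemma is_derive_dirP f x v df : is_derive x v f df <->
  forall e, 0 < e -> exists2 r, 0 < r &
    forall h : R, `|h| < r -> `|f (x + h *: v) - f x - h *: df| <= e * `|h|.
Proof.
rewrite is_derive_cvg; split.
  move=> /cvgrPdist_le fdf e e0; have /nbhs_ballP[r /= r0 rP] := fdf e e0.
  exists r => // h hr; have [->|h0] := eqVneq h 0.
    by rewrite !scale0r addr0 subrr subr0 !normr0 mulr0.
  have := rP h; rewrite -ball_normE /= sub0r normrN => /(_ hr h0).
  rewrite -(@ler_pM2l _ `|h|) ?normr_gt0// -normrZ scalerBr scalerA divff//.
  by rewrite scale1r distrC [_ * e]mulrC [_ + x]addrC.
move=> fdf; apply/cvgrPdist_le => e e0; have [r r0 rP] := fdf e e0.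
apply/nbhs_ballP; exists r => //= h; rewrite -ball_normE /= sub0r normrN => hr h0.
rewrite -(@ler_pM2l _ `|h|) ?normr_gt0// -normrZ scalerBr scalerA divff//.
by rewrite scale1r distrC [_ * e]mulrC [_ + x]addrC; exact: rP.
Qed.

End DeriveEps.

Lemma is_deriveP (R : realType) (V : normedModType R) (f : R -> V) t df :
  is_derive t (1 : R) f df <-> forall e, 0 < e -> exists2 r, 0 < r &
    forall s, `|s - t| < r -> `|f s - f t - (s - t) *: df| <= e * `|s - t|.
Proof.
rewrite is_derive_dirP; split=> fdf e /fdf[r r0 rP]; exists r => // s sr.
  by have := rP _ sr; rewrite [_ *: 1]mulr1 subrKC.
by have := rP (t + s); rewrite [t + s]addrC addrK => /(_ sr); rewrite [_ *: 1]mulr1 addrC.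
Qed.

Section FTC.
Context {R : realType} {V : normedModType R}.
Implicit Types (f : R -> V) (G : R -> R).

(** Only increments across t are asked for, since these are what differentiability at t controls. *)
Lemma increment_le a b f G : a <= b ->
  (forall t, a <= t <= b -> exists2 r, 0 < r & forall s s', a <= s -> s <= t ->
     t <= s' -> s' <= b -> t - r < s -> s' < t + r -> `|f s' - f s| <= G s' - G s) ->
  `|f b - f a| <= G b - G a.
Proof.
move=> ab loc; apply: (@real_induction _ a b (fun t => `|f t - f a| <= G t - G a)) => //.
  move=> t /[dup] tab /loc[r r0 rP]; exists r => // s /andP[as_ sb].
  case/andP: tab => at_ tb; split=> /andP[st1 st2] IH.
    have -> : f t - f a = (f t - f s) + (f s - f a) by rewrite addrA subrK.
    have -> : G t - G a = (G t - G s) + (G s - G a) by rewrite addrA subrK.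
    by apply: le_trans (ler_normD _ _) (lerD (rP _ _ _ _ _ _ _ _) IH) => //; rewrite ltrDl.
  have -> : f s - f a = (f s - f t) + (f t - f a) by rewrite addrA subrK.
  have -> : G s - G a = (G s - G t) + (G t - G a) by rewrite addrA subrK.
  by apply: le_trans (ler_normD _ _) (lerD (rP _ _ _ _ _ _ _ _) IH) => //; rewrite ltrBlDr ltrDl.
by rewrite !subrr normr0.
Qed.

Lemma derive_increment_le f G t df dG e : is_derive t (1 : R) f df ->
  is_derive t (1 : R) G dG -> `|df| <= dG -> 0 < e ->
  exists2 r, 0 < r & forall s s', s <= t -> t <= s' -> t - r < s -> s' < t + r ->
    `|f s' - f s| <= G s' - G s + e * (s' - s).
Proof.
move=> /is_deriveP fdf /is_deriveP GdG dfG e0.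
have e4 : 0 < e / 2 by rewrite divr_gt0.
have [r1 r10 r1P] := fdf _ e4; have [r2 r20 r2P] := GdG _ e4.
exists (Num.min r1 r2); first by rewrite lt_min r10.
move=> s s' st ts'; rewrite ltrBlDr -ltrBlDl lt_min => /andP[ts1 ts2].
rewrite -ltrBlDl lt_min => /andP[ts'1 ts'2].
have s'E : `|s' - t| = s' - t by rewrite ger0_norm ?subr_ge0.
have sE : `|s - t| = t - s by rewrite distrC ger0_norm ?subr_ge0.
have := r1P s'; rewrite s'E => /(_ ts'1) f1.
have := r1P s; rewrite sE => /(_ ts1) f2.
have := r2P s'; rewrite s'E => /(_ ts'2) g1.
have := r2P s; rewrite sE => /(_ ts2) g2.
have : `|f s' - f s| <= e / 2 * (s' - t) + e / 2 * (t - s) + (s' - s) * dG.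
  have -> : f s' - f s = (f s' - f t - (s' - t) *: df) - (f s - f t - (s - t) *: df)
      + (s' - s) *: df.
    have -> : (s' - s) *: df = (s' - t) *: df - (s - t) *: df.
      by rewrite -scalerBl; congr (_ *: _); rewrite opprB addrA subrK.
    exact: subr_rearrange.
  apply: le_trans (ler_normD _ _) _; apply: lerD.
    by apply: le_trans (ler_normB _ _) (lerD _ _).
  rewrite normrZ ger0_norm ?subr_ge0 ?(le_trans st)//.
  by rewrite ler_wpM2l// subr_ge0 (le_trans st).
have : (s' - s) * dG <= G s' - G s + e / 2 * (s' - t) + e / 2 * (t - s).
  move: g1 g2; rewrite !ler_norml /GRing.scale/= => /andP[+ _] /andP[_]; lra.
lra.
Qed.

(** The comparison principle from which the estimates along solutions are drawn. Absolute continuity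
    of f compensates for the null set of times without derivative; over the intervals covering that
    set the increment of G is discarded, which uses monotonicity alone. *)
Lemma ftc_le a b f G : a <= b -> abs_continuous a b f ->
  (forall s t, a <= s -> s <= t -> t <= b -> G s <= G t) ->
  {ae @lebesgue_measure R, forall t, a < t < b -> exists df dG,
     [/\ is_derive t (1 : R) f df, is_derive t (1 : R) G dG & `|df| <= dG]} ->
  `|f b - f a| <= G b - G a.
Proof.
move=> ab ac Gmono fG.
pose good t := exists df dG,
     [/\ is_derive t (1 : R) f df, is_derive t (1 : R) G dG & `|df| <= dG].
(* The end points join the null set because the hypothesis speaks of inner times only. *)
pose N := [set t | ~ (a < t < b -> good t)] `|` [set a] `|` [set b].
have negN : (@lebesgue_measure R).-negligible N.
  apply: negligibleU; first apply: negligibleU.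
  - exact: fG.
  - by exists [set a]; split => //; exact: lebesgue_measure_set1.
  - by exists [set b]; split => //; exact: lebesgue_measure_set1.
have goodN t : a <= t <= b -> ~ N t -> good t.
  move=> /andP[at_ tb] nN; have [ta tb'] : t != a /\ t != b.
    by split; apply/negP => /eqP tE; apply: nN; rewrite tE; [left; right | right].
  apply: contrapT => ng; apply: nN; left; left => /=; apply: contra_not ng; apply.
  by rewrite !lt_neqAle at_ tb eq_sym ta tb'.
have key e : 0 < e -> `|f b - f a| <= G b - G a + e * (b - a) + e.
  move=> e0; have [d d0 acd] := ac e e0.
  have [m [mmono mabd mP]] := negligible_gauge negN d0 ab.
  (* [P tau] holds if the growth of f up to tau is accounted for by G, by the slope e, and by the
     increments of f over a finite list of bad intervals whose total length is paid for by the gauge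
     [m]. Real induction brings tau to b. *)
  pose P tau := exists k (s t : nat -> R), [/\
    forall i, (i < k)%N -> a <= s i /\ s i <= t i /\ t i <= tau,
    forall i j, (i < j < k)%N -> t i <= s j,
    \sum_(i < k) (t i - s i) <= m tau - m a &
    `|f tau - f a| <= G tau - G a + e * (tau - a) + \sum_(i < k) `|f (t i) - f (s i)|].
  have Pext s0 t0 : a <= s0 -> s0 <= t0 -> t0 <= b ->
      (`|f t0 - f s0| <= G t0 - G s0 + e * (t0 - s0) \/ t0 - s0 <= m t0 - m s0) ->
      P s0 -> P t0.
    move=> as0 s0t0 t0b fst [k [s [t [st ts smk fk]]]].
    have fE : `|f t0 - f a| <= `|f t0 - f s0| + `|f s0 - f a|.
      by apply: le_trans (ler_normD _ _); rewrite addrA subrK.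
    case: fst => [gd|bd].
      exists k, s, t; split => //.
      + by move=> i ik; have [? [? ?]] := st i ik; split => //; split => //; apply: le_trans s0t0.
      + by apply: le_trans smk _; rewrite lerD2r mmono.
      + by lra.
    (* A bad piece is appended at the right end, which keeps the list ordered. *)
    exists k.+1, (fun i => if (i < k)%N then s i else s0),
      (fun i => if (i < k)%N then t i else t0); split => //.
    + move=> i _; case: ifP => [ik|_]; last by [].
      by have [? [? ?]] := st i ik; split => //; split => //; apply: le_trans s0t0.
    + move=> i j /andP[ij jk].
      have ik : (i < k)%N by apply: (leq_trans ij); rewrite -ltnS.
      rewrite ik; case: (ltnP j k) => [jk'|_]; first by apply: ts; rewrite ij.
      by have [_ []] := st i ik.
    + rewrite big_ord_recr/= ltnn (eq_bigr (fun i : 'I_k => t i - s i)); last first.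
        by move=> i _; rewrite ltn_ord.
      by lra.
    + rewrite big_ord_recr/= ltnn (eq_bigr (fun i : 'I_k => `|f (t i) - f (s i)|)); last first.
        by move=> i _; rewrite ltn_ord.
      have := Gmono _ _ as0 s0t0 t0b.
      have : 0 <= e * (t0 - s0) by rewrite mulr_ge0 ?subr_ge0// ltW.
      lra.
  have : P b.
    apply: (@real_induction _ a b P ab); last first.
      exists 0%N, (fun=> a), (fun=> a); split => //; rewrite ?big_ord0 ?subrr//.
      by rewrite normr0 mulr0 !addr0.
    move=> t tab; have [Nt|nNt] := pselect (N t).
      have [r r0 rP] := mP t Nt; exists r => // s /andP[as_ sb].
      have [at_ tb] := andP tab.
      split=> /andP[h1 h2]; apply: Pext => //; right; apply: rP => //.
        by rewrite ltrDl.
      by rewrite ltrBlDr ltrDl.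
    have [df [dG [fd Gd dfG]]] := goodN t tab nNt.
    have [r r0 rP] := derive_increment_le fd Gd dfG e0.
    exists r => // s /andP[as_ sb]; have [at_ tb] := andP tab.
    split=> /andP[h1 h2]; apply: Pext => //; left; apply: rP => //.
      by rewrite ltrDl.
    by rewrite ltrBlDr ltrDl.
  move=> [k [s [t [st ts smk fk]]]].
  have /ltW := acd k s t st ts (le_lt_trans smk mabd); lra.
apply/ler_addgt0Pr => e e0.
have c0 : 0 < b - a + 1 by rewrite ltr_wpDl ?subr_ge0.
have := key (e / (b - a + 1)) (divr_gt0 e0 c0).
rewrite -addrA -[X in _ + (_ + X)]mulr1 -mulrDr -mulrA mulVf ?mulr1//.
by rewrite gt_eqF.
Qed.

End FTC.

Section AlmostEverywhere.
Context {R : realType}.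
Local Notation mu := (@lebesgue_measure R).
Implicit Types P Q S : R -> Prop.

Lemma ae_filterT : Filter (nbhs (almost_everywhere mu)).
Proof. exact: (ae_filter_ringOfSetsType mu). Qed.

Lemma aeS P Q : (forall t, P t -> Q t) ->
  {ae mu, forall t, P t} -> {ae mu, forall t, Q t}.
Proof. by move=> PQ; apply: (@filterS _ _ ae_filterT). Qed.

Lemma aeS2 P Q S : (forall t, P t -> Q t -> S t) ->
  {ae mu, forall t, P t} -> {ae mu, forall t, Q t} -> {ae mu, forall t, S t}.
Proof. by move=> PQ; apply: (@filterS2 _ _ ae_filterT). Qed.

Lemma aeS3 P Q S U : (forall t, P t -> Q t -> S t -> U t) ->
  {ae mu, forall t, P t} -> {ae mu, forall t, Q t} -> {ae mu, forall t, S t} ->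
  {ae mu, forall t, U t}.
Proof. by move=> PQ; apply: (@filterS3 _ _ ae_filterT). Qed.

Lemma ae_all (I : finType) (P : I -> R -> Prop) :
  (forall i, {ae mu, forall t, P i t}) -> {ae mu, forall t, forall i, P i t}.
Proof. by move=> aeP; apply: (@filter_forall _ _ _ _ ae_filterT). Qed.

End AlmostEverywhere.

(** * Primitives of integrable functions *)

Section Primitive.
Context {R : realType}.
Local Notation mu := (@lebesgue_measure R).
Implicit Types (g om : R -> R) (s t : R).

Definition primitive g t := (\int[mu]_(x in `]-oo, t]) g x)%R.

Lemma integrable_sub g (D : set R) : measurable D ->
  mu.-integrable setT (EFin \o g) -> mu.-integrable D (EFin \o g).
Proof. by move=> mD; apply: integrableS. Qed.

Lemma integrable_scale C g : mu.-integrable setT (EFin \o g) ->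
  mu.-integrable setT (EFin \o (fun x => C * g x)).
Proof. by move=> intg; have := integrableZl measurableT C intg. Qed.

Lemma primitiveB g s t : mu.-integrable setT (EFin \o g) -> s <= t ->
  primitive g t - primitive g s = (\int[mu]_(x in `]s, t]) g x)%R.
Proof.
move=> intg st; apply: Rintegral_itvB.
- exact: integrable_sub.
- by [].
- by rewrite bnd_simp.
Qed.

Lemma primitive_derive g : mu.-integrable setT (EFin \o g) ->
  {ae mu, forall t, is_derive t (1 : R) (primitive g) (g t)}.
Proof.
move=> intg.
have := @FTC1Ny R g (fun y => integrable_sub (measurable_itv _) intg)
  (open_integrable_locally openT intg).
apply: aeS => t [dg dE]; refine (DeriveDef dg _).
by rewrite -derive1E.
Qed.

Lemma primitive_mono om s t : mu.-integrable setT (EFin \o om) ->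
  (forall x, 0 <= om x) -> s <= t -> primitive om s <= primitive om t.
Proof.
by move=> iom om0 st; rewrite -subr_ge0 primitiveB//; apply: Rintegral_ge0.
Qed.

Lemma primitive_le g om C s t : mu.-integrable setT (EFin \o g) ->
  mu.-integrable setT (EFin \o om) -> (forall x, `|g x| <= C * om x) -> s <= t ->
  `|primitive g t - primitive g s| <= C * (primitive om t - primitive om s).
Proof.
move=> intg iom gom st; rewrite !primitiveB//.
have intg' := @integrable_sub g `]s, t]%classic (measurable_itv _) intg.
have iom' := @integrable_sub om `]s, t]%classic (measurable_itv _) iom.
rewrite -RintegralZl//.
apply: le_trans (le_normr_Rintegral _ _) _ => //.
apply: le_Rintegral => //; first exact: integrable_norm.
exact/integrable_sub/integrable_scale.
Qed.

(** Absolute continuity of the integral, applied to the union of the intervals; taking them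
    half-open makes adjacent ones disjoint. *)
Lemma primitive_ac om : mu.-integrable setT (EFin \o om) ->
  (forall x, 0 <= om x) -> forall e, 0 < e -> exists2 d, 0 < d &
  forall (m : nat) (s t : nat -> R),
    (forall i, (i < m)%N -> s i <= t i) ->
    (forall i j, (i < j < m)%N -> t i <= s j) ->
    \sum_(i < m) (t i - s i) < d ->
    \sum_(i < m) (primitive om (t i) - primitive om (s i)) < e.
Proof.
move=> iom om0 e e0; have [d [d0 dP]] := integral_normr_continuous iom e0.
exists d => // m s t st ts smd.
pose A k := \big[setU/set0]_(i < k) `]s i, t i]%classic.
have mA k : measurable (A k) by apply: bigsetU_measurable => i _; exact: measurable_itv.
have AP k x : A k x -> exists2 i, (i < k)%N & s i < x <= t i.
  by rewrite /A -(@bigcup_mkord _ k (fun i => `]s i, t i]%classic)) => -[i /= ik]; rewrite in_itv/=; exists i.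
have disjA k : (k < m)%N -> [disjoint A k & `]s k, t k]%classic].
  move=> km; apply/disj_setPS => x [/AP[i ik /andP[_ xt]]] /=; rewrite in_itv/= => /andP[sx _].
  by have := lt_le_trans sx xt; rewrite ltNge ts// ik.
have AE k : (k <= m)%N -> (mu (A k) = (\sum_(i < k) (t i - s i))%:E)%E /\
    (\int[mu]_(x in A k) om x)%R = \sum_(i < k) (primitive om (t i) - primitive om (s i)).
  elim: k => [_|k IH km]; first by rewrite /A !big_ord0 measure0 Rintegral_set0.
  have [IH1 IH2] := IH (ltnW km).
  have -> : A k.+1 = A k `|` `]s k, t k]%classic by rewrite /A big_ord_recr.
  split.
    have -> : mu (A k `|` `]s k, t k]%classic) = (mu (A k) + mu `]s k, t k]%classic)%E.
      apply: measureU; [exact: mA | exact: measurable_itv|].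
      by apply/eqP; rewrite -disj_set2E; exact: disjA.
    rewrite IH1.
    rewrite [in RHS]big_ord_recr [in RHS]EFinD; congr (_ + _)%E.
    rewrite lebesgue_measure_itv/= lte_fin; case: ltP => [_|h]; first by rewrite EFinB.
    by have -> : t k = s k; [apply/eqP; rewrite eq_le h st | rewrite subrr].
  have intU : mu.-integrable (A k `|` `]s k, t k]%classic) (EFin \o om).
    by apply: integrable_sub => //; apply: measurableU; [exact: mA | exact: measurable_itv].
  rewrite (@Rintegral_setU _ _ _ mu (A k) `]s k, t k]%classic om (mA k) (measurable_itv _) intU (disjA k km)).
  by rewrite IH2 big_ord_recr/= primitiveB// st.
have [muA <-] := AE m (leqnn m).
rewrite -(@eq_Rintegral _ _ _ mu _ om (fun x => `|om x|)); last first.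
  by move=> x _; rewrite ger0_norm.
have muAd : (mu (A m) < d%:E)%E by rewrite muA lte_fin.
exact: dP (mA m) muAd.
Qed.

End Primitive.

(** * Maps that are Lipschitz with respect to the primitive of a weight *)

Section MatrixNorm.
Context {R : realType} {m n : nat}.
Implicit Types A : 'M[R]_(m, n).

Lemma mx_entry_le A i j : `|A i j| <= `|A|.
Proof.
rewrite [leRHS]/Num.Def.normr/= mx_normrE; apply/bigmax_geP; right => /=; by exists (i, j).
Qed.

Lemma mx_norm_le A c : 0 <= c -> (forall i j, `|A i j| <= c) -> `|A| <= c.
Proof.
move=> c0 Ac; rewrite [leLHS]/Num.Def.normr/= mx_normrE; apply/bigmax_leP; split => // -[i j] _; exact: Ac.
Qed.


Lemma is_derive_mx (V : normedModType R) (F : V -> 'M[R]_(m, n)) (dF : 'M[R]_(m, n)) x v :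
  (forall i j, is_derive x v (fun y => F y i j) (dF i j)) -> is_derive x v F dF.
Proof.
move=> Fij; have dF' : derivable F x v by apply/derivable_mxP => i j; case: (Fij i j).
apply: DeriveDef => //; rewrite derive_mx//; apply/matrixP => i j; rewrite !mxE.
by case: (Fij i j).
Qed.

Lemma is_derive_entry (V : normedModType R) (F : V -> 'M[R]_(m, n)) (dF : 'M[R]_(m, n)) x v i j :
  is_derive x v F dF -> is_derive x v (fun y => F y i j) (dF i j).
Proof.
case=> dFx <-; apply: DeriveDef; first exact: (derivable_mxP _ _ _).1.
by rewrite derive_mx// mxE.
Qed.

End MatrixNorm.

Section Wlip.
Context {R : realType}.
Local Notation mu := (@lebesgue_measure R).

Definition weight (om : R -> R) : Prop :=
  mu.-integrable setT (EFin \o om) /\ forall x, 0 <= om x.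

Variables (om : R -> R).
Hypothesis om_weight : weight om.
Local Notation W := (primitive om).

(** Lipschitz continuity with respect to the clock W, which runs at speed [om]. *)
Definition wlip {V : normedModType R} (C a b : R) (f : R -> V) : Prop :=
  forall s t, a <= s -> s <= t -> t <= b -> `|f t - f s| <= C * (W t - W s).

Definition Wlip {V : normedModType R} (a b : R) (f : R -> V) : Prop :=
  exists2 C, 0 <= C & wlip C a b f.

Lemma W_mono s t : s <= t -> W s <= W t.
Proof. by case: om_weight => iom om0; exact: primitive_mono. Qed.

Lemma W_derive : {ae mu, forall t, is_derive t (1 : R) W (om t)}.
Proof. by case: om_weight => iom _; exact: primitive_derive. Qed.

Lemma W_cont t e : 0 < e -> exists2 r, 0 < r &
  forall s s', t - r < s -> s <= s' -> s' < t + r -> W s' - W s < e.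
Proof.
move=> e0; case: om_weight => iom om0.
have [d d0 dP] := primitive_ac iom om0 e0.
exists (d / 2); first by rewrite divr_gt0.
move=> s s' ts ss' s't.
have := dP 1%N (fun=> s) (fun=> s'); rewrite !big_ord1; apply => //.
- by move=> i j /andP[ij]; rewrite ltnS leqn0 => /eqP j0; rewrite j0 in ij.
- lra.
Qed.

Context {V : normedModType R}.
Implicit Types (f g : R -> V) (a b C : R).

Lemma wlip_ac C a b f : wlip C a b f -> abs_continuous a b f.
Proof.
move=> fC e e0; case: om_weight => iom om0.
have C1 : 0 < `|C| + 1 by rewrite ltr_wpDl.
have [d d0 dP] := primitive_ac iom om0 (divr_gt0 e0 C1).
exists d => // m s t st ts smd.
have st' i : (i < m)%N -> s i <= t i by case/st => _ [].
have := dP m s t st' ts smd; rewrite ltr_pdivlMr//; apply: le_lt_trans.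
rewrite mulr_suml; apply: ler_sum => i _.
have [as_ [si tb]] := st i (ltn_ord i).
apply: le_trans (fC _ _ as_ si tb) _; rewrite mulrC.
by rewrite ler_wpM2l ?subr_ge0 ?W_mono// ler_wpDr// ler_norm.
Qed.

Lemma Wlip_ac a b f : Wlip a b f -> abs_continuous a b f.
Proof. by case=> C _; exact: wlip_ac. Qed.

Lemma wlipS C a b a' b' f : a <= a' -> b' <= b -> wlip C a b f -> wlip C a' b' f.
Proof. by move=> aa' b'b fC s t as_ st tb; apply: fC => //; [apply: le_trans as_ | apply: le_trans b'b]. Qed.

Lemma WlipS a b a' b' f : a <= a' -> b' <= b -> Wlip a b f -> Wlip a' b' f.
Proof. by move=> aa' b'b [C C0 fC]; exists C => //; exact: wlipS fC. Qed.

Lemma ftc_wlip C a b f : a <= b -> abs_continuous a b f -> 0 <= C ->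
  {ae mu, forall t, a < t < b -> exists2 df, is_derive t (1 : R) f df & `|df| <= C * om t} ->
  wlip C a b f.
Proof.
move=> ab fac C0 fd s t as_ st tb.
rewrite mulrBr; apply: (@ftc_le _ _ s t f (fun x => C * W x)) => //.
- move=> e e0; have [d d0 dP] := fac e e0; exists d => // m s' t' st' ts' smd.
  apply: dP => // i im; have [h1 [h2 h3]] := st' i im.
  by split; [exact: le_trans h1 | split => //; exact: le_trans tb].
- by move=> x y _ xy _; rewrite ler_wpM2l// W_mono.
apply: aeS2 fd W_derive => x fdx Wx /andP[sx xt].
have [|df fdf dfC] := fdx; first by rewrite (le_lt_trans as_)// (lt_le_trans xt).
exists df, (C * om x); split => //.
exact: is_deriveZ.
Qed.

Lemma wlip_bounded a b f : a <= b -> Wlip a b f ->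
  exists2 B, 0 <= B & forall t, a <= t <= b -> `|f t| <= B.
Proof.
move=> ab [C C0 fC]; exists (`|f a| + C * (W b - W a)).
  by rewrite addr_ge0// mulr_ge0// subr_ge0 W_mono.
move=> t /andP[at_ tb]; rewrite -[f t](subrK (f a)) addrC.
apply: le_trans (ler_normD _ _) _; rewrite lerD2l.
apply: le_trans (fC _ _ (lexx _) at_ tb) _.
by rewrite ler_wpM2l// lerD2r W_mono.
Qed.

(** Gronwall without the exponential: on an interval where k times the increment of W is at most
    1/2, the supremum S of |f| satisfies S <= S / 2 + |f a| + (G b - G a), and half of S is
    absorbed. *)
Lemma gronwall_short a b k f (G : R -> R) : a <= b -> Wlip a b f -> 0 <= k ->
  k * (W b - W a) <= 1 / 2 ->
  (forall s t, a <= s -> s <= t -> t <= b -> G s <= G t) ->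
  {ae mu, forall t, a < t < b -> exists df dG,
     [/\ is_derive t (1 : R) f df, is_derive t (1 : R) G dG &
         `|df| <= k * om t * `|f t| + dG]} ->
  forall t, a <= t <= b -> `|f t| <= 2 * (`|f a| + (G b - G a)).
Proof.
move=> ab fW k0 kW Gmono fd t0 t0ab.
have [B B0 fB] := wlip_bounded ab fW.
pose S := [set `|f t| | t in [set t | a <= t <= b]].
have supS : has_sup S.
  split; first by exists `|f t0|, t0.
  by exists B => _ [t tab <-]; exact: fB.
have Sub t : a <= t <= b -> `|f t| <= sup S.
  by move=> tab; apply: ub_le_sup; [case: supS | exists t].
have S0 : 0 <= sup S by apply: le_trans (Sub _ t0ab).
have step t : a <= t <= b -> `|f t| <= sup S / 2 + (`|f a| + (G b - G a)).
  move=> /andP[at_ tb].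
  have : `|f t - f a| <= (k * sup S * W t + G t) - (k * sup S * W a + G a).
    apply: (@ftc_le _ _ a t f (fun x => k * sup S * W x + G x)) => //.
    - by apply: Wlip_ac; apply: WlipS fW.
    - move=> x y ax xy yt; rewrite lerD//; last by apply: Gmono => //; exact: le_trans tb.
      by rewrite ler_wpM2l ?W_mono// mulr_ge0.
    apply: aeS2 fd W_derive => x fdx Wx /andP[ax xt].
    have [|df [dG [fdf GdG dfle]]] := fdx; first by rewrite ax (lt_le_trans xt).
    exists df, (k * sup S * om x + dG); split => //.
      apply: is_deriveD; exact: is_deriveZ.
    apply: le_trans dfle _; rewrite lerD2r mulrAC ler_wpM2r//.
      by case: om_weight.
    by rewrite ler_wpM2l// Sub// ltW//= (le_trans (ltW xt)).
  have WtW : W t - W a <= W b - W a by rewrite lerD2r W_mono.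
  have GtG := Gmono _ _ at_ tb (lexx b).
  have : k * sup S * (W t - W a) <= sup S / 2.
    rewrite mulrAC; apply: (@le_trans _ _ (k * (W b - W a) * sup S)).
      by rewrite ler_wpM2r// ler_wpM2l.
    by rewrite mulrC ler_wpM2l// -[X in _ <= X]mul1r.
  have : `|f t| <= `|f t - f a| + `|f a| by rewrite -{1}(subrK (f a) (f t)) ler_normD.
  lra.
have : sup S <= sup S / 2 + (`|f a| + (G b - G a)).
  by apply: ge_sup; [case: supS | move=> _ [t tab <-]; exact: step].
have := Sub _ t0ab; lra.
Qed.

End Wlip.

Section DeriveRules.
Context {R : realType}.

Lemma is_derive_sumF (U V : normedModType R) (I : finType) (h : I -> U -> V) (dh : I -> V) x v :
  (forall i, is_derive x v (h i) (dh i)) ->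
  is_derive x v (fun y => \sum_i h i y) (\sum_i dh i).
Proof.
move=> hd; elim: (index_enum I) => [|i s IH].
  rewrite big_nil (_ : (fun _ => _) = cst 0); first exact: is_derive_cst.
  by apply/funext => y; rewrite big_nil.
rewrite big_cons (_ : (fun _ => _) = h i + (fun y => \sum_(i <- s) h i y)).
  exact: is_deriveD.
by apply/funext => y; rewrite big_cons.
Qed.

Lemma is_deriveBF (U V : normedModType R) (f g : U -> V) x v df dg :
  is_derive x v f df -> is_derive x v g dg ->
  is_derive x v (fun y => f y - g y) (df - dg).
Proof. exact: is_deriveB. Qed.

Lemma is_deriveDF (U V : normedModType R) (f g : U -> V) x v df dg :
  is_derive x v f df -> is_derive x v g dg ->
  is_derive x v (fun y => f y + g y) (df + dg).
Proof. exact: is_deriveD. Qed.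

Lemma is_deriveZF (U V : normedModType R) (k : R) (f : U -> V) x v df :
  is_derive x v f df -> is_derive x v (fun y => k *: f y) (k *: df).
Proof. exact: is_deriveZ. Qed.

Lemma is_deriveMR (U : normedModType R) (f g : U -> R) x v df dg :
  is_derive x v f df -> is_derive x v g dg ->
  is_derive x v (fun y => f y * g y) (df * g x + f x * dg).
Proof.
move=> fd gd; have := is_deriveM fd gd.
by rewrite /GRing.scale/= addrC [g x * _]mulrC.
Qed.

Lemma is_deriveZV (U : normedModType R) (m n : nat) (c : U -> R) (f : U -> 'M[R]_(m, n)) x v dc df :
  is_derive x v c dc -> is_derive x v f df ->
  is_derive x v (fun y => c y *: f y) (dc *: f x + c x *: df).
Proof.
move=> cd fd; apply: is_derive_mx => i j.
rewrite (_ : (fun _ => _) = (fun y => c y * f y i j)); last first.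
  by apply/funext => y; rewrite mxE.
by rewrite !mxE; apply: is_deriveMR => //; exact: is_derive_entry.
Qed.

Lemma pairingE (n : nat) (p : 'cV[R]_n) (b : 'rV[R]_n) : pairing p b = \sum_j b 0 j * p j 0.
Proof. by rewrite /pairing mxE. Qed.

Lemma is_derive_pairing (U : normedModType R) (n : nat) (p : U -> 'cV[R]_n) (b : U -> 'rV[R]_n) x v dp db :
  is_derive x v p dp -> is_derive x v b db ->
  is_derive x v (fun y => pairing (p y) (b y)) (pairing dp (b x) + pairing (p x) db).
Proof.
move=> pd bd; rewrite (_ : (fun _ => _) = (fun y => \sum_j b y 0 j * p y j 0)); last first.
  by apply/funext => y; rewrite pairingE.
rewrite !pairingE -big_split/=; apply: is_derive_sumF => j.
by rewrite addrC; apply: is_deriveMR; exact: is_derive_entry.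
Qed.

Lemma is_derive_chain (V W : normedModType R) (g : V -> W) (x : R -> V) t dx :
  is_derive t (1 : R) x dx -> differentiable g (x t) ->
  is_derive t (1 : R) (g \o x) ('D_dx g (x t)).
Proof.
move=> [dxt <-] gd; have xd : differentiable x t by apply/derivable1_diffP.
have gxd : differentiable (g \o x) t by apply: differentiable_comp.
apply: DeriveDef; first exact/derivable1_diffP.
by rewrite deriveE// diff_comp//= -deriveE// -deriveE.
Qed.

End DeriveRules.

Section Pairing.
Context {R : realType} {n : nat}.
Implicit Types (p : 'cV[R]_n) (b : 'rV[R]_n).

Lemma pairingDr p b b' : pairing p (b + b') = pairing p b + pairing p b'.
Proof. by rewrite /pairing mulmxDl mxE. Qed.

Lemma pairingBr p b b' : pairing p (b - b') = pairing p b - pairing p b'.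
Proof. by rewrite /pairing mulmxBl !mxE. Qed.

Lemma pairingBl p p' b : pairing (p - p') b = pairing p b - pairing p' b.
Proof. by rewrite /pairing mulmxBr !mxE. Qed.

Lemma pairingZr p a b : pairing p (a *: b) = a * pairing p b.
Proof. by rewrite /pairing -scalemxAl mxE. Qed.

Lemma pairingZl p a b : pairing (a *: p) b = a * pairing p b.
Proof. by rewrite /pairing -scalemxAr mxE. Qed.

Lemma pairing0r p : pairing p 0 = 0.
Proof. by rewrite /pairing mul0mx mxE. Qed.

Lemma pairing0l b : pairing 0 b = 0.
Proof. by rewrite /pairing mulmx0 mxE. Qed.

Lemma pairing_sumr (I : finType) p (F : I -> 'rV[R]_n) :
  pairing p (\sum_i F i) = \sum_i pairing p (F i).
Proof. by rewrite /pairing mulmx_suml summxE. Qed.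

Lemma pairing_suml (I : finType) (F : I -> 'cV[R]_n) b :
  pairing (\sum_i F i) b = \sum_i pairing (F i) b.
Proof. by rewrite /pairing mulmx_sumr summxE. Qed.

Lemma pairing_le p b : `|pairing p b| <= n%:R * (`|p| * `|b|).
Proof.
rewrite pairingE; apply: le_trans (ler_norm_sum _ _ _) _.
apply: (@le_trans _ _ (\sum_(j < n) (`|p| * `|b|))).
  apply: ler_sum => j _; rewrite normrM mulrC.
  by apply: ler_pM => //; exact: mx_entry_le.
by rewrite sumr_const card_ord -[X in X <= _]mulr_natl.
Qed.

End Pairing.

Section WlipRules.
Context {R : realType} (om : R -> R).
Hypothesis om_weight : weight om.
Local Notation W := (primitive om).

Lemma W_sub_ge0 (s t : R) : s <= t -> 0 <= W t - W s.
Proof. by move=> st; rewrite subr_ge0; exact: W_mono. Qed.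

Lemma Wlip_lip2 (U V X : normedModType R) a b (f : R -> U) (g : R -> V) (h : R -> X) c :
  0 <= c -> Wlip om a b f -> Wlip om a b g ->
  (forall s t, a <= s -> s <= t -> t <= b ->
     `|h t - h s| <= c * (`|f t - f s| + `|g t - g s|)) -> Wlip om a b h.
Proof.
move=> c0 [C C0 fC] [D D0 gD] hP; exists (c * (C + D)); first by rewrite mulr_ge0// addr_ge0.
move=> s t as_ st tb; apply: le_trans (hP _ _ as_ st tb) _.
by rewrite -mulrA ler_wpM2l// mulrDl lerD// ?fC// gD.
Qed.

Lemma Wlip_cst (V : normedModType R) a b (v : V) : Wlip om a b (fun=> v).
Proof. by exists 0 => // s t _ _ _; rewrite subrr normr0 mul0r. Qed.

Lemma Wlip_lip (U V : normedModType R) a b (f : R -> U) (h : R -> V) c :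
  0 <= c -> Wlip om a b f ->
  (forall s t, a <= s -> s <= t -> t <= b -> `|h t - h s| <= c * `|f t - f s|) ->
  Wlip om a b h.
Proof.
move=> c0 fW hP; apply: (Wlip_lip2 c0 fW (Wlip_cst a b (0 : U))) => s t as_ st tb.
by rewrite subrr normr0 addr0; exact: hP.
Qed.

Lemma WlipD (V : normedModType R) a b (f g : R -> V) : Wlip om a b f -> Wlip om a b g ->
  Wlip om a b (fun t => f t + g t).
Proof.
move=> fW gW; apply: (Wlip_lip2 ler01 fW gW) => s t _ _ _.
by rewrite mul1r opprD addrACA ler_normD.
Qed.

Lemma WlipZ (V : normedModType R) a b (k : R) (f : R -> V) : Wlip om a b f ->
  Wlip om a b (fun t => k *: f t).
Proof.
by move=> fW; apply: (Wlip_lip (normr_ge0 k) fW) => s t _ _ _; rewrite -scalerBr normrZ.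
Qed.

Lemma WlipB (V : normedModType R) a b (f g : R -> V) : Wlip om a b f -> Wlip om a b g ->
  Wlip om a b (fun t => f t - g t).
Proof.
move=> fW gW; apply: (Wlip_lip2 ler01 fW gW) => s t _ _ _.
have -> : f t - g t - (f s - g s) = (f t - f s) - (g t - g s).
  by rewrite !opprD !opprK addrACA.
by rewrite mul1r ler_normB.
Qed.

Lemma Wlip_sum (V : normedModType R) (I : finType) a b (f : I -> R -> V) :
  (forall i, Wlip om a b (f i)) -> Wlip om a b (fun t => \sum_i f i t).
Proof.
move=> fW; elim: (index_enum I) => [|i s IH].
  rewrite (_ : (fun _ => _) = fun=> 0); first exact: Wlip_cst.
  by apply/funext => y; rewrite big_nil.
rewrite (_ : (fun _ => _) = (fun t => f i t + \sum_(i <- s) f i t)); first exact: WlipD.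
by apply/funext => y; rewrite big_cons.
Qed.

Lemma Wlip_entry m n a b (f : R -> 'M[R]_(m, n)) i j : Wlip om a b f ->
  Wlip om a b (fun t => f t i j).
Proof.
move=> fW; apply: (Wlip_lip ler01 fW) => s t _ _ _; rewrite mul1r.
by apply: le_trans (mx_entry_le _ i j); rewrite !mxE.
Qed.

Lemma Wlip_bilin (U V X : normedModType R) a b (f : R -> U) (g : R -> V) (B : U -> V -> X) c :
  a <= b -> 0 <= c -> (forall u v, `|B u v| <= c * (`|u| * `|v|)) ->
  (forall u u' v, B (u - u') v = B u v - B u' v) ->
  (forall u v v', B u (v - v') = B u v - B u v') ->
  Wlip om a b f -> Wlip om a b g -> Wlip om a b (fun t => B (f t) (g t)).
Proof.
move=> ab c0 Bc Bl Br fW gW.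
have [M M0 fM] := wlip_bounded om_weight ab fW.
have [N N0 gN] := wlip_bounded om_weight ab gW.
have cMN : 0 <= c * (M + N) by rewrite mulr_ge0// addr_ge0.
apply: (Wlip_lip2 cMN fW gW) => s t as_ st tb.
have -> : B (f t) (g t) - B (f s) (g s) = B (f t - f s) (g t) + B (f s) (g t - g s).
  by rewrite Bl Br addrA subrK.
apply: le_trans (ler_normD _ _) _.
have h1 : `|f t - f s| * `|g t| <= `|f t - f s| * N.
  by rewrite ler_wpM2l// gN// tb (le_trans as_).
have h2 : `|f s| * `|g t - g s| <= M * `|g t - g s|.
  by rewrite ler_wpM2r// fM// as_ (le_trans st).
apply: (@le_trans _ _ (c * (`|f t - f s| * N) + c * (M * `|g t - g s|))).
  apply: lerD; apply: le_trans (Bc _ _) _; exact: ler_wpM2l.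
rewrite -mulrDr -mulrA ler_wpM2l// mulrDl mulrDr mulrDr.
have : 0 <= M * `|f t - f s| by rewrite mulr_ge0.
have : 0 <= N * `|g t - g s| by rewrite mulr_ge0.
lra.
Qed.

Lemma WlipM a b (f g : R -> R) : a <= b -> Wlip om a b f -> Wlip om a b g ->
  Wlip om a b (fun t => f t * g t).
Proof.
move=> ab; apply: (@Wlip_bilin _ _ _ a b f g (fun x y : R => x * y) 1) => //.
- by move=> u v; rewrite normrM mul1r.
- by move=> u u' v; rewrite mulrBl.
- by move=> u v v'; rewrite mulrBr.
Qed.

Lemma WlipZV (V : normedModType R) a b (f : R -> R) (g : R -> V) : a <= b ->
  Wlip om a b f -> Wlip om a b g -> Wlip om a b (fun t => f t *: g t).
Proof.
move=> ab; apply: (@Wlip_bilin _ _ _ a b f g (fun (x : R) (y : V) => x *: y) 1) => //.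
- by move=> u v; rewrite normrZ mul1r.
- by move=> u u' v; rewrite scalerBl.
- by move=> u v v'; rewrite scalerBr.
Qed.

Lemma Wlip_pairing n a b (p : R -> 'cV[R]_n) (y : R -> 'rV[R]_n) : a <= b ->
  Wlip om a b p -> Wlip om a b y -> Wlip om a b (fun t => pairing (p t) (y t)).
Proof.
move=> ab; apply: (@Wlip_bilin _ _ _ a b p y (fun p y => pairing p y) n%:R) => //.
- exact: pairing_le.
- by move=> u u' v; exact: pairingBl.
- by move=> u v v'; exact: pairingBr.
Qed.

End WlipRules.

Section VectorPrimitive.
Context {R : realType} (om : R -> R).
Hypothesis om_weight : weight om.
Local Notation W := (primitive om).
Local Notation mu := (@lebesgue_measure R).

(** The retraction of the line onto [a, b]: curves are controlled on [a, b] only, while integrands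
    have to be measurable on the whole line. *)
Let clamp (a b t : R) : R := Num.max a (Num.min b t).

Lemma Wlip_measurable a b (h : R -> R) : a <= b -> Wlip om a b h ->
  measurable_fun setT (h \o clamp a b).
Proof.
move=> ab [C C0 hC]; apply: continuous_measurable_fun => t.
have cl s : a <= clamp a b s <= b.
  by rewrite /clamp le_max lexx /= ge_max ab ge_min lexx.
have clP s : [\/ s <= a /\ clamp a b s = a, a <= s /\ s <= b /\ clamp a b s = s |
    b <= s /\ clamp a b s = b].
  rewrite /clamp; have [sa|as_] := leP s a.
    by constructor 1; rewrite min_r ?max_l// (le_trans sa).
  have [sb|bs] := leP s b; first by constructor 2; rewrite max_r// ltW.
  by constructor 3; rewrite max_r// ltW.
have clm s s' : s <= s' -> clamp a b s <= clamp a b s'.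
  by move=> ss'; case: (clP s) (clP s') => [[? ->]|[? [? ->]]|[? ->]] [[? ->]|[? [? ->]]|[? ->]]; lra.
have cld s s' : s <= s' -> clamp a b s' - clamp a b s <= s' - s.
  by move=> ss'; case: (clP s) (clP s') => [[? ->]|[? [? ->]]|[? ->]] [[? ->]|[? [? ->]]|[? ->]]; lra.
apply/cvgrPdist_le => e e0.
have C1 : 0 < C + 1 by rewrite ltr_wpDl.
have [r r0 rP] := W_cont om_weight (clamp a b t) (divr_gt0 e0 C1).
apply/nbhs_ballP; exists r => //= s; rewrite /ball/= => tsr.
have key x y : x <= y -> t - r < x -> y < t + r -> (x = t \/ y = t) ->
    `|h (clamp a b y) - h (clamp a b x)| <= e.
  move=> xy tx yt xyt; have := hC (clamp a b x) (clamp a b y).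
  have /andP[-> _] := cl x; have /andP[_ ->] := cl y; rewrite clm// => /(_ isT isT isT) hle.
  apply: (le_trans hle).
  have : W (clamp a b y) - W (clamp a b x) < e / (C + 1).
    have := cld _ _ xy; have := clm _ _ xy => h1 h2.
    by apply: rP => //; case: xyt h1 h2 => -> *; lra.
  rewrite ltr_pdivlMr// => hlt; apply: le_trans (ltW hlt).
  by rewrite mulrC ler_wpM2l ?W_sub_ge0 ?clm// ler_wpDr.
move: tsr; rewrite ltr_distl => /andP[h1 h2].
have [ts|st] := leP t s.
  by rewrite distrC; apply: key => //; [lra|lra|left].
by apply: key => //; [exact: ltW|lra|lra|right].
Qed.

(** Integrates both the right-hand sides met in Picard iteration and the second variation: the [w j]
    are merely measurable controls, the [h j] are fields evaluated along a curve that is Lipschitz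
    for the clock W. *)
Lemma vector_primitive (J : finType) n (w : J -> R -> R) (h : J -> R -> 'rV[R]_n)
    (a b La M : R) : a <= b -> 0 <= La -> 0 <= M ->
  (forall j, measurable_fun setT (w j)) ->
  (forall j t, a <= t <= b -> `|w j t| <= La * om t) ->
  (forall j, Wlip om a b (h j)) ->
  (forall j t, a <= t <= b -> `|h j t| <= M) ->
  exists F : R -> 'rV[R]_n, [/\ F a = 0, wlip om (#|J|%:R * La * M) a b F &
    {ae mu, forall t, a < t < b -> is_derive t (1 : R) F (\sum_j w j t *: h j t)}].
Proof.
move=> ab La0 M0 mw wL hW hM; have [iom om0] := om_weight.
pose g k x := \sum_j (\1_(`[a, b]%classic) x * w j x) * (h j (clamp a b x)) 0 k.
have cl s : a <= clamp a b s <= b.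
  by rewrite /clamp le_max lexx /= ge_max ab ge_min lexx.
have clE s : a <= s <= b -> clamp a b s = s.
  by move=> /andP[as_ sb]; rewrite /clamp min_r// max_r.
have mg k : measurable_fun setT (g k).
  apply: measurable_sum => j; apply: measurable_funM; last first.
    by apply: (@Wlip_measurable a b (fun t => h j t 0 k)) => //; exact: Wlip_entry.
  by apply: measurable_funM; [exact: measurable_indic|exact: mw].
pose D := #|J|%:R * La * M.
have D0 : 0 <= D by rewrite !mulr_ge0.
have gle k x : `|g k x| <= D * om x.
  apply: le_trans (ler_norm_sum _ _ _) _.
  have -> : D * om x = \sum_(j : J) La * om x * M by rewrite sumr_const -mulr_natl /D; ring.
  apply: ler_sum => j _; rewrite !normrM indicE.
  have [xab|xab] := boolP (x \in `[a, b]%classic); last first.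
    by rewrite normr0 !mul0r !mulr_ge0// om0.
  move: xab; rewrite inE/= in_itv/= => xab; rewrite normr1 mul1r; apply: ler_pM => //.
    exact: wL.
  by apply: le_trans (mx_entry_le _ _ _) _; exact: hM.
have intg k : mu.-integrable setT (EFin \o g k).
  apply: (le_integrable measurableT _ _ (integrable_scale D iom)).
    by apply/measurable_EFinP; exact: mg.
  by move=> x _; rewrite lee_fin (le_trans (gle k x))// ler_norm.
exists (fun t => \row_k (primitive (g k) t - primitive (g k) a)); split.
- by apply/rowP => k; rewrite !mxE subrr.
- move=> s t as_ st tb; apply: mx_norm_le; first by rewrite mulr_ge0// W_sub_ge0.
  move=> i k; rewrite !mxE opprB addrA subrK.
  by apply: primitive_le => //; exact: gle.
apply: aeS (ae_all (fun k => primitive_derive (intg k))) => t gd tab.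
apply: is_derive_mx => i k.
rewrite (_ : (fun _ => _) = (fun y => primitive (g k) y - primitive (g k) a)); last first.
  by apply/funext => y; rewrite mxE.
have -> : (\sum_j w j t *: h j t) i k = g k t - 0.
  rewrite subr0 summxE; apply: eq_bigr => j _.
  rewrite !mxE indicE clE; last by case/andP: tab => /ltW -> /ltW ->.
  rewrite mem_set ?mul1r ?ord1//=.
  by rewrite in_itv/=; case/andP: tab => /ltW -> /ltW ->.
exact: (is_deriveBF (gd k) (is_derive_cst _ _ _)).
Qed.

End VectorPrimitive.

(** * Caratheodory solutions in a chart: existence, dependence on the control *)

Lemma geometric_small (R : realType) (c e : R) : 0 <= c -> 0 < e ->
  exists i : nat, c / 2 ^+ i <= e.
Proof.
move=> c0 e0; exists (Num.bound (c / e)).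
rewrite ler_pdivrMr ?exprn_gt0// mulrC -ler_pdivrMr//.
have /ltW/le_trans := archi_boundP (divr_ge0 c0 (ltW e0)); apply.
by rewrite -natrX ler_nat ltnW// ltn_expl.
Qed.

Lemma le0_geometric (R : realType) (c x : R) : 0 <= c ->
  (forall i, x <= c / 2 ^+ i) -> x <= 0.
Proof.
move=> c0 xc; apply/ler_addgt0Pr => e e0; rewrite add0r.
by have [i ie] := geometric_small c0 e0; apply: le_trans (xc i) ie.
Qed.

Lemma geometric_cvg (R : realType) n (z : nat -> 'rV[R]_n) (c : R) :
  0 <= c -> (forall i, `|z i.+1 - z i| <= c / 2 ^+ i) ->
  exists l, forall i, `|l - z i| <= 2 * c / 2 ^+ i.
Proof.
move=> c0 zc.
have zm i m : `|z (i + m)%N - z i| <= 2 * c / 2 ^+ i - 2 * c / 2 ^+ (i + m).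
  elim: m => [|m IH]; first by rewrite addn0 !subrr normr0.
  rewrite addnS -[z _.+1](subrK (z (i + m)%N)) -addrA.
  apply: le_trans (ler_normD _ _) _.
  have /= h := zc (i + m)%N; apply: le_trans (lerD h IH) _.
  have -> : 2 * c / 2 ^+ (i + m).+1 = c / 2 ^+ (i + m).
    by rewrite exprS invfM mulrA [2 * c]mulrC mulfK.
  by rewrite -[2 * c / 2 ^+ (i + m)]mulrA mulr_natl mulr2n; lra.
have zi i m : (i <= m)%N -> `|z m - z i| <= 2 * c / 2 ^+ i.
  move=> im; have := zm i (m - i)%N; rewrite subnKC// => /le_trans; apply.
  by rewrite lerBlDr lerDl divr_ge0 ?mulr_ge0// exprn_ge0.
have cz : cvg (z @ \oo).
  apply: cauchy_cvg; apply/cauchyP => e e0.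
  have c20 : 0 <= 2 * c by rewrite mulr_ge0.
  have [i ie] := geometric_small c20 (divr_gt0 e0 (ltr0n _ 2)).
  exists (z i); suff: \forall m \near \oo, ball (z i) e (z m) by [].
  near=> m.
  have im : (i <= m)%N by near: m; exact: nbhs_infty_ge.
  rewrite -ball_normE /ball_/= distrC.
  apply: le_lt_trans (le_trans (zi i m im) ie) _.
  by rewrite ltr_pdivrMr// ltr_pMr// ltr1n.
exists (lim (z @ \oo)) => i; apply/ler_addgt0Pr => e e0.
have /cvgrPdist_le/(_ e e0) le_e := cz.
near \oo => m.
rewrite -[lim _](subrK (z m)) -addrA; apply: le_trans (ler_normD _ _) _.
have im : (i <= m)%N by near: m; exact: nbhs_infty_ge.
by rewrite [leLHS]addrC; apply: lerD; [exact: zi | near: m].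
Unshelve. all: by end_near. Qed.

Section Picard.
Context {R : realType} (om : R -> R).
Hypothesis om_weight : weight om.
Local Notation W := (primitive om).
Local Notation mu := (@lebesgue_measure R).

(** The index type and the time dependence of [h] are kept abstract so that one statement serves the
    nonlinear equation, where J is 'I_l, and the linearised one, where J is the sum 'I_l + 'I_l of
    homogeneous and source terms. *)
Lemma picard (J : finType) n (w : J -> R -> R) (h : J -> R -> 'rV[R]_n -> 'rV[R]_n)
    (a b La M k r : R) (xi : 'rV[R]_n) : a <= b -> 0 <= La -> 0 <= M -> 0 <= k ->
  (forall j, measurable_fun setT (w j)) ->
  (forall j t, a <= t <= b -> `|w j t| <= La * om t) ->
  (forall j t z, a <= t <= b -> `|z - xi| <= r -> `|h j t z| <= M) ->
  (forall j t z z', a <= t <= b -> `|z - xi| <= r -> `|z' - xi| <= r ->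
     `|h j t z - h j t z'| <= k * `|z - z'|) ->
  (forall j z, Wlip om a b z -> (forall t, a <= t <= b -> `|z t - xi| <= r) ->
     Wlip om a b (fun t => h j t (z t))) ->
  #|J|%:R * La * M * (W b - W a) <= r ->
  #|J|%:R * La * k * (W b - W a) <= 1 / 2 ->
  exists z : R -> 'rV[R]_n, [/\ z a = xi, wlip om (#|J|%:R * La * M) a b z,
    forall t, a <= t <= b -> `|z t - xi| <= r &
    {ae mu, forall t, a < t < b -> is_derive t (1 : R) z (\sum_j w j t *: h j t (z t))}].
Proof.
move=> ab La0 M0 k0 mw wL hM hk hW smallM smallk.
set D := #|J|%:R * La * M.
have D0 : 0 <= D by rewrite !mulr_ge0.
(* The speed limit [D] confines an admissible curve to the ball of radius r, where the bounds on [h]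
   hold. *)
pose adm (z : R -> 'rV[R]_n) := z a = xi /\ wlip om D a b z.
have adm_ball z : adm z -> forall t, a <= t <= b -> `|z t - xi| <= r.
  move=> [<- zD] t /andP[at_ tb]; apply: le_trans (zD _ _ (lexx a) at_ tb) _.
  by apply: le_trans smallM; rewrite ler_wpM2l// lerD2r W_mono.
have r0 : 0 <= r.
  by apply: le_trans smallM; rewrite mulr_ge0// W_sub_ge0.
pose next (z z' : R -> 'rV[R]_n) :=
  {ae mu, forall t, a < t < b -> is_derive t (1 : R) z' (\sum_j w j t *: h j t (z t))}.
have nextP z : adm z -> exists z', adm z' /\ next z z'.
  move=> admz; have [za zD] := admz.
  have hzW j : Wlip om a b (fun t => h j t (z t)).
    by apply: hW; [exists D | exact: adm_ball].
  have hzM j t : a <= t <= b -> `|h j t (z t)| <= M.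
    by move=> tab; apply: hM => //; exact: adm_ball.
  have [F [Fa FD Fd]] := vector_primitive om_weight ab La0 M0 mw wL hzW hzM.
  exists (fun t => F t + xi); split.
    split; first by rewrite Fa add0r.
    by move=> s t as_ st tb; rewrite opprD addrACA subrr addr0; exact: FD.
  apply: aeS Fd => t Fd /Fd{}Fd.
  have -> : \sum_j w j t *: h j t (z t) = \sum_j w j t *: h j t (z t) + 0 by rewrite addr0.
  by apply: is_deriveDF => //; exact: is_derive_cst.
(* The iteration halves uniform distances, by the last smallness hypothesis. *)
have contr z1 z2 z1' z2' e : adm z1 -> adm z2 -> adm z1' -> adm z2' ->
    next z1 z1' -> next z2 z2' -> (forall t, a <= t <= b -> `|z1 t - z2 t| <= e) ->
    forall t, a <= t <= b -> `|z1' t - z2' t| <= e / 2.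
  move=> a1 a2 a1' a2' n1 n2 z12 t tab; have [at_ tb] := andP tab.
  have e0 : 0 <= e by apply: le_trans (z12 _ tab).
  have := @ftc_le _ _ a t (fun s => z1' s - z2' s) (fun s => #|J|%:R * La * k * e * W s) at_.
  rewrite a1'.1 a2'.1 subrr subr0 => H; apply: le_trans (H _ _ _) _.
  - apply: (@Wlip_ac _ _ om_weight); apply: WlipB => //; exists D => //.
      by apply: wlipS a1'.2.
    by apply: wlipS a2'.2.
  - move=> x y _ xy _; apply: ler_wpM2l; last exact: W_mono.
    by rewrite !mulr_ge0.
  - apply: aeS3 n1 n2 (W_derive om_weight) => s s1 s2 Ws /andP[as_ st].
    have sab : a < s < b by rewrite as_ (lt_le_trans st).
    have sab' : a <= s <= b by case/andP: sab => /ltW -> /ltW ->.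
    exists (\sum_j w j s *: h j s (z1 s) - \sum_j w j s *: h j s (z2 s)),
      (#|J|%:R * La * k * e * om s); split.
    + by apply: is_deriveBF; [exact: s1 | exact: s2].
    + exact: is_deriveZF.
    rewrite -sumrB; apply: le_trans (ler_norm_sum _ _ _) _.
    have -> : #|J|%:R * La * k * e * om s = \sum_(j : J) (La * om s) * (k * e).
      by rewrite sumr_const -mulr_natl; ring.
    apply: ler_sum => j _; rewrite -scalerBr normrZ; apply: ler_pM => //.
      exact: wL.
    apply: le_trans (hk _ _ _ _ sab' _ _) _; rewrite ?adm_ball//.
    by rewrite ler_wpM2l// z12.
  rewrite -mulrBr mulrAC.
  apply: (@le_trans _ _ (#|J|%:R * La * k * (W b - W a) * e)).
    rewrite ler_wpM2r// ler_wpM2l// ?mulr_ge0//.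
    by rewrite lerD2r W_mono.
  by rewrite [e / 2]mulrC ler_wpM2r// -[X in _ <= X]mul1r.
(* Existence of a next iterate becomes a function on admissible curves, so that the sequence can be
   defined by recursion. *)
pose nextf (z : {z | adm z}) : {z' | adm z' /\ next (sval z) z'} := cid (nextP _ (svalP z)).
have adm0 : adm (fun=> xi).
  split=> // s t as_ st tb; rewrite subrr normr0 mulr_ge0//.
  exact: W_sub_ge0.
pose zs := fix zs i : {z | adm z} := if i is i'.+1
  then exist _ (sval (nextf (zs i'))) (svalP (nextf (zs i'))).1 else exist _ _ adm0.
have zs_next i : next (sval (zs i)) (sval (zs i.+1)) by exact: (svalP (nextf (zs i))).2.
have zs_adm i : adm (sval (zs i)) by exact: svalP.
have zs_dist i t : a <= t <= b -> `|sval (zs i.+1) t - sval (zs i) t| <= r / 2 ^+ i.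
  elim: i t => [|i IH] t tab.
    by rewrite expr0 divr1; apply: adm_ball.
  rewrite exprS invfM mulrA mulrAC.
  exact: (contr _ _ _ _ (r / 2 ^+ i) (zs_adm i.+1) (zs_adm i) (zs_adm i.+2) (zs_adm i.+1)
    (zs_next i.+1) (zs_next i) IH t tab).
have limP t : exists l, a <= t <= b -> forall i, `|l - sval (zs i) t| <= 2 * r / 2 ^+ i.
  have [tab|tab] := boolP (a <= t <= b); last by exists 0.
  have [l lP] := @geometric_cvg R n (fun i => sval (zs i) t) r r0 (fun i => zs_dist i t tab).
  by exists l.
pose z t := sval (cid (limP t)).
have zP t : a <= t <= b -> forall i, `|z t - sval (zs i) t| <= 2 * r / 2 ^+ i.
  exact: svalP (cid (limP t)).
have r20 : 0 <= 2 * r by rewrite mulr_ge0.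
have z_adm : adm z.
  split.
    apply/eqP; rewrite -subr_eq0 -normr_le0; apply: (le0_geometric r20) => i.
    by rewrite -(zs_adm i).1; apply: zP; rewrite lexx.
  move=> s t as_ st tb; rewrite -subr_le0; apply: (@le0_geometric _ (2 * (2 * r))) => [|i].
    by rewrite mulr_ge0.
  rewrite lerBlDl; have sab : a <= s <= b by rewrite as_ (le_trans st).
  have tab : a <= t <= b by rewrite tb (le_trans as_).
  have -> : z t - z s = (sval (zs i) t - sval (zs i) s) +
      ((z t - sval (zs i) t) - (z s - sval (zs i) s)).
    have -> : z t - sval (zs i) t - (z s - sval (zs i) s) =
        (z t - z s) - (sval (zs i) t - sval (zs i) s).
      by rewrite !opprD !opprK addrACA.
    by rewrite [RHS]addrC subrK.
  apply: le_trans (ler_normD _ _) (lerD ((zs_adm i).2 _ _ as_ st tb) _).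
  apply: le_trans (ler_normB _ _) _; have := zP t tab i; have := zP s sab i.
  by rewrite -(mulrA 2) mulr_natl mulr2n; lra.
(* A uniform limit of the iterates need not inherit their derivatives. One more iteration yields a
   curve with a derivative almost everywhere, and contraction identifies it with the limit on
   [a, b]. *)
have [z' [z'_adm z'z]] := nextP z z_adm.
have zz' t : a <= t <= b -> z' t = z t.
  move=> tab; apply/eqP; rewrite -subr_eq0 -normr_le0.
  apply: (@le0_geometric _ (2 * (2 * r))) => [|i]; first by rewrite mulr_ge0.
  have h1 := contr _ _ _ _ _ z_adm (zs_adm i) z'_adm (zs_adm i.+1) z'z (zs_next i)
    (fun t tab => zP t tab i) t tab.
  have h2 := zP t tab i.+1.
  rewrite -[z' t](subrK (sval (zs i.+1) t)) -addrA.
  apply: le_trans (ler_normD _ _) _; rewrite [X in _ + X]distrC.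
  apply: le_trans (lerD h1 h2) _.
  have i0 : 0 < (2 : R) ^+ i by rewrite exprn_gt0.
  rewrite exprS invfM -(mulrA 2 (2 * r)) [2^-1 * _]mulrC mulrA.
  have : 0 <= 2 * r / 2 ^+ i by rewrite divr_ge0// ltW.
  by lra.
exists z'; split => //; [exact: z'_adm.1 | exact: z'_adm.2 | exact: adm_ball |].
apply: aeS z'z => t z'z tab; have tab' : a <= t <= b by case/andP: tab => /ltW -> /ltW ->.
by rewrite zz'//; exact: z'z.
Qed.

End Picard.

(** * Quantitative smoothness on a ball *)

Section C11.
Context {R : realType}.

Lemma mvt_curve (V : normedModType R) (phi : R -> V) (C : R) :
  (forall s : R, 0 <= s <= 1 -> exists2 d, is_derive s (1 : R) phi d & `|d| <= C) ->
  `|phi 1 - phi 0| <= C.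
Proof.
move=> phid; apply/ler_addgt0Pr => e e0.
have := @increment_le R V 0 1 phi (fun s : R => (C + e) * s) ler01.
rewrite mulr1 mulr0 subr0; apply => s s01.
have [d sd dC] := phid s s01.
have Cd : is_derive s (1 : R) (fun s : R => C * s) C.
  by have := is_deriveZF C (is_derive_id s (1 : R)); rewrite /GRing.scale/= mulr1.
have [r r0 rP] := derive_increment_le sd Cd dC e0.
exists r => // t t' _ ts st' _ h1 h2; apply: le_trans (rP _ _ ts st' h1 h2) _.
by rewrite !mulrDl; lra.
Qed.

Lemma is_derive_line (V W : normedModType R) (g : V -> W) (x h : V) (s : R) :
  differentiable g (x + s *: h) ->
  is_derive s (1 : R) (fun s : R => g (x + s *: h)) ('D_h g (x + s *: h)).
Proof.
move=> gd; apply: (@is_derive_chain _ _ _ g (fun s : R => x + s *: h)) => //.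
apply/is_deriveP => e e0; exists 1 => // t _.
by rewrite opprD addrACA subrr add0r -!scalerBl subrr scale0r normr0 mulr_ge0// ltW.
Qed.

(** A single constant K for all the bounds turns the smallness of a time window into a single
    condition on K and W. Imposed on the fields and on their first partial derivatives, the record
    carries all that the local estimates use of smoothness. *)
Record c11 {n m} (f : 'rV[R]_n -> 'rV[R]_m) (x0 : 'rV[R]_n) (rho K : R) : Prop := C11 {
  c11_diff : forall x, `|x - x0| <= rho -> differentiable f x;
  c11_bound : forall x, `|x - x0| <= rho -> `|f x| <= K;
  c11_dbound : forall x b, `|x - x0| <= rho -> `|'D_b f x| <= K * `|b|;
  c11_lip : forall x x', `|x - x0| <= rho -> `|x' - x0| <= rho ->
    `|f x' - f x| <= K * `|x' - x|;
  c11_dlip : forall x x' b, `|x - x0| <= rho -> `|x' - x0| <= rho ->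
    `|'D_b f x' - 'D_b f x| <= K * `|b| * `|x' - x|;
  c11_taylor : forall x x', `|x - x0| <= rho -> `|x' - x0| <= rho ->
    `|f x' - f x - 'D_(x' - x) f x| <= K * `|x' - x| ^+ 2 }.

Lemma ball_line (V : normedModType R) (x0 x x' : V) rho (s : R) : 0 <= s <= 1 ->
  `|x - x0| <= rho -> `|x' - x0| <= rho -> `|x + s *: (x' - x) - x0| <= rho.
Proof.
move=> /andP[s0 s1] xr x'r.
have -> : x + s *: (x' - x) - x0 = (1 - s) *: (x - x0) + s *: (x' - x0).
  rewrite [in RHS]scalerBl scale1r -[RHS]addrA [X in _ = _ + X]addrC -scalerBr opprB addrA subrK.
  by rewrite addrAC.
apply: le_trans (ler_normD _ _) _; rewrite !normrZ (ger0_norm s0) ger0_norm ?subr_ge0//.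
have : (1 - s) * `|x - x0| <= (1 - s) * rho by rewrite ler_wpM2l// subr_ge0.
have : s * `|x' - x0| <= s * rho by rewrite ler_wpM2l.
lra.
Qed.

Lemma mvt_ball (V W : normedModType R) (g : V -> W) (x0 : V) rho K :
  (forall x, `|x - x0| <= rho -> differentiable g x) ->
  (forall x b, `|x - x0| <= rho -> `|'D_b g x| <= K * `|b|) ->
  forall x x', `|x - x0| <= rho -> `|x' - x0| <= rho ->
  `|g x' - g x| <= K * `|x' - x|.
Proof.
move=> gd gK x x' xr x'r.
have := @mvt_curve _ (fun s => g (x + s *: (x' - x))) (K * `|x' - x|).
rewrite scale1r scale0r addr0 subrKC; apply => s s01.
have xs := ball_line s01 xr x'r.
by exists ('D_(x' - x) g (x + s *: (x' - x))); [apply/is_derive_line/gd | exact: gK].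
Qed.

Lemma derive_basis n m (f : 'rV[R]_n -> 'rV[R]_m) x b : differentiable f x ->
  'D_b f x = \sum_j b 0 j *: 'D_(delta_mx 0 j) f x.
Proof.
move=> fd; rewrite deriveE// {1}(row_sum_delta b) linear_sum.
by apply: eq_bigr => j _; rewrite linearZ -deriveE.
Qed.

Lemma sum_scale_le n m (b : 'rV[R]_n) (F : 'I_n -> 'rV[R]_m) K : 0 <= K ->
  (forall j, `|F j| <= K) -> `|\sum_j b 0 j *: F j| <= n%:R * K * `|b|.
Proof.
move=> K0 FK; apply: le_trans (ler_norm_sum _ _ _) _.
apply: (@le_trans _ _ (\sum_(j < n) `|b| * K)).
  by apply: ler_sum => j _; rewrite normrZ ler_pM// mx_entry_le.
by rewrite sumr_const card_ord -[X in X <= _]mulr_natl -mulrA [`|b| * _]mulrC.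
Qed.

(** Each passage from partial to directional derivatives costs a factor n, hence the three summands
    of the constant. The Taylor bound is the mean value inequality for s |-> f (x + s h) - s D_h f
    x. *)
Lemma c11_of_bounds n m (f : 'rV[R]_n -> 'rV[R]_m) x0 rho K : 0 <= K ->
  (forall x, `|x - x0| <= rho -> differentiable f x) ->
  (forall x j, `|x - x0| <= rho -> differentiable ('D_(delta_mx 0 j) f) x) ->
  (forall x, `|x - x0| <= rho -> `|f x| <= K) ->
  (forall x j, `|x - x0| <= rho -> `|'D_(delta_mx 0 j) f x| <= K) ->
  (forall x i j, `|x - x0| <= rho -> `|'D_(delta_mx 0 i) ('D_(delta_mx 0 j) f) x| <= K) ->
  c11 f x0 rho (K + n%:R * K + n%:R * (n%:R * K)).
Proof.
move=> K0 fd fdd fK fdK fddK; set L := K + _ + _.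
have nK0 : 0 <= n%:R * K by rewrite mulr_ge0.
have nnK0 : 0 <= n%:R * (n%:R * K) by rewrite mulr_ge0.
have KL : K <= L by rewrite /L; lra.
have nKL : n%:R * K <= L by rewrite /L; lra.
have nnKL : n%:R * (n%:R * K) <= L by rewrite /L; lra.
have L0 : 0 <= L by apply: le_trans KL.
have dK x b : `|x - x0| <= rho -> `|'D_b f x| <= n%:R * K * `|b|.
  by move=> xr; rewrite (derive_basis _ (fd _ xr)); apply: sum_scale_le => // j; exact: fdK.
have dlip x x' b : `|x - x0| <= rho -> `|x' - x0| <= rho ->
    `|'D_b f x' - 'D_b f x| <= n%:R * (n%:R * K) * `|b| * `|x' - x|.
  move=> xr x'r; rewrite (derive_basis _ (fd _ xr)) (derive_basis _ (fd _ x'r)).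
  rewrite -sumrB (eq_bigr (fun j => b 0 j *: ('D_(delta_mx 0 j) f x' - 'D_(delta_mx 0 j) f x))).
    rewrite mulrAC -(mulrA n%:R); apply: sum_scale_le; first by rewrite mulr_ge0.
    move=> j; have djK y d : `|y - x0| <= rho ->
        `|'D_d ('D_(delta_mx 0 j) f) y| <= n%:R * K * `|d|.
      move=> yr; rewrite (derive_basis _ (fdd _ j yr)).
      by apply: sum_scale_le => // i; exact: fddK.
    exact: (mvt_ball (g := 'D_(delta_mx 0 j) f) (fun y yr => fdd y j yr) djK xr x'r).
  by move=> j _; rewrite scalerBr.
split => //.
- by move=> x xr; apply: le_trans (fK x xr) _.
- by move=> x b xr; apply: le_trans (dK x b xr) _; rewrite ler_wpM2r.
- move=> x x' xr x'r; apply: (mvt_ball (x0 := x0) (rho := rho)) => // y b yr.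
  by apply: le_trans (dK y b yr) _; rewrite ler_wpM2r.
- move=> x x' b xr x'r; apply: le_trans (dlip x x' b xr x'r) _.
  by rewrite ler_wpM2r// ler_wpM2r.
- move=> x x' xr x'r; set h := x' - x.
  have := @mvt_curve _ (fun s => f (x + s *: h) - s *: 'D_h f x) (L * `|h| ^+ 2).
  have xh : x + h = x' by rewrite /h subrKC.
  rewrite /= !scale1r !scale0r addr0 subr0 xh addrAC; apply => s s01.
  have xs := ball_line s01 xr x'r.
  exists ('D_h f (x + s *: h) - 'D_h f x).
    apply: is_deriveBF; first exact/is_derive_line/fd.
    apply/is_deriveP => e e0; exists 1 => // t _.
    by rewrite -!scalerBl subrr scale0r normr0 mulr_ge0// ltW.
  apply: le_trans (dlip _ _ _ xr xs) _; rewrite [_ + _ - x]addrAC subrr add0r normrZ.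
  have s1 : `|s| * `|h| <= `|h|.
    by case/andP: s01 => s0 s1; rewrite ger0_norm// ler_piMl.
  have nL : n%:R * (n%:R * K) * `|h| <= L * `|h| by rewrite ler_wpM2r.
  rewrite expr2 [leRHS]mulrA; have c0 : 0 <= n%:R * (n%:R * K) * `|h| by apply: mulr_ge0.
  apply: le_trans (ler_wpM2l c0 s1) _.
  by rewrite ler_wpM2r.
Qed.

Lemma c11_mono n m (f : 'rV[R]_n -> 'rV[R]_m) x0 rho K rho' K' :
  rho' <= rho -> K <= K' -> c11 f x0 rho K -> c11 f x0 rho' K'.
Proof.
move=> rr KK [h1 h2 h3 h4 h5 h6]; split.
- by move=> x xr; apply: h1; exact: le_trans rr.
- by move=> x xr; apply: le_trans KK; apply: h2; exact: le_trans rr.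
- move=> x b xr; apply: le_trans (h3 x b _) _; first exact: le_trans rr.
  by rewrite ler_wpM2r.
- move=> x x' xr x'r; apply: le_trans (h4 x x' _ _) _; try exact: le_trans rr.
  by rewrite ler_wpM2r.
- move=> x x' b xr x'r; apply: le_trans (h5 x x' b _ _) _; try exact: le_trans rr.
  by rewrite ler_wpM2r// ler_wpM2r.
- move=> x x' xr x'r; apply: le_trans (h6 x x' _ _) _; try exact: le_trans rr.
  by rewrite ler_wpM2r.
Qed.

End C11.

Section SmoothC11.
Context {R : realType}.

Lemma near_bounded (V W : normedModType R) (g : V -> W) x0 :
  differentiable g x0 -> \forall y \near x0, `|g y| <= `|g x0| + 1.
Proof.
move=> /differentiable_continuous /cvgrPdist_le /(_ 1 ltr01); apply: filterS => y gy.
rewrite -lerBlDl; apply: le_trans gy; rewrite distrC.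
by apply: le_trans (lerB_dist _ _).
Qed.

(** By continuity, near x0 every partial derivative exceeds its norm at x0 by at most 1. Orders up
    to three occur, because the first partial derivatives must satisfy the same second-order bounds
    as f. Halving the radius puts a closed ball inside an open one. *)
Lemma smooth_c11 n m (U : set 'rV[R]_n) (f : 'rV[R]_n -> 'rV[R]_m) (x0 : 'rV[R]_n) :
  smooth_on U f -> nbhs x0 U -> exists rho K : R, [/\ 0 < rho, 0 <= K,
    forall x, `|x - x0| <= rho -> nbhs x U, c11 f x0 rho K &
    forall j, c11 ('D_(delta_mx 0 j) f) x0 rho K].
Proof.
move=> fU x0U; have Ux0 := nbhs_singleton x0U.
pose e (j : 'I_n) : 'rV[R]_n := delta_mx 0 j.
pose D1 j := 'D_(e j) f; pose D2 i j := 'D_(e i) (D1 j); pose D3 k i j := 'D_(e k) (D2 i j).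
pose S1 := \sum_j `|D1 j x0|; pose S2 := \sum_i \sum_j `|D2 i j x0|.
pose S3 := \sum_k \sum_i \sum_j `|D3 k i j x0|.
have sub1 (F : 'I_n -> R) j : (forall j, 0 <= F j) -> F j <= \sum_j F j.
  by move=> F0; rewrite (bigD1 j)//= lerDl sumr_ge0.
have d0 : differentiable f x0 by exact: (fU [::]).
have d1 j : differentiable (D1 j) x0 by exact: (fU [:: e j]).
have d2 i j : differentiable (D2 i j) x0 by exact: (fU [:: e i; e j]).
have d3 k i j : differentiable (D3 k i j) x0 by exact: (fU [:: e k; e i; e j]).
have s1 : 0 <= S1 by apply: sumr_ge0.
have s2 : 0 <= S2 by apply: sumr_ge0 => i _; apply: sumr_ge0.
have s3 : 0 <= S3.
  by apply: sumr_ge0 => k _; apply: sumr_ge0 => i _; apply: sumr_ge0.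
have h1 j : `|D1 j x0| <= S1 by apply: (sub1 (fun j => `|D1 j x0|)).
have h2 i j : `|D2 i j x0| <= S2.
  apply: le_trans (sub1 (fun j => `|D2 i j x0|) j _) _ => //.
  by apply: (sub1 (fun i => \sum_j `|D2 i j x0|)) => k; apply: sumr_ge0.
have h3 k i j : `|D3 k i j x0| <= S3.
  apply: le_trans (sub1 (fun j => `|D3 k i j x0|) j _) _ => //.
  apply: le_trans (sub1 (fun i => \sum_j `|D3 k i j x0|) i _) _.
    by move=> i'; apply: sumr_ge0.
  apply: (sub1 (fun k => \sum_i \sum_j `|D3 k i j x0|)) => k'.
  by apply: sumr_ge0 => i' _; apply: sumr_ge0.
clearbody S1 S2 S3.
have s0 : 0 <= `|f x0| by [].
pose K := `|f x0| + S1 + S2 + S3 + 1.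
have K0 : 0 <= K by rewrite /K; lra.
have n0 : \forall y \near x0, `|f y| <= K.
  by apply: filterS (near_bounded d0) => y /le_trans; apply; rewrite /K; lra.
have nall (I : finType) (P : I -> 'rV[R]_n -> Prop) :
    (forall i, \forall y \near x0, P i y) -> \forall y \near x0, forall i, P i y.
  by move=> HP; apply: (@filter_forall _ _ P (nbhs x0) _ HP).
have n1 : \forall y \near x0, forall j, `|D1 j y| <= K.
  apply: (nall _) => j; apply: filterS (near_bounded (d1 j)) => y /le_trans; apply.
  by have := h1 j; rewrite /K; lra.
have n2 : \forall y \near x0, forall i j, `|D2 i j y| <= K.
  apply: (nall _) => i; apply: (nall _) => j.
  apply: filterS (near_bounded (d2 i j)) => y /le_trans; apply.
  by have := h2 i j; rewrite /K; lra.
have n3 : \forall y \near x0, forall k i j, `|D3 k i j y| <= K.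
  apply: (nall _) => k; apply: (nall _) => i; apply: (nall _) => j.
  apply: filterS (near_bounded (d3 k i j)) => y /le_trans; apply.
  by have := h3 k i j; rewrite /K; lra.
clearbody K.
have /nbhs_ballP[r /= r0 rP] : \forall y \near x0, [/\ U y, `|f y| <= K,
    forall j, `|D1 j y| <= K, forall i j, `|D2 i j y| <= K & forall k i j, `|D3 k i j y| <= K].
  by near=> y; split; near: y.
pose rho := r / 2.
have rho0 : 0 < rho by rewrite divr_gt0.
have inb x : `|x - x0| <= rho -> ball x0 r x.
  move=> xr; rewrite -ball_normE/= distrC; apply: le_lt_trans xr _.
  by rewrite ltr_pdivrMr// ltr_pMr// ltr1n.
have inU x : `|x - x0| <= rho -> U x by move=> /inb /rP[].
have nU x : `|x - x0| <= rho -> nbhs x U.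
  move=> xr; have /nbhs_ballP : nbhs x (ball x0 r).
    by apply: (open_nbhs_nbhs); split; [exact: ball_open | exact: inb].
  by move=> [e' /= e'0 e'P]; apply/nbhs_ballP; exists e' => // y /e'P /rP[].
set L := K + n%:R * K + n%:R * (n%:R * K).
have L0 : 0 <= L by rewrite !addr_ge0// !mulr_ge0.
have cf : c11 f x0 rho L.
  apply: c11_of_bounds => //.
  - by move=> x /inU; exact: (fU [::]).
  - by move=> x j /inU; exact: (fU [:: e j]).
  - by move=> x /inb /rP[].
  - by move=> x j /inb /rP[_ _ H _ _]; exact: H.
  - by move=> x i j /inb /rP[_ _ _ H _]; exact: H.
have cD1 j : c11 (D1 j) x0 rho L.
  apply: c11_of_bounds => //.
  - by move=> x /inU; exact: (fU [:: e j]).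
  - by move=> x i /inU; exact: (fU [:: e i; e j]).
  - by move=> x /inb /rP[_ _ H _ _]; exact: H.
  - by move=> x i /inb /rP[_ _ _ H _]; exact: H.
  - by move=> x i k /inb /rP[_ _ _ _ H]; exact: H.
by exists rho, L.
Unshelve. all: by end_near. Qed.

End SmoothC11.

Ltac nneg := do ?[by [] | exact: normr_ge0 | exact: ler0n | apply: exprn_ge0
  | apply: addr_ge0 | apply: mulr_ge0].

(* [lra] on the order hypotheses only: reifying the other ones is what takes time. *)
Ltac order_lra := repeat match goal with
  | H : ?P |- _ => lazymatch P with
      is_true (_ <= _) => fail | is_true (_ < _) => fail | _ => clear H end
  end; lra.

Lemma le_of_eq d (R : porderType d) (x y : R) : x = y -> (x <= y)%O.
Proof. by move=> ->. Qed.

(** * Dependence of local solutions on the control and the initial value *)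

Section LocalSolution.
Context {R : realType} (om : R -> R).
Hypothesis om_weight : weight om.
Local Notation W := (primitive om).
Local Notation mu := (@lebesgue_measure R).

Lemma norm_sum_scale_le (V : normedModType R) (I : finType) (w : I -> R) (F : I -> V) A B :
  (forall i, `|w i| <= A) -> (forall i, `|F i| <= B) ->
  `|\sum_i w i *: F i| <= #|I|%:R * (A * B).
Proof.
move=> wA FB; apply: le_trans (ler_norm_sum _ _ _) _.
apply: (@le_trans _ _ (\sum_(i : I) A * B)); last by rewrite sumr_const -[leLHS]mulr_natl.
by apply: ler_sum => i _; rewrite normrZ ler_pM.
Qed.

Lemma deriveDr (V V' : normedModType R) (f : V -> V') x b b' : differentiable f x ->
  'D_(b + b') f x = 'D_b f x + 'D_b' f x.
Proof. by move=> fd; rewrite !deriveE// linearD. Qed.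

Lemma deriveBr (V V' : normedModType R) (f : V -> V') x b b' : differentiable f x ->
  'D_(b - b') f x = 'D_b f x - 'D_b' f x.
Proof. by move=> fd; rewrite !deriveE// linearB. Qed.

Lemma deriveZr (V V' : normedModType R) (f : V -> V') x k b : differentiable f x ->
  'D_(k *: b) f x = k *: 'D_b f x.
Proof. by move=> fd; rewrite !deriveE// linearZZ. Qed.

Context {n l : nat} (f : 'I_l -> 'rV[R]_n -> 'rV[R]_n) (x0 : 'rV[R]_n) (rho K : R).
Hypothesis (K0 : 0 <= K) (fc : forall i, c11 (f i) x0 rho K).

Definition local_sol (w : 'I_l -> R -> R) (a b : R) (X : R -> 'rV[R]_n) : Prop :=
  [/\ Wlip om a b X, forall t, a <= t <= b -> `|X t - x0| <= rho &
  {ae mu, forall t, a < t < b -> is_derive t (1 : R) X (\sum_i w i t *: f i (X t))}].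

Lemma Wlip_c11 m (h : 'rV[R]_n -> 'rV[R]_m) H a b X : 0 <= H -> c11 h x0 rho H ->
  Wlip om a b X -> (forall t, a <= t <= b -> `|X t - x0| <= rho) ->
  Wlip om a b (fun t => h (X t)).
Proof.
move=> H0 hc XW Xr; apply: (Wlip_lip H0 XW) => s t as_ st tb.
by apply: (c11_lip hc); apply: Xr; [rewrite as_ (le_trans st) | rewrite tb (le_trans as_)].
Qed.

Lemma Wlip_c11_derive m (h : 'rV[R]_n -> 'rV[R]_m) H a b X Y : a <= b -> 0 <= H -> c11 h x0 rho H ->
  Wlip om a b X -> (forall t, a <= t <= b -> `|X t - x0| <= rho) ->
  Wlip om a b Y -> Wlip om a b (fun t => 'D_(Y t) h (X t)).
Proof.
move=> ab H0 hc XW Xr YW; have [B B0 YB] := wlip_bounded om_weight ab YW.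
have c0 : 0 <= H * (1 + B) by rewrite mulr_ge0// addr_ge0.
apply: (Wlip_lip2 c0 XW YW) => s t as_ st tb.
have sab : a <= s <= b by rewrite as_ (le_trans st).
have tab : a <= t <= b by rewrite tb (le_trans as_).
have -> : 'D_(Y t) h (X t) - 'D_(Y s) h (X s) =
    'D_(Y t - Y s) h (X t) + ('D_(Y s) h (X t) - 'D_(Y s) h (X s)).
  by rewrite deriveBr ?addrA ?subrK//; apply: (c11_diff hc); exact: Xr.
apply: le_trans (ler_normD _ _) _.
have h1 := c11_dbound hc (Y t - Y s) (Xr t tab).
have h2 := c11_dlip hc (Y s) (Xr s sab) (Xr t tab).
have h3 : H * `|Y s| * `|X t - X s| <= H * B * `|X t - X s|.
  by rewrite ler_wpM2r// ler_wpM2l// YB.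
have h4 : 0 <= H * `|X t - X s| by rewrite mulr_ge0.
have h5 : 0 <= H * B * `|Y t - Y s| by rewrite !mulr_ge0.
rewrite -mulrA mulrDl mul1r [H * _]mulrDr !mulrDr !mulrA; lra.
Qed.

Variables (a b : R).
Hypothesis (ab : a <= b).
Local Notation LW := (l%:R * 2 * K * (W b - W a)).
(** The factor 2 in [LW] leaves room for the controls u + s v, bounded by 2 om for small s. The
    bound is 1/4 although Gronwall asks for 1/2, because the linearised equation has twice as many
    terms. *)
Hypothesis small : LW <= 1 / 4.

Let open_closed t : a < t < b -> a <= t <= b.
Proof. by move=> /andP[/ltW -> /ltW ->]. Qed.

Let Wab : 0 <= W b - W a.
Proof. exact: W_sub_ge0. Qed.

Lemma is_derive_scaleW c t : is_derive t (1 : R) W (om t) ->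
  is_derive t (1 : R) (fun s => c * W s) (c * om t).
Proof. exact: is_deriveZF. Qed.

Lemma gronwall_om (V : normedModType R) (e : R -> V) c : 0 <= c -> Wlip om a b e ->
  {ae mu, forall t, a < t < b -> exists2 de, is_derive t (1 : R) e de &
     `|de| <= l%:R * 2 * K * om t * `|e t| + c * om t} ->
  forall t, a <= t <= b -> `|e t| <= 2 * (`|e a| + c * (W b - W a)).
Proof.
move=> c0 eW ed t tab; rewrite mulrBr.
apply: (@gronwall_short _ _ om_weight _ a b (l%:R * 2 * K) e (fun s => c * W s)) => //.
- by rewrite !mulr_ge0.
- by apply: le_trans small _; lra.
- by move=> s s' _ ss' _; rewrite ler_wpM2l// W_mono.
apply: aeS2 ed (W_derive om_weight) => s ed Ws /ed [de eds deL].
by exists de, (c * om s); split => //; exact: is_derive_scaleW.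
Qed.

(** With d = 0 and equal initial values this is uniqueness; otherwise it gives Lipschitz dependence
    on the control. *)
Lemma local_sol_dist w1 w2 X1 X2 d : 0 <= d ->
  (forall i t, a <= t <= b -> `|w1 i t| <= 2 * om t) ->
  (forall i t, a <= t <= b -> `|w1 i t - w2 i t| <= d * om t) ->
  local_sol w1 a b X1 -> local_sol w2 a b X2 ->
  forall t, a <= t <= b ->
    `|X1 t - X2 t| <= 2 * (`|X1 a - X2 a| + l%:R * d * K * (W b - W a)).
Proof.
move=> d0 w1le w12 [X1W X1r X1d] [X2W X2r X2d] t tab.
apply: (gronwall_om (e := fun t => X1 t - X2 t) _ _ _ tab); first by rewrite !mulr_ge0.
  exact: WlipB.
apply: aeS2 X1d X2d => s X1d X2d sab; have sab' := open_closed sab.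
exists (\sum_i w1 i s *: f i (X1 s) - \sum_i w2 i s *: f i (X2 s)).
  by apply: is_deriveBF; [exact: X1d | exact: X2d].
have -> : \sum_i w1 i s *: f i (X1 s) - \sum_i w2 i s *: f i (X2 s) =
    \sum_i w1 i s *: (f i (X1 s) - f i (X2 s)) + \sum_i (w1 i s - w2 i s) *: f i (X2 s).
  rewrite -sumrB -big_split/=; apply: eq_bigr => i _.
  by rewrite scalerBr scalerBl addrA subrK.
apply: le_trans (ler_normD _ _) _; apply: lerD.
  apply: le_trans (norm_sum_scale_le (fun i => w1le i s sab')
    (fun i => c11_lip (fc i) (X2r s sab') (X1r s sab'))) _.
  by rewrite card_ord; apply: le_of_eq; ring.
apply: le_trans (norm_sum_scale_le (fun i => w12 i s sab')
  (fun i => c11_bound (fc i) (X2r s sab'))) _.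
by rewrite card_ord; apply: le_of_eq; ring.
Qed.

(** The equation linearised along X, with source v: it governs the derivative at h = 0 of solutions
    with controls w + h v. *)
Definition variational_sol (w v : 'I_l -> R -> R) (X Y : R -> 'rV[R]_n) : Prop :=
  Wlip om a b Y /\ {ae mu, forall t, a < t < b -> is_derive t (1 : R) Y
    (\sum_i w i t *: 'D_(Y t) (f i) (X t) + \sum_i v i t *: f i (X t))}.

Lemma variational_bound w v X Y V : 0 <= V ->
  (forall i t, a <= t <= b -> `|w i t| <= 2 * om t) ->
  (forall i t, a <= t <= b -> `|v i t| <= V * om t) ->
  local_sol w a b X -> variational_sol w v X Y ->
  forall t, a <= t <= b -> `|Y t| <= 2 * (`|Y a| + l%:R * V * K * (W b - W a)).
Proof.
move=> V0 wle vle [XW Xr Xd] [YW Yd] t tab.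
apply: (gronwall_om (e := Y) _ _ _ tab) => //; first by rewrite !mulr_ge0.
apply: aeS Yd => s Yd sab; have sab' := open_closed sab.
eexists; first exact: Yd.
apply: le_trans (ler_normD _ _) _; apply: lerD.
  apply: le_trans (norm_sum_scale_le (fun i => wle i s sab')
    (fun i => c11_dbound (fc i) (Y s) (Xr s sab'))) _.
  by rewrite card_ord; apply: le_of_eq; ring.
apply: le_trans (norm_sum_scale_le (fun i => vle i s sab')
  (fun i => c11_bound (fc i) (Xr s sab'))) _.
by rewrite card_ord; apply: le_of_eq; ring.
Qed.

(** The difference e = X2 - X - h Y solves the equation linearised along X up to a Taylor remainder
    of size B^2 and a cross term of size |h| B. As B will be of order |h|, the error is quadratic in
    h. *)
Lemma variational_error w v X X2 Y V h B : 0 <= V -> 0 <= B ->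
  (forall i t, a <= t <= b -> `|w i t| <= 2 * om t) ->
  (forall i t, a <= t <= b -> `|v i t| <= V * om t) ->
  local_sol w a b X -> local_sol (fun i t => w i t + h * v i t) a b X2 ->
  variational_sol w v X Y ->
  (forall t, a <= t <= b -> `|X2 t - X t| <= B) ->
  forall t, a <= t <= b -> `|X2 t - X t - h *: Y t| <=
    2 * (`|X2 a - X a - h *: Y a| + l%:R * K * (2 * B ^+ 2 + `|h| * V * B) * (W b - W a)).
Proof.
move=> V0 B0 wle vle [XW Xr Xd] [X2W X2r X2d] [YW Yd] XB t tab.
apply: (gronwall_om (e := fun t => X2 t - X t - h *: Y t) _ _ _ tab).
- by rewrite !mulr_ge0// addr_ge0// !mulr_ge0// exprn_ge0.
- by apply: WlipB; [exact: WlipB | exact: WlipZ].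
apply: aeS3 Xd X2d Yd => s Xd X2d Yd sab; have sab' := open_closed sab.
have Xs := Xr s sab'; have X2s := X2r s sab'; have fd i := c11_diff (fc i) Xs.
eexists.
  apply: is_deriveBF; first by apply: is_deriveBF; [exact: X2d | exact: Xd].
  by apply: is_deriveZF; exact: Yd.
set e := X2 s - X s - h *: Y s.
(* Linear part in e, Taylor remainder of the fields, and effect of h v on the displacement from X to
   X2, in this order. *)
have -> : \sum_i (w i s + h * v i s) *: f i (X2 s) - \sum_i w i s *: f i (X s) -
    h *: (\sum_i w i s *: 'D_(Y s) (f i) (X s) + \sum_i v i s *: f i (X s)) =
    \sum_i w i s *: 'D_e (f i) (X s) +
    (\sum_i w i s *: (f i (X2 s) - f i (X s) - 'D_(X2 s - X s) (f i) (X s)) +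
     \sum_i (h * v i s) *: (f i (X2 s) - f i (X s))).
  rewrite scalerDr !scaler_sumr -big_split/= -!sumrB -!big_split/=; apply: eq_bigr => i _.
  rewrite /e deriveBr// deriveZr// !scalerBr !scalerDl !scalerA [h * w i s]mulrC.
  rewrite -!scalerA.
  move: ('D_(X2 s - X s) (f i) (X s)) ('D_(Y s) (f i) (X s)) (f i (X2 s)) (f i (X s)).
  move=> p q r z; apply/rowP => k; rewrite !mxE; ring.
apply: le_trans (ler_normD _ _) _; apply: lerD.
  apply: le_trans (norm_sum_scale_le (fun i => wle i s sab')
    (fun i => c11_dbound (fc i) e Xs)) _.
  by rewrite card_ord; apply: le_of_eq; ring.
have om0 : 0 <= om s by case: om_weight.
have B2 : `|X2 s - X s| ^+ 2 <= B ^+ 2 by rewrite ler_pXn2r ?nnegrE// XB.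
have h1 i : `|f i (X2 s) - f i (X s) - 'D_(X2 s - X s) (f i) (X s)| <= K * B ^+ 2.
  by apply: le_trans (c11_taylor (fc i) Xs X2s) _; rewrite ler_wpM2l.
have h2 i : `|f i (X2 s) - f i (X s)| <= K * B.
  by apply: le_trans (c11_lip (fc i) Xs X2s) _; rewrite ler_wpM2l// XB.
have h3 i : `|h * v i s| <= `|h| * (V * om s) by rewrite normrM ler_wpM2l// vle.
apply: le_trans (ler_normD _ _) _.
apply: le_trans (lerD (norm_sum_scale_le (fun i => wle i s sab') h1)
  (norm_sum_scale_le h3 h2)) _.
by rewrite card_ord; apply: le_of_eq; ring.
Qed.

End LocalSolution.

Section LocalFamily.
Context {R : realType} (om : R -> R).
Hypothesis om_weight : weight om.
Local Notation W := (primitive om).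
Local Notation mu := (@lebesgue_measure R).
Context {n l : nat} (f : 'I_l -> 'rV[R]_n -> 'rV[R]_n) (x0 : 'rV[R]_n) (rho K : R).
Hypothesis (K0 : 0 <= K) (fc : forall i, c11 (f i) x0 rho K).
Variables (a b : R).
Hypothesis (ab : a <= b).
Local Notation LW := (l%:R * 2 * K * (W b - W a)).
Hypothesis small : LW <= 1 / 4.
Hypothesis smallr : LW <= rho / 2.

Lemma local_existence (w : 'I_l -> R -> R) xi :
  (forall i, measurable_fun setT (w i)) ->
  (forall i t, a <= t <= b -> `|w i t| <= 2 * om t) -> `|xi - x0| <= rho / 2 ->
  exists X, X a = xi /\ local_sol om f x0 rho w a b X.
Proof.
move=> mw wle xir.
have inr z : `|z - xi| <= rho / 2 -> `|z - x0| <= rho.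
  move=> zr; rewrite -(subrK xi z) -addrA; apply: le_trans (ler_normD _ _) _; lra.
have [|||||z [za zW zr zd]] := @picard _ _ om_weight _ _ w (fun i _ z => f i z) a b 2 K K (rho / 2) xi
  ab (ler0n _ 2) K0 K0 mw wle.
- by move=> j t z _ /inr; exact: (c11_bound (fc j)).
- by move=> j t z z' _ /inr zr /inr z'r; exact: (c11_lip (fc j)).
- move=> j z zW zr; apply: (Wlip_c11 K0 (fc j)) => // t tab.
  by apply: inr; exact: zr.
- by rewrite card_ord.
- by rewrite card_ord; apply: le_trans small _; lra.
exists z; split=> //; split => //.
- by exists (#|'I_l|%:R * 2 * K) => //; rewrite !mulr_ge0.
- by move=> t /zr /inr.
Qed.

(** Solvable on the same window for every initial value and every source, since the equation is
    linear: the radius of the Picard ball may grow with the data. *)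
Lemma variational_existence (w v : 'I_l -> R -> R) V X eta : 0 <= V ->
  (forall i, measurable_fun setT (w i)) -> (forall i, measurable_fun setT (v i)) ->
  (forall i t, a <= t <= b -> `|w i t| <= 2 * om t) ->
  (forall i t, a <= t <= b -> `|v i t| <= V * om t) ->
  local_sol om f x0 rho w a b X ->
  exists Y, Y a = eta /\ variational_sol om f a b w v X Y.
Proof.
move=> V0 mw mv wle vle [XW Xr Xd].
pose V1 := V + 1.
have V10 : 0 < V1 by rewrite ltr_wpDl.
(* This r solves (|eta| + r + V1) / 2 = r, which is the smallness condition of the iteration once
   the window accounts for the factor 1/2. *)
pose r := `|eta| + V1.
have r0 : 0 <= r by rewrite addr_ge0// ltW.
(* The source controls are divided by V1 to respect the common bound 2 om, and the fields they
   multiply are scaled by V1 in return. *)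
pose w' (j : 'I_l + 'I_l) : R -> R :=
  match j with inl i => w i | inr i => fun t => V1^-1 * v i t end.
pose h (j : 'I_l + 'I_l) t (z : 'rV[R]_n) : 'rV[R]_n :=
  match j with inl i => 'D_z (f i) (X t) | inr i => V1 *: f i (X t) end.
have mw' j : measurable_fun setT (w' j).
  by case: j => i /=; [exact: mw | apply: measurable_funM => //; exact: measurable_cst].
have om0 t : 0 <= om t by case: om_weight.
have wle' j t : a <= t <= b -> `|w' j t| <= 2 * om t.
  case: j => i tab /=; first exact: wle.
  rewrite normrM gtr0_norm ?invr_gt0// -ler_pdivlMl ?invr_gt0// invrK.
  apply: le_trans (vle i t tab) _; rewrite mulrA ler_wpM2r// /V1; lra.
pose M := K * (`|eta| + r) + V1 * K.
have M0 : 0 <= M by rewrite addr_ge0// mulr_ge0// ?addr_ge0// ltW.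
have small2 : #|{: 'I_l + 'I_l}|%:R * 2 * K * (W b - W a) <= 1 / 2.
  rewrite card_sum card_ord natrD.
  have -> : (l%:R + l%:R) * 2 * K * (W b - W a) = LW + LW by ring.
  by apply: le_trans (lerD small small) _; lra.
have [|||||z [za zW zr zd]] := @picard _ _ om_weight _ _ w' h a b 2 M K r eta
  ab (ler0n _ 2) M0 K0 mw' wle'.
- case=> i t z tab zr /=.
    apply: le_trans (c11_dbound (fc i) z (Xr t tab)) _.
    apply: (@le_trans _ _ (K * (`|eta| + r))); last by rewrite lerDl mulr_ge0// ltW.
    rewrite ler_wpM2l// -(subrK eta z) addrC; apply: le_trans (ler_normD _ _) _.
    by rewrite lerD2l.
  rewrite normrZ gtr0_norm//; apply: (@le_trans _ _ (V1 * K)).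
    by apply: ler_wpM2l; [exact: ltW | exact: (c11_bound (fc i) (Xr t tab))].
  by rewrite lerDr mulr_ge0// addr_ge0.
- case=> i t z z' tab zr z'r /=; last by rewrite subrr normr0 mulr_ge0.
  rewrite -deriveBr; last exact: (c11_diff (fc i) (Xr t tab)).
  exact: (c11_dbound (fc i) _ (Xr t tab)).
- case=> i z zW zr /=; first exact: (Wlip_c11_derive om_weight ab K0 (fc i)).
  by apply: WlipZ; exact: (Wlip_c11 K0 (fc i)).
- have -> : #|{: 'I_l + 'I_l}|%:R * 2 * M * (W b - W a) =
      (#|{: 'I_l + 'I_l}|%:R * 2 * K * (W b - W a)) * (`|eta| + r + V1).
    by rewrite /M; ring.
  have s0 : 0 <= `|eta| + r + V1 by rewrite addr_ge0 ?addr_ge0// ltW.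
  apply: le_trans (ler_wpM2r s0 small2) _; rewrite /r; lra.
- exact: small2.
exists z; split => //; split.
  by exists (#|{: 'I_l + 'I_l}|%:R * 2 * M) => //; rewrite !mulr_ge0.
apply: aeS zd => t zd /zd; rewrite big_sumType/=.
rewrite [X in _ + X](eq_bigr (fun i => v i t *: f i (X t)))// => i _.
by rewrite scalerA mulrAC mulVf ?mul1r// gt_eqF.
Qed.

(** The window [a, b] is fixed before s, and differentiability holds at every small s instead of at
    0 only: the second derivative of the end point differentiates the velocity Y s in s. *)
Lemma local_family (u v : 'I_l -> R -> R) V (x : R -> 'rV[R]_n) (gam g : R -> 'rV[R]_n) e :
  0 < rho -> 0 <= V ->
  (forall i, measurable_fun setT (u i)) -> (forall i, measurable_fun setT (v i)) ->
  (forall i t, a <= t <= b -> `|u i t| <= om t) ->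
  (forall i t, a <= t <= b -> `|v i t| <= V * om t) ->
  local_sol om f x0 rho u a b x -> `|x a - x0| <= rho / 4 ->
  0 < e -> gam 0 = x a -> (forall s : R, `|s| < e -> is_derive s (1 : R) gam (g s)) ->
  exists e' (X Y : R -> R -> 'rV[R]_n), [/\ 0 < e', e' <= e &
   forall s, `|s| < e' -> [/\ local_sol om f x0 rho (fun i t => u i t + s * v i t) a b (X s) /\
      X s a = gam s,
     variational_sol om f a b (fun i t => u i t + s * v i t) v (X s) (Y s) /\ Y s a = g s,
     forall t, a <= t <= b -> is_derive s (1 : R) (X ^~ t) (Y s t),
     forall t, a <= t <= b ->
       `|X s t - x t| <= 2 * (`|gam s - gam 0| + l%:R * (`|s| * V) * K * (W b - W a)) &
     forall t, a <= t <= b -> `|Y s t| <= 2 * (`|g s| + l%:R * V * K * (W b - W a))]].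
Proof.
move=> rho_gt0 V0 mu_ mv ule vle xsol xar e0 gam0 gd.
have om0 t : 0 <= om t by case: om_weight.
have Wab : 0 <= W b - W a by exact: W_sub_ge0.
have [e1 e10 e1P] : exists2 e1, 0 < e1 & forall s, `|s| < e1 -> `|gam s - x0| <= rho / 2.
  have d0 : is_derive (0 : R) (1 : R) gam (g 0) by apply: gd; rewrite normr0.
  have := (differentiable_continuous ((derivable1_diffP _ _).1 (@ex_derive _ _ _ _ _ _ _ d0))).
  move=> /cvgrPdist_le /(_ _ (divr_gt0 rho_gt0 (ltr0n _ 4))) /nbhs_ballP[r /= r0 rP].
  exists r => // s sr; have := rP s; rewrite -ball_normE/= sub0r normrN gam0 => /(_ sr).
  rewrite distrC => h; rewrite -(subrK (x a) (gam s)) -addrA.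
  apply: le_trans (ler_normD _ _) _; lra.
(* The bound e2 V <= 1 keeps u + s v below 2 om; e1 keeps the initial points in the half ball where
   solutions start. *)
have [e2 [e20 e2e e2e1 e2V]] : exists e2, [/\ 0 < e2, e2 <= e, e2 <= e1 & e2 * V <= 1].
  have V1 : 0 < V + 1 by rewrite ltr_wpDl.
  exists (Num.min (Num.min e e1) (V + 1)^-1); rewrite !lt_min e0 e10 invr_gt0 V1.
  have h : Num.min (Num.min e e1) (V + 1)^-1 <= (V + 1)^-1 by rewrite ge_min lexx orbT.
  split=> //; rewrite ?ge_min ?lexx ?orbT//.
  apply: le_trans (ler_wpM2r V0 h) _; rewrite mulrC ler_pdivrMr// mul1r; lra.
pose w s i t := u i t + s * v i t.
have mw s i : measurable_fun setT (w s i).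
  by apply: measurable_funD => //; apply: measurable_funM => //; exact: measurable_cst.
have wle s i t : `|s| < e2 -> a <= t <= b -> `|w s i t| <= 2 * om t.
  move=> se tab; apply: le_trans (ler_normD _ _) _; rewrite normrM.
  have : `|s| * `|v i t| <= 1 * om t.
    apply: le_trans (ler_wpM2l (normr_ge0 s) (vle i t tab)) _.
    rewrite mulrA ler_wpM2r//; apply: le_trans e2V.
    by rewrite ler_wpM2r// ltW.
  have := ule i t tab; lra.
have wdist s s' i t : a <= t <= b -> `|w s i t - w s' i t| <= `|s - s'| * V * om t.
  move=> tab; rewrite /w opprD addrACA subrr add0r -mulrBl normrM -mulrA.
  by rewrite ler_wpM2l// vle.
(* The guard |s| < e2 is placed under the existential, with a dummy curve elsewhere, so that a
   solution can be chosen for every real s. *)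
have XP s : exists X, `|s| < e2 -> X a = gam s /\ local_sol om f x0 rho (w s) a b X.
  have [se|se] := boolP (`|s| < e2); last by exists (fun=> 0) => h; case/negP: se.
  have [|X XP] := @local_existence (w s) (gam s) (mw s) (fun i t => wle s i t se).
    by apply: e1P; exact: lt_le_trans e2e1.
  by exists X.
pose X s := sval (cid (XP s)).
have XS s : `|s| < e2 -> X s a = gam s /\ local_sol om f x0 rho (w s) a b (X s).
  exact: svalP (cid (XP s)).
have YP s : exists Y, `|s| < e2 -> Y a = g s /\ variational_sol om f a b (w s) v (X s) Y.
  have [se|se] := boolP (`|s| < e2); last by exists (fun=> 0) => h; case/negP: se.
  have [Xa Xs] := XS s se.
  have [Y YP] := @variational_existence (w s) v V (X s) (g s) V0 (mw s) mv
    (fun i t => wle s i t se) vle Xs.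
  by exists Y.
pose Y s := sval (cid (YP s)).
have YS s : `|s| < e2 -> Y s a = g s /\ variational_sol om f a b (w s) v (X s) (Y s).
  exact: svalP (cid (YP s)).
have dist s s' : `|s| < e2 -> `|s'| < e2 -> forall t, a <= t <= b ->
    `|X s t - X s' t| <= 2 * (`|gam s - gam s'| + l%:R * (`|s - s'| * V) * K * (W b - W a)).
  move=> se s'e t tab; have [<- Xs] := XS s se; have [<- Xs'] := XS s' s'e.
  have d0 : 0 <= `|s - s'| * V by rewrite mulr_ge0.
  exact: (local_sol_dist om_weight K0 fc ab small d0 (fun i t => wle s i t se)
    (fun i t => wdist s s' i t) Xs Xs' tab).
exists e2, X, Y; split=> // s se; have [Xa Xs] := XS s se; have [Ya Ys] := YS s se.
split=> //.
- move=> t tab; apply/is_deriveP => d d0.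
  have gds : is_derive s (1 : R) gam (g s) by apply: gd; exact: lt_le_trans e2e.
  pose c := `|g s| + 1 + l%:R * V * K * (W b - W a).
  have c0 : 0 <= c by rewrite !addr_ge0// !mulr_ge0.
  pose C := l%:R * K * (2 * (2 * c) ^+ 2 + V * (2 * c)) * (W b - W a).
  have C0 : 0 <= C by rewrite !mulr_ge0// addr_ge0// !mulr_ge0// exprn_ge0// mulr_ge0.
  have [r1 r10 r1P] := (is_deriveP _ _ _).1 gds 1 ltr01.
  have [r2 r20 r2P] := (is_deriveP _ _ _).1 gds _ (divr_gt0 d0 (ltr0n _ 4)).
  have C1 : 0 < C + 1 by rewrite ltr_wpDl.
  (* In turn: a Lipschitz bound on gam, its first-order expansion with error d / 4, staying in the
     family, and a quadratic error of at most another d / 4; Gronwall doubles the total to d. *)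
  exists (Num.min (Num.min r1 r2) (Num.min (e2 - `|s|) (d / 4 / (C + 1)))).
    by rewrite !lt_min r10 r20 subr_gt0 se !divr_gt0.
  move=> s2; rewrite !lt_min => /andP[/andP[h1 h2] /andP[h3 h4]].
  have s2e : `|s2| < e2.
    by rewrite -(subrK s s2); apply: le_lt_trans (ler_normD _ _) _; rewrite -ltrBrDr.
  have [X2a X2s] := XS s2 s2e.
  have gg : `|gam s2 - gam s| <= (`|g s| + 1) * `|s2 - s|.
    have := r1P s2 h1; rewrite mul1r => h.
    rewrite -(subrK ((s2 - s) *: g s) (gam s2 - gam s)); apply: le_trans (ler_normD _ _) _.
    by rewrite normrZ mulrDl mul1r addrC [`|s2 - s| * _]mulrC lerD2l.
  pose B := 2 * c * `|s2 - s|.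
  have B0 : 0 <= B by rewrite !mulr_ge0.
  have XB t' : a <= t' <= b -> `|X s2 t' - X s t'| <= B.
    move=> t'ab; apply: le_trans (dist s2 s s2e se t' t'ab) _.
    rewrite /B -[leRHS]mulrA ler_wpM2l// /c [leRHS]mulrDl.
    have -> : l%:R * (`|s2 - s| * V) * K * (W b - W a) = l%:R * V * K * (W b - W a) * `|s2 - s|.
      by ring.
    by rewrite lerD2r.
  have X2s' : local_sol om f x0 rho (fun i t => w s i t + (s2 - s) * v i t) a b (X s2).
    rewrite (_ : (fun _ _ => _) = w s2)//; apply/funext => i; apply/funext => t'.
    by rewrite /w -addrA -mulrDl [s + _]addrC subrK.
  have := variational_error om_weight K0 fc ab small V0 B0 (fun i t => wle s i t se) vle Xs X2s' Ys XB tab.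
  rewrite X2a Xa Ya => h; apply: le_trans h _.
  have h5 := r2P s2 h2.
  have -> : l%:R * K * (2 * B ^+ 2 + `|s2 - s| * V * B) * (W b - W a) = C * `|s2 - s| ^+ 2.
    by rewrite /C /B; ring.
  have h6 : C * `|s2 - s| ^+ 2 <= d / 4 * `|s2 - s|.
    rewrite expr2 mulrA ler_wpM2r// .
    move: h4; rewrite ltr_pdivlMr// => /ltW; apply: le_trans.
    by rewrite mulrC ler_wpM2l// lerDl.
  order_lra.
- move=> t tab; have [X0a X0s] := XS 0 (eq_ind_r (fun z => z < e2) e20 (normr0 R)).
  have usol : local_sol om f x0 rho u a b x by [].
  have d0 : 0 <= `|s| * V by rewrite mulr_ge0.
  rewrite gam0 -Xa.
  apply: (local_sol_dist om_weight K0 fc ab small d0 (fun i t => wle s i t se) _ Xs xsol tab).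
  by move=> i t' t'ab; rewrite /w addrC addKr normrM -mulrA ler_wpM2l// vle.
- move=> t tab; rewrite -Ya.
  exact: (variational_bound om_weight K0 fc ab small V0 (fun i t => wle s i t se) vle Xs Ys tab).
Qed.

End LocalFamily.

(** * First and second variation paired with a covector *)

Section Covector.
Context {R : realType} (om : R -> R).
Hypothesis om_weight : weight om.
Local Notation W := (primitive om).
Local Notation mu := (@lebesgue_measure R).
Context {n l : nat} (f : 'I_l -> 'rV[R]_n -> 'rV[R]_n) (x0 : 'rV[R]_n) (rho K : R).
Hypothesis (K0 : 0 <= K) (fc : forall i, c11 (f i) x0 rho K).
Hypothesis fc2 : forall i j, c11 ('D_(delta_mx 0 j) (f i)) x0 rho K.
Variables (a b : R).
Hypothesis (ab : a <= b).
Local Notation LW := (l%:R * 2 * K * (W b - W a)).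
Hypothesis small : LW <= 1 / 4.
Variables (u : 'I_l -> R -> R) (x : R -> 'rV[R]_n).
Hypothesis ule : forall i t, a <= t <= b -> `|u i t| <= om t.
Hypothesis xsol : local_sol om f x0 rho u a b x.

Let open_closed t : a < t < b -> a <= t <= b.
Proof. by move=> /andP[/ltW -> /ltW ->]. Qed.

Let om0 t : 0 <= om t. Proof. by case: om_weight. Qed.

Let Wab : 0 <= W b - W a. Proof. exact: W_sub_ge0. Qed.

Definition covector_sol (p : R -> 'cV[R]_n) : Prop :=
  Wlip om a b p /\ {ae mu, forall t, a < t < b -> exists2 dp, is_derive t (1 : R) p dp &
    forall d, pairing dp d + \sum_i u i t * pairing (p t) ('D_d (f i) (x t)) = 0}.

(** The covector equation is adjoint to the linearisation along x, whereas Y is a variation along X.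
    What survives is the discrepancy between X and x and the source. *)
Lemma pairing_variational p w v X Y : covector_sol p -> variational_sol om f a b w v X Y ->
  {ae mu, forall t, a < t < b -> is_derive t (1 : R) (fun t => pairing (p t) (Y t))
    (\sum_i w i t * pairing (p t) ('D_(Y t) (f i) (X t))
     - \sum_i u i t * pairing (p t) ('D_(Y t) (f i) (x t))
     + \sum_i v i t * pairing (p t) (f i (X t)))}.
Proof.
move=> [_ pd] [_ Yd]; apply: aeS2 pd Yd => t pd Yd tab.
have [dp pdp dpE] := pd tab.
apply: is_derive_eq; first exact: is_derive_pairing pdp (Yd tab).
rewrite pairingDr !pairing_sumr.
rewrite (eq_bigr (fun i => w i t * pairing (p t) ('D_(Y t) (f i) (X t)))); last first.
  by move=> i _; rewrite pairingZr.
rewrite [X in _ + (_ + X)](eq_bigr (fun i => v i t * pairing (p t) (f i (X t)))); last first.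
  by move=> i _; rewrite pairingZr.
have /eqP := dpE (Y t); rewrite addr_eq0 => /eqP ->.
by rewrite addrA [- _ + _]addrC.
Qed.

Lemma norm_sum_le (I : finType) (c F : I -> R) A B :
  (forall i, `|c i| <= A) -> (forall i, `|F i| <= B) ->
  `|\sum_i c i * F i| <= #|I|%:R * (A * B).
Proof. exact: (@norm_sum_scale_le R R I c F A B). Qed.

Lemma pairing_le2 (p : 'cV[R]_n) (d : 'rV[R]_n) P D : `|p| <= P -> `|d| <= D ->
  `|pairing p d| <= n%:R * (P * D).
Proof.
by move=> pP dD; apply: le_trans (pairing_le _ _) _; rewrite ler_wpM2l// ler_pM.
Qed.

(** The drift is bounded by the product of |Y| and |X - x|. For a family with Y = O(|s|^k) it is
    thus o(|s|^k), which preserves the leading coefficient; for X = x the pairing is conserved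
    exactly. *)
Lemma pairing_transport p X Y P B D : covector_sol p ->
  local_sol om f x0 rho u a b X -> variational_sol om f a b u (fun _ _ => 0) X Y ->
  (forall t, a <= t <= b -> `|p t| <= P) -> (forall t, a <= t <= b -> `|Y t| <= B) ->
  (forall t, a <= t <= b -> `|X t - x t| <= D) ->
  `|pairing (p b) (Y b) - pairing (p a) (Y a)| <= l%:R * n%:R * P * K * B * D * (W b - W a).
Proof.
move=> pcov [XW Xr Xd] Ysol pP YB XD.
have P0 : 0 <= P by apply: le_trans (pP a _); rewrite ?lexx.
have B0 : 0 <= B by apply: le_trans (YB a _); rewrite ?lexx.
have D0 : 0 <= D by apply: le_trans (XD a _); rewrite ?lexx.
set C := l%:R * n%:R * P * K * B * D; rewrite mulrBr.
have [xW xr xd] := xsol.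
apply: (@ftc_le _ _ a b (fun t => pairing (p t) (Y t)) (fun t => C * W t)) => //.
- by apply: (Wlip_ac om_weight); apply: Wlip_pairing => //; [case: pcov | case: Ysol].
- by move=> s t _ st _; rewrite ler_wpM2l ?W_mono// !mulr_ge0.
apply: aeS2 (pairing_variational pcov Ysol) (W_derive om_weight) => t pYd Wd tab.
have tab' := open_closed tab.
eexists; exists (C * om t); split; [exact: pYd | exact: is_derive_scaleW|].
rewrite [X in _ + X]big1 ?addr0; last by move=> i _; rewrite mul0r.
rewrite -sumrB (eq_bigr (fun i => u i t * pairing (p t)
    ('D_(Y t) (f i) (X t) - 'D_(Y t) (f i) (x t)))); last first.
  by move=> i _; rewrite pairingBr mulrBr.
have h i : `|pairing (p t) ('D_(Y t) (f i) (X t) - 'D_(Y t) (f i) (x t))| <=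
    n%:R * (P * (K * B * D)).
  apply: pairing_le2; first exact: pP.
  apply: le_trans (c11_dlip (fc i) (Y t) (xr t tab') (Xr t tab')) _.
  apply: ler_pM; rewrite ?mulr_ge0//; last exact: XD.
  by rewrite ler_wpM2l// YB.
apply: le_trans (norm_sum_le (fun i => ule i tab') h) _.
by rewrite card_ord; apply: le_of_eq; rewrite /C; ring.
Qed.

Lemma vector_rearrange2 m (A1 A2 A3 A4 A5 : 'rV[R]_m) (c d s : R) :
  (c + s * d) *: A1 + d *: A4 - (c *: A3 + d *: A5) =
  c *: (A2 - A3) + (c *: (A1 - A2) + (s * d) *: A1 + d *: (A4 - A5)).
Proof. by apply/rowP => k; rewrite !mxE; ring. Qed.

Lemma vector_sum_rearrange (V : zmodType) (I : finType) (a1 a2 b1 b2 c1 c2 c3 c4 : I -> V) :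
  (forall i, a1 i + a2 i - (b1 i + b2 i) = c1 i + (c2 i + c3 i + c4 i)) ->
  \sum_i a1 i + \sum_i a2 i - (\sum_i b1 i + \sum_i b2 i) =
  \sum_i c1 i + (\sum_i c2 i + \sum_i c3 i + \sum_i c4 i).
Proof.
by move=> H; rewrite -!big_split/= -sumrB; apply: eq_bigr => i _; exact: H.
Qed.

(** Shows that the velocity Y at parameter s is within O(|s|) of the first variation y: the source
    |s| V B comes from the control, the other two terms from moving x to X. *)
Lemma variational_dist w v X Y y V s D B : 0 <= V -> 
  (forall i t, w i t = u i t + s * v i t) ->
  (forall i t, a <= t <= b -> `|v i t| <= V * om t) ->
  local_sol om f x0 rho w a b X ->
  variational_sol om f a b w v X Y -> variational_sol om f a b u v x y ->
  (forall t, a <= t <= b -> `|Y t| <= B) ->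
  (forall t, a <= t <= b -> `|X t - x t| <= D) ->
  forall t, a <= t <= b -> `|Y t - y t| <=
    2 * (`|Y a - y a| + l%:R * K * (B * D + `|s| * V * B + V * D) * (W b - W a)).
Proof.
move=> V0 wE vle [XW Xr Xd] [YW Yd] [yW yd] YB XD t tab.
have B0 : 0 <= B by apply: le_trans (YB a _); rewrite ?lexx.
have D0 : 0 <= D by apply: le_trans (XD a _); rewrite ?lexx.
have [xW xr xd] := xsol.
apply: (gronwall_om om_weight K0 ab small (e := fun t => Y t - y t) _ _ _ tab).
- by rewrite !mulr_ge0// !addr_ge0// !mulr_ge0.
- exact: WlipB.
apply: aeS2 Yd yd => r Yd yd rab; have rab' := open_closed rab.
eexists; first by apply: is_deriveBF; [exact: Yd | exact: yd].
have Xr' := Xr r rab'; have xr' := xr r rab'.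
have -> : \sum_i w i r *: 'D_(Y r) (f i) (X r) + \sum_i v i r *: f i (X r)
   - (\sum_i u i r *: 'D_(y r) (f i) (x r) + \sum_i v i r *: f i (x r)) =
   \sum_i u i r *: 'D_(Y r - y r) (f i) (x r) +
   (\sum_i u i r *: ('D_(Y r) (f i) (X r) - 'D_(Y r) (f i) (x r)) +
    \sum_i (s * v i r) *: 'D_(Y r) (f i) (X r) + \sum_i v i r *: (f i (X r) - f i (x r))).
  apply: vector_sum_rearrange => i.
  rewrite wE (deriveBr (Y r) (y r) (c11_diff (fc i) xr')); exact: vector_rearrange2.
have ur i : `|u i r| <= 2 * om r.
  by apply: le_trans (ule i rab') _; have := om0 r; lra.
apply: le_trans (ler_normD _ _) _; apply: lerD.
  apply: le_trans (norm_sum_scale_le ur (fun i => c11_dbound (fc i) (Y r - y r) xr')) _.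
  by rewrite card_ord; apply: le_of_eq; ring.
have h1 i : `|'D_(Y r) (f i) (X r) - 'D_(Y r) (f i) (x r)| <= K * B * D.
  apply: le_trans (c11_dlip (fc i) (Y r) xr' Xr') _.
  by apply: ler_pM; rewrite ?mulr_ge0// ?XD// ler_wpM2l// YB.
have h2 i : `|'D_(Y r) (f i) (X r)| <= K * B.
  by apply: le_trans (c11_dbound (fc i) (Y r) Xr') _; rewrite ler_wpM2l// YB.
have h3 i : `|f i (X r) - f i (x r)| <= K * D.
  by apply: le_trans (c11_lip (fc i) xr' Xr') _; rewrite ler_wpM2l// XD.
have sv i : `|s * v i r| <= `|s| * (V * om r) by rewrite normrM ler_wpM2l// vle.
apply: le_trans (ler_normD _ _) _.
apply: le_trans (lerD (le_trans (ler_normD _ _) (lerD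
  (norm_sum_scale_le (fun i => ule i rab') h1) (norm_sum_scale_le sv h2)))
  (norm_sum_scale_le (fun i => vle i r rab') h3)) _.
by rewrite card_ord; apply: le_of_eq; ring.
Qed.

(** The second derivative of f_i at z, applied twice to y. One of the two directions is expanded in
    the basis because the bounds are available for the partial derivatives. *)
Definition hess (i : 'I_l) (z y : 'rV[R]_n) : 'rV[R]_n :=
  \sum_j y 0 j *: 'D_y ('D_(delta_mx 0 j) (f i)) z.

(** The derivative at s = 0 of the time derivative of the pairing of p with Y s. The derivative of Y
    in s cancels by the adjoint equation; the factor 2 arises because v multiplies both the
    linearised and the undifferentiated field. *)
Definition second_variation (v : 'I_l -> R -> R) (p : R -> 'cV[R]_n) (y : R -> 'rV[R]_n) t : R :=
  \sum_i u i t * pairing (p t) (hess i (x t) (y t)) +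
  \sum_i v i t * (2 * pairing (p t) ('D_(y t) (f i) (x t))).

Lemma hess_le i z y : `|z - x0| <= rho -> `|hess i z y| <= n%:R * (K * `|y|) * `|y|.
Proof.
move=> zr; apply: sum_scale_le => [|j]; first by rewrite mulr_ge0.
exact: (c11_dbound (fc2 i j)).
Qed.

(** The N covectors are handled together, as the entries of one vector-valued integrand. *)
Lemma second_variation_primitive (N : nat) (v : 'I_l -> R -> R) (V : R) (p : 'I_N -> R -> 'cV[R]_n) (y : R -> 'rV[R]_n) :
  0 <= V -> (forall i, measurable_fun setT (u i)) -> (forall i, measurable_fun setT (v i)) ->
  (forall i t, a <= t <= b -> `|v i t| <= V * om t) ->
  (forall k, Wlip om a b (p k)) -> Wlip om a b y ->
  exists be : 'I_N -> R -> R, forall k, [/\ be k a = 0, Wlip om a b (be k) &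
    {ae mu, forall t, a < t < b -> is_derive t (1 : R) (be k) (second_variation v (p k) y t)}].
Proof.
move=> V0 mu_ mv vle pW yW; have [xW xr xd] := xsol.
pose h1 i k t := pairing (p k t) (hess i (x t) (y t)).
pose h2 i k t := 2 * pairing (p k t) ('D_(y t) (f i) (x t)).
pose h (j : 'I_l + 'I_l) t : 'rV[R]_N :=
  match j with inl i => \row_k h1 i k t | inr i => \row_k h2 i k t end.
pose w' (j : 'I_l + 'I_l) := match j with inl i => u i | inr i => v i end.
have Wrow (F : 'I_N -> R -> R) : (forall k, Wlip om a b (F k)) -> Wlip om a b (fun t => \row_k F k t).
  move=> FW; rewrite (_ : (fun _ => _) = (fun t => \sum_k F k t *: delta_mx 0 k)).
    by apply: Wlip_sum => k; apply: WlipZV => //; exact: Wlip_cst.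
  by apply/funext => t; rewrite [LHS]row_sum_delta; apply: eq_bigr => k _; rewrite mxE.
have h1W i k : Wlip om a b (h1 i k).
  apply: Wlip_pairing => //; apply: Wlip_sum => j; apply: WlipZV => //.
    exact: Wlip_entry.
  exact: (Wlip_c11_derive om_weight ab K0 (fc2 i j)).
have h2W i k : Wlip om a b (h2 i k).
  apply: (@WlipZ _ _ R); apply: Wlip_pairing => //.
  exact: (Wlip_c11_derive om_weight ab K0 (fc i)).
have hW j : Wlip om a b (h j) by case: j => i; apply: Wrow.
have [M M0 hM] : exists2 M, 0 <= M & forall j t, a <= t <= b -> `|h j t| <= M.
  have hbound j : exists M, 0 <= M /\ forall t, a <= t <= b -> `|h j t| <= M.
    by have [M M0 hM] := wlip_bounded om_weight ab (hW j); exists M.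
  have [M hM] := choice hbound.
  exists (\sum_j M j); first by apply: sumr_ge0 => j _; exact: (hM j).1.
  move=> j t tab; apply: le_trans ((hM j).2 t tab) _.
  by rewrite (bigD1 j)//= lerDl sumr_ge0// => j' _; exact: (hM j').1.
have V1 : 0 <= 1 + V by rewrite addr_ge0.
have mw' j : measurable_fun setT (w' j) by case: j => i; [exact: mu_ | exact: mv].
have wle' j t : a <= t <= b -> `|w' j t| <= (1 + V) * om t.
  move=> tab; have := om0 t; have : 0 <= V * om t by rewrite mulr_ge0.
  by case: j => i /=; [have := ule i tab | have := vle i t tab]; rewrite mulrDl; lra.
have [F [Fa FD Fd]] := vector_primitive om_weight ab V1 M0 mw' wle' hW hM.
exists (fun k t => F t 0 k) => k; split.
- by rewrite Fa mxE.
- apply: Wlip_entry; exists (#|{: 'I_l + 'I_l}|%:R * (1 + V) * M) => //.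
  by rewrite !mulr_ge0.
apply: aeS Fd => t Fd /Fd {}Fd.
have := is_derive_entry 0 k Fd; congr is_derive.
rewrite big_sumType/= mxE !summxE; congr (_ + _); apply: eq_bigr => i _;
  by rewrite !mxE.
Qed.

Lemma sum_rearrange (I : finType) (a1 a2 a3 b1 b2 b3 c1 c2 d1 d2 d3 : I -> R) :
  (forall i, a1 i - a2 i + a3 i - (b1 i - b2 i + b3 i) - (c1 i + c2 i) = d1 i + d2 i + d3 i) ->
  \sum_i a1 i - \sum_i a2 i + \sum_i a3 i - (\sum_i b1 i - \sum_i b2 i + \sum_i b3 i)
    - (\sum_i c1 i + \sum_i c2 i) = \sum_i d1 i + \sum_i d2 i + \sum_i d3 i.
Proof.
by move=> H; rewrite -!sumrB -!big_split/= -!sumrB; apply: eq_bigr => i _; exact: H.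
Qed.

Lemma pairing_rearrange (q : 'cV[R]_n) (A1 A2 A3 A4 A5 H : 'rV[R]_n) (c d s : R) :
  (c + s * d) * pairing q A1 - c * pairing q A2 + d * pairing q A4
  - (c * pairing q A3 - c * pairing q A3 + d * pairing q A5)
  - (s * (c * pairing q H) + s * (d * (2 * pairing q A3))) =
  c * pairing q (A1 - A2 - s *: H) + d * (s * pairing q (A1 - A3)) +
  d * pairing q (A4 - A5 - s *: A3).
Proof. by rewrite !pairingBr !pairingZr; ring. Qed.

Lemma sum_scale_expand m (I : finType) (c : I -> R) (A B C E : I -> 'rV[R]_m) (s : R) :
  \sum_j c j *: (A j - B j - C j) + \sum_j c j *: (C j - s *: E j) =
  \sum_j c j *: A j - \sum_j c j *: B j - s *: \sum_j c j *: E j.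
Proof.
rewrite scaler_sumr -!sumrB -big_split/=; apply: eq_bigr => j _.
by rewrite !scalerBr addrA subrK !scalerA [s * _]mulrC.
Qed.

Lemma vector_rearrange m (A1 A2 A3 A4 A5 : 'rV[R]_m) :
  A1 - A2 - A5 = A1 - A3 - (A2 - A4) + (A3 - A4 - A5).
Proof. by apply/rowP => k; rewrite !mxE; ring. Qed.

(** Both pairings and s times [be] start equal to 0 at a, so it suffices to expand the time
    derivative of their difference in s: its terms of order one are exactly those of
    [second_variation]. *)
Lemma second_order_error (w v : 'I_l -> R -> R) p X Y y be V s P B D : 0 <= V ->
  (forall i t, w i t = u i t + s * v i t) ->
  (forall i t, a <= t <= b -> `|v i t| <= V * om t) ->
  covector_sol p -> local_sol om f x0 rho w a b X ->
  variational_sol om f a b w v X Y -> variational_sol om f a b u v x y ->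
  Y a = 0 -> y a = 0 -> be a = 0 -> Wlip om a b be ->
  {ae mu, forall t, a < t < b -> is_derive t (1 : R) be (second_variation v p y t)} ->
  (forall t, a <= t <= b -> `|p t| <= P) -> (forall t, a <= t <= b -> `|y t| <= B) ->
  (forall t, a <= t <= b -> `|X t - x t| <= D * `|s|) ->
  (forall t, a <= t <= b -> `|Y t - y t| <= D * `|s|) ->
  (forall t, a <= t <= b -> `|X t - x t - s *: y t| <= D * `|s| ^+ 2) ->
  `|pairing (p b) (Y b) - pairing (p b) (y b) - s * be b| <=
    l%:R * n%:R * P * (K * (D ^+ 2 + n%:R * D ^+ 2 * B + n%:R * D * B)
      + V * (K * D + K * B * D) + V * (K * D ^+ 2 + K * D)) * (W b - W a) * `|s| ^+ 2.
Proof.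
move=> V0 wE vle pcov [XW Xr Xd] Ysol ysol Ya ya bea beW bed pP yB XD YD XyD.
have [xW xr xd] := xsol.
have P0 : 0 <= P by apply: le_trans (pP a _); rewrite ?lexx.
have B0 : 0 <= B by apply: le_trans (yB a _); rewrite ?lexx.
set T1 := K * _; set T2 := K * D + _; set T3 := K * D ^+ 2 + _.
(* The sign of D is read off from D |s| >= 0, so s = 0 is treated apart; there Y b = y b. *)
have [s0|s0] := eqVneq s 0.
  have Yy : Y b = y b.
    apply/eqP; rewrite -subr_eq0 -normr_le0; apply: le_trans (YD b _) _; rewrite ?lexx ?ab//.
    by rewrite s0 normr0 mulr0.
  by rewrite Yy s0 mul0r subrr subr0 !normr0 expr0n/= mulr0.
have s_gt0 : 0 < `|s| by rewrite normr_gt0.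
have D0 : 0 <= D by rewrite -(pmulr_lge0 _ s_gt0); apply: le_trans (XD a _); rewrite ?lexx.
set C := l%:R * n%:R * P * (T1 + V * T2 + V * T3).
have T10 : 0 <= T1 by rewrite /T1; nneg.
have T20 : 0 <= T2 by rewrite /T2; nneg.
have T30 : 0 <= T3 by rewrite /T3; nneg.
have C0 : 0 <= C by rewrite /C; nneg.
pose E t := pairing (p t) (Y t) - pairing (p t) (y t) - s * be t.
have Ea : E a = 0 by rewrite /E Ya ya bea !pairing0r mulr0 !subrr.
have -> : pairing (p b) (Y b) - pairing (p b) (y b) - s * be b = E b - E a by rewrite Ea subr0.
have -> : C * (W b - W a) * `|s| ^+ 2 = C * `|s| ^+ 2 * W b - C * `|s| ^+ 2 * W a by ring.
apply: (@ftc_le _ _ a b E (fun t => C * `|s| ^+ 2 * W t)) => //.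
- apply: (Wlip_ac om_weight); apply: WlipB; last exact: (@WlipZ _ _ R).
  by apply: WlipB; apply: Wlip_pairing => //; [case: pcov|case: Ysol|case: pcov|case: ysol].
- by move=> r t _ rt _; apply: ler_wpM2l; [nneg | exact: W_mono].
apply: aeS2 (W_derive om_weight) (aeS2 (fun t A B => conj A B) bed (aeS2 (fun t A B => conj A B)
  (pairing_variational pcov Ysol) (pairing_variational pcov ysol))) => t Wd [bed' [Yd yd]] tab.
have tab' := open_closed tab.
have Xt := Xr t tab'; have xt := xr t tab'.
have fd i := c11_diff (fc i) xt; have fdX i := c11_diff (fc i) Xt.
(* The remainders multiplying u, s v and v. The first and the third are of order s^2; order s is
   enough for the second, which carries a factor s. *)
pose Z i := 'D_(Y t) (f i) (X t) - 'D_(Y t) (f i) (x t) - s *: hess i (x t) (y t).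
pose Z2 i := 'D_(Y t) (f i) (X t) - 'D_(y t) (f i) (x t).
pose Z3 i := f i (X t) - f i (x t) - s *: 'D_(y t) (f i) (x t).
exists (\sum_i u i t * pairing (p t) (Z i) + \sum_i v i t * (s * pairing (p t) (Z2 i))
    + \sum_i v i t * pairing (p t) (Z3 i)), (C * `|s| ^+ 2 * om t); split.
- apply: is_derive_eq.
    apply: is_deriveBF; first by apply: is_deriveBF; [exact: Yd | exact: yd].
    by apply: is_deriveZF; exact: bed'.
  rewrite /GRing.scale/= /second_variation mulrDr !mulr_sumr.
  apply: sum_rearrange => i; rewrite wE; exact: pairing_rearrange.
- exact: is_derive_scaleW.
have Xx := XD t tab'; have YyD := YD t tab'; have Xy := XyD t tab'; have yB' := yB t tab'.
have h2 : `|X t - x t| ^+ 2 <= D ^+ 2 * `|s| ^+ 2.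
  by rewrite -exprMn ler_pXn2r ?nnegrE//; nneg.
have hD b1 i : `|'D_b1 (f i) (X t) - 'D_b1 (f i) (x t)| <= K * `|b1| * (D * `|s|).
  by apply: le_trans (c11_dlip (fc i) b1 xt Xt) _; apply: ler_wpM2l => //; nneg.
have hZ i : `|Z i| <= T1 * `|s| ^+ 2.
  (* Three sources of error: replacing Y by y, the Taylor remainder of each partial derivative, and
     replacing X - x by s y. *)
  have -> : Z i = ('D_(Y t - y t) (f i) (X t) - 'D_(Y t - y t) (f i) (x t)) +
    \sum_j y t 0 j *: ('D_(delta_mx 0 j) (f i) (X t) - 'D_(delta_mx 0 j) (f i) (x t)
       - 'D_(X t - x t) ('D_(delta_mx 0 j) (f i)) (x t)) +
    \sum_j y t 0 j *: 'D_(X t - x t - s *: y t) ('D_(delta_mx 0 j) (f i)) (x t).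
    rewrite -addrA.
    rewrite [X in _ = _ + (_ + X)](eq_bigr (fun j => y t 0 j *:
        ('D_(X t - x t) ('D_(delta_mx 0 j) (f i)) (x t)
        - s *: 'D_(y t) ('D_(delta_mx 0 j) (f i)) (x t)))); last first.
      move=> j _; have c2 := c11_diff (fc2 i j) xt.
      by rewrite (deriveBr (X t - x t) (s *: y t) c2) (deriveZr s (y t) c2).
    rewrite (sum_scale_expand (fun j => y t 0 j) (fun j => 'D_(delta_mx 0 j) (f i) (X t))
      (fun j => 'D_(delta_mx 0 j) (f i) (x t))).
    rewrite -(derive_basis (y t) (fdX i)) -(derive_basis (y t) (fd i)).
    rewrite (deriveBr (Y t) (y t) (fdX i)) (deriveBr (Y t) (y t) (fd i)) /Z /hess.
    exact: vector_rearrange.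
  have e1 : `|'D_(Y t - y t) (f i) (X t) - 'D_(Y t - y t) (f i) (x t)| <= K * (D * `|s|) * (D * `|s|).
    by apply: le_trans (hD _ i) _; apply: ler_wpM2r; [nneg | apply: ler_wpM2l].
  have e2 j : `|'D_(delta_mx 0 j) (f i) (X t) - 'D_(delta_mx 0 j) (f i) (x t)
       - 'D_(X t - x t) ('D_(delta_mx 0 j) (f i)) (x t)| <= K * (D ^+ 2 * `|s| ^+ 2).
    by apply: le_trans (c11_taylor (fc2 i j) xt Xt) _; apply: ler_wpM2l.
  have e3 j : `|'D_(X t - x t - s *: y t) ('D_(delta_mx 0 j) (f i)) (x t)| <= K * (D * `|s| ^+ 2).
    by apply: le_trans (c11_dbound (fc2 i j) _ xt) _; apply: ler_wpM2l.
  have e2' := sum_scale_le (y t) (mulr_ge0 K0 (mulr_ge0 (exprn_ge0 2 D0) (exprn_ge0 2 (normr_ge0 s)))) e2.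
  have e3' := sum_scale_le (y t) (mulr_ge0 K0 (mulr_ge0 D0 (exprn_ge0 2 (normr_ge0 s)))) e3.
  apply: le_trans (ler_normD _ _) (le_trans (lerD (le_trans (ler_normD _ _) (lerD e1 e2')) e3') _).
  have -> : T1 * `|s| ^+ 2 = K * (D * `|s|) * (D * `|s|) +
     n%:R * (K * (D ^+ 2 * `|s| ^+ 2)) * B + n%:R * (K * (D * `|s| ^+ 2)) * B by rewrite /T1; ring.
  by apply: lerD; [apply: lerD => // |]; apply: ler_wpM2l => //; nneg.
have hZ2 i : `|Z2 i| <= T2 * `|s|.
  have -> : Z2 i = 'D_(Y t - y t) (f i) (X t) + ('D_(y t) (f i) (X t) - 'D_(y t) (f i) (x t)).
    by rewrite /Z2 deriveBr// addrA subrK.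
  apply: le_trans (ler_normD _ _) _; rewrite /T2 mulrDl -!mulrA mulrA; apply: lerD.
    by apply: le_trans (c11_dbound (fc i) _ Xt) _; rewrite -mulrA; apply: ler_wpM2l.
  apply: le_trans (hD _ i) _; rewrite -mulrA; apply: ler_wpM2l => //.
  by apply: ler_wpM2r => //; nneg.
have hZ3 i : `|Z3 i| <= T3 * `|s| ^+ 2.
  have -> : Z3 i = (f i (X t) - f i (x t) - 'D_(X t - x t) (f i) (x t))
      + 'D_(X t - x t - s *: y t) (f i) (x t).
    by rewrite /Z3 [in RHS](deriveBr (X t - x t))// deriveZr// addrA subrK.
  apply: le_trans (ler_normD _ _) _; rewrite /T3 mulrDl; apply: lerD.
    by apply: le_trans (c11_taylor (fc i) xt Xt) _; rewrite -mulrA; apply: ler_wpM2l.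
  by apply: le_trans (c11_dbound (fc i) _ xt) _; rewrite -mulrA; apply: ler_wpM2l.
have pP' := pP t tab'.
have q1 i : `|pairing (p t) (Z i)| <= n%:R * (P * (T1 * `|s| ^+ 2)) by apply: pairing_le2.
have q2 i : `|s * pairing (p t) (Z2 i)| <= `|s| * (n%:R * (P * (T2 * `|s|))).
  by rewrite normrM; apply: ler_wpM2l => //; apply: pairing_le2.
have q3 i : `|pairing (p t) (Z3 i)| <= n%:R * (P * (T3 * `|s| ^+ 2)) by apply: pairing_le2.
apply: le_trans (ler_normD _ _) (le_trans (lerD (le_trans (ler_normD _ _) (lerD
  (norm_sum_le (fun i => ule i tab') q1) (norm_sum_le (fun i => vle i t tab') q2)))
  (norm_sum_le (fun i => vle i t tab') q3)) _).
by rewrite card_ord; apply: le_of_eq; rewrite /C; ring.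
Qed.

End Covector.

(** * Variations of the test controls on a short interval *)

Section GohEstimate.
Context {R : realType} (om : R -> R).
Hypothesis om_weight : weight om.
Local Notation W := (primitive om).
Local Notation mu := (@lebesgue_measure R).

Definition two_controls (l : nat) (i1 i2 : 'I_l) (v1 v2 : R -> R) (i : 'I_l) (t : R) : R :=
  if i == i1 then v1 t else if i == i2 then v2 t else 0.

Lemma sum_two_controls (V : lmodType R) l (i1 i2 : 'I_l) v1 v2 t (F : 'I_l -> V) : i1 != i2 ->
  \sum_i two_controls i1 i2 v1 v2 i t *: F i = v1 t *: F i1 + v2 t *: F i2.
Proof.
move=> i12; rewrite (bigD1 i1)//= (bigD1 i2) 1?eq_sym//= /two_controls eqxx.
rewrite eq_sym (negbTE i12) eqxx big1 ?addr0// => i /andP[/negbTE -> /negbTE ->].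
by rewrite scale0r.
Qed.

Lemma sum_two_controls_mul l (i1 i2 : 'I_l) v1 v2 t (F : 'I_l -> R) : i1 != i2 ->
  \sum_i two_controls i1 i2 v1 v2 i t * F i = v1 t * F i1 + v2 t * F i2.
Proof. exact: (@sum_two_controls R^o). Qed.

Definition single_control (l : nat) (i1 : 'I_l) (v1 : R -> R) (i : 'I_l) (t : R) : R :=
  if i == i1 then v1 t else 0.

Lemma sum_single_control_mul l (i1 : 'I_l) v1 t (F : 'I_l -> R) :
  \sum_i single_control i1 v1 i t * F i = v1 t * F i1.
Proof.
rewrite (bigD1 i1)//= /single_control eqxx big1 ?addr0// => i /negbTE ->.
by rewrite mul0r.
Qed.

Lemma id_wlip a b : a <= b -> (forall t, a <= t <= b -> 1 <= om t) -> wlip om 1 a b (@id R).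
Proof.
move=> ab om1; apply: ftc_wlip => //.
  move=> e e0; exists e => // m s t st _; rewrite (eq_bigr (fun i : 'I_m => `|t i - s i|))// => i _.
  by have [_ [si _]] := st i (ltn_ord i); rewrite ger0_norm// subr_ge0.
apply: aeS (W_derive om_weight) => t _ tab; exists 1; first exact: is_derive_id.
by rewrite normr1 mul1r om1//; case/andP: tab => /ltW -> /ltW ->.
Qed.

Lemma derive_Wlip (V : normedModType R) a b C (F dF : R -> V) : a <= b -> 0 <= C ->
  (forall t, a <= t <= b -> 1 <= om t) ->
  (forall t, a <= t <= b -> is_derive t (1 : R) F (dF t)) ->
  (forall t, a <= t <= b -> `|dF t| <= C) -> Wlip om a b F.
Proof.
move=> ab C0 om1 Fd dFC; exists C => // s t as_ st tb.
have CW : C * (t - s) <= C * (W t - W s).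
  rewrite ler_wpM2l//; have := id_wlip ab om1 as_ st tb.
  by rewrite mul1r ger0_norm// subr_ge0.
apply: le_trans CW; apply/ler_addgt0Pr => e e0.
pose d := e / (t - s + 1).
have ts1 : 0 < t - s + 1 by rewrite ltr_wpDl// subr_ge0.
have d0 : 0 < d by rewrite divr_gt0.
have := @increment_le R V s t F (fun x : R => (C + d) * x) st.
have -> : (C + d) * t - (C + d) * s = C * (t - s) + d * (t - s) by ring.
move=> H; apply: le_trans (H _) _ => [x /andP[sx xt]|]; last first.
  rewrite lerD2l /d mulrAC ler_pdivrMr// ler_wpM2l ?(ltW e0)//; lra.
have xab : a <= x <= b by rewrite (le_trans as_)// (le_trans xt).
have Cd : is_derive x (1 : R) (fun s : R => C * s) C.
  by have := is_deriveZF C (is_derive_id x (1 : R)); rewrite /GRing.scale/= mulr1.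
have [r r0 rP] := derive_increment_le (Fd x xab) Cd (dFC x xab) d0.
exists r => // y y' _ yx xy' _ h1 h2; apply: le_trans (rP _ _ yx xy' h1 h2) _.
by rewrite !mulrDl; lra.
Qed.

Context {n l : nat} (f : 'I_l -> 'rV[R]_n -> 'rV[R]_n) (x0 : 'rV[R]_n) (rho K : R).
Hypothesis (K0 : 0 <= K) (fc : forall i, c11 (f i) x0 rho K).
Hypothesis fc2 : forall i j, c11 ('D_(delta_mx 0 j) (f i)) x0 rho K.
Variables (a b : R).
Hypothesis (ab : a < b).
Local Notation dW := (W b - W a).
Hypothesis small : l%:R * 2 * K * dW <= 1 / 4.
Variables (u : 'I_l -> R -> R) (x : R -> 'rV[R]_n).
Hypothesis ule : forall i t, a <= t <= b -> `|u i t| <= om t.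
Hypothesis om1 : forall t, a <= t <= b -> 1 <= om t.
Hypothesis xsol : local_sol om f x0 rho u a b x.
Variables (i1 i2 : 'I_l) (i12 : i1 != i2).
Variables (p : R -> 'cV[R]_n) (P Cp Cx : R).
Hypothesis pcov : covector_sol om f a b u x p.
Hypothesis pP : forall t, a <= t <= b -> `|p t| <= P.
Hypothesis pC : wlip om Cp a b p.
Hypothesis xC : wlip om Cx a b x.
Hypothesis Cp0 : 0 <= Cp.
Hypothesis Cx0 : 0 <= Cx.

Let ab' : a <= b. Proof. exact: ltW. Qed.

Let open_closed t : a < t < b -> a <= t <= b.
Proof. by move=> /andP[/ltW -> /ltW ->]. Qed.

Let om0 t : 0 <= om t. Proof. by case: om_weight. Qed.

Let Wab : 0 <= dW. Proof. exact: W_sub_ge0. Qed.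

Let wlip_dW (V : normedModType R) C (F : R -> V) t : 0 <= C -> wlip om C a b F ->
  a <= t <= b -> `|F t - F a| <= C * dW.
Proof.
move=> C0 FC /andP[at_ tb]; apply: le_trans (FC _ _ (lexx a) at_ tb) _.
by rewrite ler_wpM2l// lerD2r W_mono.
Qed.

Let P0 : 0 <= P.
Proof. by apply: le_trans (pP (t := a) _); rewrite ?lexx. Qed.

Lemma is_derive_linear (c t : R) : is_derive t (1 : R) (fun s : R => c * s) c.
Proof. by have := is_deriveZF c (is_derive_id t (1 : R)); rewrite /GRing.scale/= mulr1. Qed.

(** The terms in u cancel by adjointness, so the pairing at b is the mean over [a, b] of the pairing
    of p with f_i1 along x. Its distance to the value at a is the oscillation of p and of the field,
    both Lipschitz for the clock W. *)
Lemma constant_control_estimate y :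
  variational_sol om f a b u (single_control i1 (fun=> (b - a)^-1)) x y -> y a = 0 ->
  `|pairing (p b) (y b) - pairing (p a) (f i1 (x a))| <=
    n%:R * (Cp * K + P * (K * Cx)) * dW.
Proof.
move=> ysol ya; have [xW xr xd] := xsol.
have d0 : 0 < b - a by rewrite subr_gt0.
have dV0 : 0 <= (b - a)^-1 by rewrite invr_ge0 ltW.
set c0 := pairing (p a) (f i1 (x a)).
set C := n%:R * _.
have C0 : 0 <= C by rewrite /C; nneg.
pose E t := pairing (p t) (y t) - (b - a)^-1 * c0 * t.
have -> : pairing (p b) (y b) - c0 = E b - E a.
  rewrite /E ya pairing0r; set q := pairing _ _.
  have -> : q - (b - a)^-1 * c0 * b - (0 - (b - a)^-1 * c0 * a) =
    q - (b - a)^-1 * (b - a) * c0 by ring.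
  by rewrite mulVf ?gt_eqF// mul1r.
have -> : C * dW = (b - a)^-1 * (C * dW) * b - (b - a)^-1 * (C * dW) * a.
  by rewrite -mulrBr [RHS]mulrAC mulVf ?gt_eqF// mul1r.
apply: (@ftc_le _ _ a b E (fun t => (b - a)^-1 * (C * dW) * t)) => //.
- apply: (Wlip_ac om_weight); apply: WlipB.
    by apply: Wlip_pairing => //; [case: pcov | case: ysol].
  apply: (@WlipZ _ _ R); exists 1 => //; exact: id_wlip.
- by move=> s t _ st _; apply: ler_wpM2l => //; nneg.
apply: aeS (pairing_variational pcov ysol) => t yd tab; have tab' := open_closed tab.
eexists; exists ((b - a)^-1 * (C * dW)); split.
- exact: (is_deriveBF (yd tab) (is_derive_linear _ _)).
- exact: is_derive_linear.
- rewrite subrr add0r sum_single_control_mul -mulrBr normrM ger0_norm//.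
  apply: ler_wpM2l => //.
  have -> : pairing (p t) (f i1 (x t)) - c0 = pairing (p t - p a) (f i1 (x t)) +
      pairing (p a) (f i1 (x t) - f i1 (x a)).
    by rewrite /c0 pairingBl pairingBr addrA subrK.
  have xa : `|x a - x0| <= rho by apply: xr; rewrite lexx.
  have xt := xr t tab'.
  have h1 := pairing_le2 (wlip_dW Cp0 pC tab') (c11_bound (fc i1) xt).
  have h2 : `|pairing (p a) (f i1 (x t) - f i1 (x a))| <= n%:R * (P * (K * (Cx * dW))).
    apply: pairing_le2; first by apply: pP; rewrite lexx.
    apply: le_trans (c11_lip (fc i1) xa xt) _; apply: ler_wpM2l => //.
    exact: wlip_dW.
  apply: le_trans (ler_normD _ _) (le_trans (lerD h1 h2) _).
  by apply: le_of_eq; rewrite /C; ring.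
Qed.

Variables (w1 w2 v1 v2 A : R -> R) (B : R) (y : R -> 'rV[R]_n) (be : R -> R).
Hypothesis B0 : 0 <= B.
Hypothesis w1d : forall t, a <= t <= b -> is_derive t (1 : R) w1 (v1 t).
Hypothesis w2d : forall t, a <= t <= b -> is_derive t (1 : R) w2 (v2 t).
Hypothesis Ad : forall t, a <= t <= b -> is_derive t (1 : R) A (v1 t * w2 t).
Hypothesis (w1a : w1 a = 0) (w2a : w2 a = 0) (w1b : w1 b = 0) (w2b : w2 b = 0).
Hypothesis w2B : forall t, a <= t <= b -> `|w2 t| <= B.
Hypothesis v1B : forall t, a <= t <= b -> `|v1 t| <= (b - a)^-1 * B.
Hypothesis v2B : forall t, a <= t <= b -> `|v2 t| <= (b - a)^-1 * B.
Hypothesis ysol : variational_sol om f a b u (two_controls i1 i2 v1 v2) x y.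
Hypothesis ya : y a = 0.
Hypothesis bea : be a = 0.
Hypothesis beW : Wlip om a b be.
Hypothesis bed : {ae mu, forall t, a < t < b -> is_derive t (1 : R) be
  (second_variation f u x (two_controls i1 i2 v1 v2) p y t)}.

Let d0 : 0 < b - a. Proof. by rewrite subr_gt0. Qed.
Let dV0 : 0 <= (b - a)^-1. Proof. by rewrite invr_ge0 ltW. Qed.
Let xr t : a <= t <= b -> `|x t - x0| <= rho. Proof. by case: xsol => _ + _; apply. Qed.
Let aab : a <= a <= b. Proof. by rewrite lexx. Qed.

(** Controls of size B / (b - a) have integral O(B), whatever the length of the interval. In the
    constant 4, one factor 2 comes from Gronwall and one from the two controls. *)
Lemma goh_y_bound t : a <= t <= b -> `|y t| <= 4 * K * B.
Proof.
move=> tab; have [yW yd] := ysol.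
have := @gronwall_short _ _ om_weight _ a b (l%:R * K) y (fun t => 2 * K * ((b - a)^-1 * B) * t) ab' yW.
rewrite ya normr0 add0r -mulrBr.
have -> : 2 * (2 * K * ((b - a)^-1 * B) * (b - a)) = 4 * K * B * ((b - a)^-1 * (b - a)) by ring.
rewrite mulVf ?gt_eqF// mulr1; apply => //; first by nneg.
- have := small; have -> : l%:R * 2 * K * dW = 2 * (l%:R * K * dW) by ring.
  by move: (_ * dW) => c; lra.
- by move=> s r _ sr _; apply: ler_wpM2l => //; nneg.
apply: aeS yd => s yd sab; have sab' := open_closed sab.
eexists; exists (2 * K * ((b - a)^-1 * B)); split; [exact: yd | exact: is_derive_linear |].
rewrite sum_two_controls//; apply: le_trans (ler_normD _ _) _; apply: lerD.
  apply: le_trans (norm_sum_scale_le (fun i => ule i sab')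
    (fun i => c11_dbound (fc i) (y s) (xr sab'))) _.
  by rewrite card_ord; apply: le_of_eq; ring.
have -> : 2 * K * ((b - a)^-1 * B) = (b - a)^-1 * B * K + (b - a)^-1 * B * K by ring.
apply: le_trans (ler_normD _ _) _; rewrite !normrZ.
by apply: lerD; apply: ler_pM => //; rewrite ?v1B ?v2B//; exact: (c11_bound (fc _) (xr sab')).
Qed.

Let R1 := l%:R * (4 * K ^+ 2) + 2 * K * Cx.

(** Up to O(B dW) the two fields may be frozen at x(a), and the term in u may be dropped because y
    is O(B) and u is bounded by om. What remains integrates explicitly. *)
Lemma goh_y_error t : a <= t <= b ->
  `|y t - (w1 t *: f i1 (x a) + w2 t *: f i2 (x a))| <= R1 * B * dW.
Proof.
move=> tab; have [at_ tb] := andP tab; have [yW yd] := ysol.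
pose r t := y t - (w1 t *: f i1 (x a) + w2 t *: f i2 (x a)).
have ra : r a = 0 by rewrite /r ya w1a w2a !scale0r addr0 subrr.
have w1W : Wlip om a b w1 by apply: (derive_Wlip ab' _ om1 w1d v1B); nneg.
have w2W : Wlip om a b w2 by apply: (derive_Wlip ab' _ om1 w2d v2B); nneg.
have rW : Wlip om a b r.
  apply: WlipB => //; apply: WlipD; apply: WlipZV => //; exact: Wlip_cst.
pose k1 := l%:R * (4 * K ^+ 2) * B; pose k2 := (b - a)^-1 * (2 * K * Cx * B * dW).
have k10 : 0 <= k1 by rewrite /k1; nneg.
have k20 : 0 <= k2 by rewrite /k2; nneg.
have := @ftc_le _ _ a t r (fun t => k1 * W t + k2 * t) at_.
rewrite ra subr0 => H; apply: le_trans (H _ _ _) _.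
- apply: (Wlip_ac om_weight); exact: WlipS rW.
- by move=> s s' _ ss' _; apply: lerD; apply: ler_wpM2l => //; exact: W_mono.
- apply: aeS2 yd (W_derive om_weight) => s yd Ws /andP[as_ st].
  have sab : a < s < b by rewrite as_ (lt_le_trans st).
  have sab' := open_closed sab.
  eexists; exists (k1 * om s + k2); split.
  + apply: is_deriveBF; first exact: yd.
    exact: (is_deriveDF (is_deriveZV (w1d sab') (is_derive_cst (f i1 (x a)) s (1 : R)))
      (is_deriveZV (w2d sab') (is_derive_cst (f i2 (x a)) s (1 : R)))).
  + exact: (is_deriveDF (is_derive_scaleW k1 Ws) (is_derive_linear k2 s)).
  rewrite sum_two_controls// !scaler0 !addr0.
  have -> (q z1 z2 z3 z4 : 'rV[R]_n) (c1 c2 : R) : q + (c1 *: z1 + c2 *: z2) - (c1 *: z3 + c2 *: z4)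
      = q + (c1 *: (z1 - z3) + c2 *: (z2 - z4)).
    by apply/rowP => k; rewrite !mxE; ring.
  apply: le_trans (ler_normD _ _) _; apply: lerD.
    have dY i : `|'D_(y s) (f i) (x s)| <= K * (4 * K * B).
      apply: le_trans (c11_dbound (fc i) (y s) (xr sab')) _; apply: ler_wpM2l => //.
      exact: goh_y_bound.
    apply: le_trans (norm_sum_scale_le (fun i => ule i sab') dY) _.
    by rewrite card_ord; apply: le_of_eq; rewrite /k1; ring.
  have fl i : `|f i (x s) - f i (x a)| <= K * (Cx * dW).
    apply: le_trans (c11_lip (fc i) (xr aab) (xr sab')) _; apply: ler_wpM2l => //.
    exact: wlip_dW.
  have -> : k2 = (b - a)^-1 * B * (K * (Cx * dW)) + (b - a)^-1 * B * (K * (Cx * dW)).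
    by rewrite /k2; ring.
  apply: le_trans (ler_normD _ _) _; rewrite !normrZ.
  by apply: lerD; apply: ler_pM => //; rewrite ?v1B ?v2B.
have h1 : k1 * (W t - W a) <= k1 * dW by apply: ler_wpM2l => //; rewrite lerD2r W_mono.
have h2 : k2 * (t - a) <= k2 * (b - a) by apply: ler_wpM2l => //; rewrite lerD2r.
have h3 : k2 * (b - a) = 2 * K * Cx * B * dW.
  by rewrite /k2 mulrAC mulVf ?gt_eqF// mul1r.
have -> : R1 * B * dW = k1 * dW + k2 * (b - a) by rewrite h3 /R1 /k1; ring.
lra.
Qed.

(** The symmetric part of this matrix contributes a total derivative; its antisymmetric part is the
    bracket. *)
Let M i j := pairing (p a) ('D_(f j (x a)) (f i) (x a)).
Let Q := n%:R * (Cp * (4 * K ^+ 2) + P * (4 * K ^+ 2 * Cx) + P * (K * R1)).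


(** The three summands of [Q] pay for replacing p(t) by p(a), x(t) by x(a), and y by its explicit
    leading part. *)
Lemma goh_linear_error i t : a <= t <= b ->
  `|pairing (p t) ('D_(y t) (f i) (x t)) - (w1 t * M i i1 + w2 t * M i i2)| <= Q * B * dW.
Proof.
move=> tab; have xt := xr tab; have xa := xr aab.
set r := y t - (w1 t *: f i1 (x a) + w2 t *: f i2 (x a)).
have -> : pairing (p t) ('D_(y t) (f i) (x t)) - (w1 t * M i i1 + w2 t * M i i2) =
    pairing (p t - p a) ('D_(y t) (f i) (x t)) +
    pairing (p a) ('D_(y t) (f i) (x t) - 'D_(y t) (f i) (x a)) +
    pairing (p a) ('D_r (f i) (x a)).
  have fda := c11_diff (fc i) xa.
  rewrite /r (deriveBr _ _ fda) (deriveDr _ _ fda) (deriveZr _ _ fda) (deriveZr _ _ fda).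
  rewrite /M; move: ('D_(y t) (f i) (x t)) ('D_(y t) (f i) (x a))
    ('D_(f i1 (x a)) (f i) (x a)) ('D_(f i2 (x a)) (f i) (x a)) => z1 z2 z3 z4.
  by rewrite pairingBl !pairingBr pairingDr !pairingZr; ring.
have yB := goh_y_bound tab.
have h1 : `|pairing (p t - p a) ('D_(y t) (f i) (x t))| <= n%:R * (Cp * dW * (K * (4 * K * B))).
  apply: pairing_le2; first exact: wlip_dW.
  by apply: le_trans (c11_dbound (fc i) (y t) xt) _; apply: ler_wpM2l.
have h2 : `|pairing (p a) ('D_(y t) (f i) (x t) - 'D_(y t) (f i) (x a))| <=
    n%:R * (P * (K * (4 * K * B) * (Cx * dW))).
  apply: pairing_le2; first exact: pP.
  apply: le_trans (c11_dlip (fc i) (y t) xa xt) _.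
  by apply: ler_pM; [nneg | nneg | apply: ler_wpM2l | exact: wlip_dW].
have h3 : `|pairing (p a) ('D_r (f i) (x a))| <= n%:R * (P * (K * (R1 * B * dW))).
  apply: pairing_le2; first exact: pP.
  apply: le_trans (c11_dbound (fc i) r xa) _; apply: ler_wpM2l => //.
  exact: goh_y_error.
apply: le_trans (ler_normD _ _) (le_trans (lerD (le_trans (ler_normD _ _) (lerD h1 h2)) h3) _).
by apply: le_of_eq; rewrite /Q; ring.
Qed.

(** The Hessian term is multiplied by u and is only O(B^2 dW). In the other one p, x and y are
    replaced by their frozen forms, with controls of size B / (b - a) integrated over a length b -
    a, so the error is again O(B^2 dW). *)
Lemma goh_estimate :
  `|be b - 2 * (M i1 i2 - M i2 i1) * (A b - A a)| <=
    (l%:R * n%:R * P * (n%:R * (16 * K ^+ 3)) + 4 * Q) * B ^+ 2 * dW.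
Proof.
have Q0 : 0 <= Q by rewrite /Q; nneg.
pose N t := M i1 i1 * (w1 t * w1 t) + M i2 i2 * (w2 t * w2 t) + 2 * M i2 i1 * (w1 t * w2 t) +
  2 * (M i1 i2 - M i2 i1) * A t.
pose k1 := l%:R * n%:R * P * (n%:R * (16 * K ^+ 3)) * B ^+ 2.
pose k2 := (b - a)^-1 * (4 * Q * B ^+ 2 * dW).
have k10 : 0 <= k1 by rewrite /k1; nneg.
have k20 : 0 <= k2 by rewrite /k2; nneg.
pose E t := be t - N t.
have -> : be b - 2 * (M i1 i2 - M i2 i1) * (A b - A a) = E b - E a.
  rewrite /E /N bea w1a w2a w1b w2b.
  by move: (M i1 i1) (M i2 i2) (M i1 i2) (M i2 i1) (A a) (A b) (be b) => *; ring.
have -> : (l%:R * n%:R * P * (n%:R * (16 * K ^+ 3)) + 4 * Q) * B ^+ 2 * dW =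
    (k1 * W b + k2 * b) - (k1 * W a + k2 * a).
  have h : k2 * (b - a) = 4 * Q * B ^+ 2 * dW by rewrite /k2 mulrAC mulVf ?gt_eqF// mul1r.
  have -> : k1 * W b + k2 * b - (k1 * W a + k2 * a) = k1 * dW + k2 * (b - a) by ring.
  by rewrite h /k1; ring.
have w1W : Wlip om a b w1 by apply: (derive_Wlip ab' _ om1 w1d v1B); nneg.
have w2W : Wlip om a b w2 by apply: (derive_Wlip ab' _ om1 w2d v2B); nneg.
have AW : Wlip om a b A.
  apply: (derive_Wlip (C := (b - a)^-1 * B * B) ab' _ om1 Ad); first by nneg.
  by move=> t tab; rewrite normrM; apply: ler_pM => //; [exact: v1B | exact: w2B].
apply: (@ftc_le _ _ a b E (fun t => k1 * W t + k2 * t)) => //.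
- apply: (Wlip_ac om_weight); apply: WlipB => //.
  have sc c (F : R -> R) : Wlip om a b F -> Wlip om a b (fun t => c * F t) by exact: (@WlipZ _ _ R).
  apply: WlipD; last exact: (sc).
  by apply: WlipD; [apply: WlipD|]; apply: (sc); apply: WlipM.
- by move=> s s' _ ss' _; apply: lerD; apply: ler_wpM2l => //; exact: W_mono.
apply: aeS2 bed (W_derive om_weight) => t bed' Wd tab; have tab' := open_closed tab.
exists (second_variation f u x (two_controls i1 i2 v1 v2) p y t -
  2 * (v1 t * (w1 t * M i1 i1 + w2 t * M i1 i2) + v2 t * (w1 t * M i2 i1 + w2 t * M i2 i2))),
  (k1 * om t + k2); split.
- apply: is_deriveBF; first exact: bed'.
  have d1 := w1d tab'; have d2 := w2d tab'; have dA := Ad tab'.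
  have sc c (F : R -> R) dF : is_derive t (1 : R) F dF -> is_derive t (1 : R) (fun t => c * F t) (c * dF).
    exact: is_deriveZF.
  have H := is_deriveDF (is_deriveDF (is_deriveDF (sc (M i1 i1) _ _ (is_deriveMR d1 d1))
    (sc (M i2 i2) _ _ (is_deriveMR d2 d2))) (sc (2 * M i2 i1) _ _ (is_deriveMR d1 d2)))
    (sc (2 * (M i1 i2 - M i2 i1)) _ _ dA).
  apply: (is_derive_eq H).
  by move: (M i1 i1) (M i2 i2) (M i1 i2) (M i2 i1) (w1 t) (w2 t) (v1 t) (v2 t) => *; ring.
- exact: (is_deriveDF (is_derive_scaleW k1 Wd) (is_derive_linear k2 t)).
rewrite /second_variation sum_two_controls_mul// -addrA.
have -> (z1 z2 z3 z4 : R) : v1 t * (2 * z1) + v2 t * (2 * z2) - 2 * (v1 t * z3 + v2 t * z4) =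
    2 * (v1 t * (z1 - z3)) + 2 * (v2 t * (z2 - z4)) by ring.
apply: le_trans (ler_normD _ _) _; apply: lerD.
  have yB := goh_y_bound tab'.
  have hH i : `|pairing (p t) (hess f i (x t) (y t))| <= n%:R * (P * (n%:R * (K * (4 * K * B)) * (4 * K * B))).
    apply: pairing_le2; first exact: pP.
    apply: le_trans (hess_le K0 fc2 i (y t) (xr tab')) _.
    by apply: ler_pM => //; [nneg | apply: ler_wpM2l => //; apply: ler_wpM2l].
  apply: le_trans (norm_sum_le (fun i => ule i tab') hH) _.
  by rewrite card_ord; apply: le_of_eq; rewrite /k1; ring.
have -> : k2 = 2 * ((b - a)^-1 * B * (Q * B * dW)) + 2 * ((b - a)^-1 * B * (Q * B * dW)).
  by rewrite /k2; ring.
have hv (c z q : R) : `|c| <= (b - a)^-1 * B -> `|z| <= q ->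
    `|2 * (c * z)| <= 2 * ((b - a)^-1 * B * q).
  by move=> cB zq; rewrite !normrM ger0_norm//; apply: ler_wpM2l => //; apply: ler_pM.
exact: le_trans (ler_normD _ _) (lerD (hv _ _ _ (v1B tab') (goh_linear_error i1 tab'))
  (hv _ _ _ (v2B tab') (goh_linear_error i2 tab'))).
Qed.

End GohEstimate.

(** * Solutions on the manifold *)

Section Charts.
Context {R : realType} {n : nat} {M : smooth_manifold R n}.
Implicit Types (c : chart R n M) (p : M).

Definition overlap c c' : set 'rV[R]_n := c @` (dom c `&` dom c').

Lemma nbhs_codom c p : dom c p -> nbhs (c p) (c @` dom c).
Proof. by move=> cp; apply: open_nbhs_nbhs; split; [exact: open_codom | exists p]. Qed.

Lemma nbhs_overlap c c' p : dom c p -> dom c' p -> nbhs (c p) (overlap c c').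
Proof.
move=> cp c'p.
have h1 := nbhs_codom cp.
have h2 : nbhs (c p) (param c @^-1` dom c').
  have /= := @continuous_param _ _ _ c (c p) (imageP c cp); apply.
  by rewrite coordsK//; apply: open_nbhs_nbhs; split; [exact: open_dom|].
apply: filterS2 h1 h2 => _ [p' cp' <-] /=; rewrite coordsK// => c'p'.
by exists p'.
Qed.

Lemma transition_differentiable c c' p : atlas c -> atlas c' -> dom c p -> dom c' p ->
  differentiable (c' \o param c) (c p).
Proof.
move=> ac ac' cp c'p; have := transition_smooth ac ac' => /(_ [::] (c p)) /=; apply.
by exists p.
Qed.

Lemma mulmx_change_of_chart c c' p (v : 'rV[R]_n) : atlas c -> atlas c' -> dom c p -> dom c' p ->
  v *m change_of_chart c c' p = 'D_v (c' \o param c) (c p).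
Proof. by move=> ac ac' cp c'p; rewrite deriveEjacobian//; exact: transition_differentiable. Qed.

#[local] Opaque change_of_chart.

(** The chain rule for transition maps. Vectors are rows, so matrices multiply in the order in which
    the charts are traversed. *)
Lemma change_of_chart_cocycle c c' c'' p : atlas c -> atlas c' -> atlas c'' ->
  dom c p -> dom c' p -> dom c'' p ->
  change_of_chart c c' p *m change_of_chart c' c'' p = change_of_chart c c'' p.
Proof.
move=> ac ac' ac'' cp c'p c''p; apply/row_matrixP => i.
rewrite rowE [RHS]rowE.
apply: etrans (mulmxA _ _ _) _.
apply: etrans (congr1 (fun z => z *m change_of_chart c' c'' p)
  (mulmx_change_of_chart (delta_mx 0 i) ac ac' cp c'p)) _.
apply: etrans (mulmx_change_of_chart _ ac' ac'' c'p c''p) _.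
apply: etrans _ (esym (mulmx_change_of_chart (delta_mx 0 i) ac ac'' cp c''p)).
have d1 := transition_differentiable ac ac' cp c'p.
have d2 := transition_differentiable ac' ac'' c'p c''p.
have E : c' p = (c' \o param c) (c p) by rewrite /= coordsK.
have -> : 'D_(delta_mx 0 i) (c'' \o param c) (c p) =
    'D_(delta_mx 0 i) ((c'' \o param c') \o (c' \o param c)) (c p).
  apply: near_eq_derive; apply: filterS (nbhs_overlap cp c'p) => _ [p' [cp' c'p'] <-] /=.
  by rewrite (coordsK cp') (coordsK c'p').
rewrite E in d2 *.
have d12 : differentiable ((c'' \o param c') \o (c' \o param c)) (c p).
  by apply: differentiable_comp.
by rewrite (deriveE _ d12) (diff_comp d1 d2) (deriveE _ d1) (deriveE _ d2).
Qed.

Lemma change_of_chart_id c p : atlas c -> dom c p -> change_of_chart c c p = 1%:M.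
Proof.
move=> ac cp; apply/row_matrixP => i; rewrite !rowE mulmx1 (mulmx_change_of_chart _ ac ac cp cp).
apply: etrans _ (derive_id (c p) (delta_mx 0 i)).
apply: near_eq_derive; apply: filterS (nbhs_codom cp) => _ [p' cp' <-] /=.
by rewrite coordsK.
Qed.

Lemma vfield_in_coords c (Y : M -> 'rV[R]_n) p : dom c p ->
  vfield_in c Y (c p) = tangent_in c p (Y p).
Proof. by move=> cp; rewrite /vfield_in coordsK. Qed.

Lemma tangent_in_change c c' p (v : 'rV[R]_n) : atlas c -> atlas c' -> dom c p -> dom c' p ->
  tangent_in c p v *m change_of_chart c c' p = tangent_in c' p v.
Proof.
move=> ac ac' cp c'p; rewrite /tangent_in -mulmxA change_of_chart_cocycle//.
  exact: chart_at_atlas.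
exact: mem_chart_at.
Qed.

Lemma tangent_in_chart_at p (v : 'rV[R]_n) : tangent_in (chart_at p) p v = v.
Proof.
by rewrite /tangent_in change_of_chart_id ?mulmx1//; [exact: chart_at_atlas | exact: mem_chart_at].
Qed.

Lemma cotangent_in_chart_at p (lam : 'cV[R]_n) : cotangent_in (chart_at p) p lam = lam.
Proof.
by rewrite /cotangent_in change_of_chart_id ?mul1mx//; [exact: chart_at_atlas | exact: mem_chart_at].
Qed.

Lemma pairing_change c c' p lam (v : 'rV[R]_n) : atlas c -> atlas c' -> dom c p -> dom c' p ->
  pairing (cotangent_in c' p lam) (v *m change_of_chart c c' p) = pairing (cotangent_in c p lam) v.
Proof.
move=> ac ac' cp c'p; rewrite /pairing /cotangent_in mulmxA -[v *m _ *m _]mulmxA.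
rewrite change_of_chart_cocycle -?mulmxA//; first exact: chart_at_atlas.
exact: mem_chart_at.
Qed.

Lemma pairing_tangent c p lam (v : 'rV[R]_n) : atlas c -> dom c p ->
  pairing (cotangent_in c p lam) (tangent_in c p v) = pairing lam v.
Proof.
move=> ac cp; have := @pairing_change (chart_at p) c p lam v.
rewrite cotangent_in_chart_at; apply => //; first exact: chart_at_atlas.
exact: mem_chart_at.
Qed.

Lemma is_derive_change c c' (q : R -> M) t xi : atlas c -> atlas c' ->
  dom c (q t) -> dom c' (q t) -> (\forall s \near t, dom c (q s)) ->
  is_derive t (1 : R) (c \o q) xi ->
  is_derive t (1 : R) (c' \o q) (xi *m change_of_chart c c' (q t)).
Proof.
move=> ac ac' cq c'q ncq cqd; rewrite (mulmx_change_of_chart _ ac ac' cq c'q).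
apply: (near_eq_is_derive (f := (c' \o param c) \o (c \o q))).
  by apply: filterS ncq => s cs /=; rewrite coordsK.
by apply: is_derive_chain => //; exact: transition_differentiable.
Qed.

End Charts.

Section ManifoldSolution.
Context {R : realType} {n l : nat} {M : smooth_manifold R n}.
Variable (om : R -> R).
Hypothesis om_weight : weight om.
Local Notation W := (primitive om).
Local Notation mu := (@lebesgue_measure R).
Variable (X : 'I_l -> M -> 'rV[R]_n).
Implicit Types (c : chart R n M) (q : R -> M) (w : 'I_l -> R -> R) (a b t : R).

Lemma ae_neq (a : R) : {ae mu, forall t, t != a}.
Proof.
exists [set a]; split; [exact: measurable_set1 | exact: lebesgue_measure_set1|].
by move=> t /= /negP; rewrite negbK => /eqP.
Qed.

(** A condition on a neighbourhood of one time, which transition maps preserve by their local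
    Lipschitz bounds; membership in the chart domain is part of it and provides continuity of q. *)
Definition wlip_at c q a b t : Prop := exists r C, [/\ 0 < r, 0 <= C &
  forall s s', a <= s -> s <= s' -> s' <= b -> t - r < s -> s' < t + r ->
    [/\ dom c (q s), dom c (q s') & `|c (q s') - c (q s)| <= C * (W s' - W s)]].

(** The working notion of solution. Replacing absolute continuity on intervals inside a chart by
    local Lipschitz bounds for the clock W makes restriction, gluing and change of chart direct. It
    is equivalent to [trajectory] for controls bounded by 2 om. *)
Definition msol w a b q : Prop :=
  (forall t c, a <= t <= b -> atlas c -> dom c (q t) -> wlip_at c q a b t) /\
  {ae mu, forall t, a < t < b ->
     is_derive t (1 : R) (chart_at (q t) \o q) (\sum_i w i t *: X i (q t))}.

Lemma wlip_at_dist c q a b t e : a <= t <= b -> wlip_at c q a b t -> 0 < e ->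
  exists2 r, 0 < r & forall s, a <= s <= b -> t - r < s < t + r ->
    dom c (q s) /\ `|c (q s) - c (q t)| <= e.
Proof.
move=> /andP[at_ tb] [r [C [r0 C0 rP]]] e0.
have C1 : 0 < C + 1 by rewrite ltr_wpDl.
have [r' r'0 r'P] := W_cont om_weight t (divr_gt0 e0 C1).
exists (Num.min r r'); first by rewrite lt_min r0.
move=> s /andP[as_ sb] /andP[]; rewrite ltrBlDr -ltrBlDl lt_min => /andP[h1 h2].
rewrite -ltrBlDl lt_min => /andP[h3 h4].
have Ce s1 s2 : s1 <= s2 -> W s2 - W s1 < e / (C + 1) -> C * (W s2 - W s1) <= e.
  move=> s12; rewrite ltr_pdivlMr// => /ltW; apply: le_trans.
  by rewrite mulrC ler_wpM2l ?W_sub_ge0// lerDl.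
have [ts|/ltW st] := leP t s.
  have [|||||_ ds dle] := rP t s => //; try order_lra.
  by split=> //; apply: le_trans dle (Ce _ _ ts _); apply: r'P => //; order_lra.
have [|||||ds _ dle] := rP s t => //; try order_lra.
by split=> //; rewrite distrC; apply: le_trans dle (Ce _ _ st _); apply: r'P => //; order_lra.
Qed.

Lemma wlip_at_change c c' q a b t : a <= t <= b -> atlas c -> atlas c' ->
  dom c (q t) -> dom c' (q t) -> wlip_at c q a b t -> wlip_at c' q a b t.
Proof.
move=> tab ac ac' cq c'q cw.
have [rho [K [rho0 K0 nU tc _]]] := smooth_c11 (transition_smooth ac ac') (nbhs_overlap cq c'q).
have [r1 r10 r1P] := wlip_at_dist tab cw rho0.
have [r [C [r0 C0 rP]]] := cw.
exists (Num.min r r1), (K * C); split; [by rewrite lt_min r0 | exact: mulr_ge0|].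
move=> s s' as_ ss' s'b; rewrite ltrBlDr -ltrBlDl lt_min => /andP[h1 h2].
rewrite -ltrBlDl lt_min => /andP[h3 h4].
have [|||||ds ds' dle] := rP s s' => //; try order_lra.
have [||_ e1] := r1P s; try (apply/andP; order_lra).
have [||_ e2] := r1P s'; try (apply/andP; order_lra).
have inD s1 : dom c (q s1) -> `|c (q s1) - c (q t)| <= rho -> dom c' (q s1).
  move=> cs1 /nU /nbhs_singleton [p' [cp' c'p'] pE].
  by rewrite -(coordsK cs1) -pE coordsK.
split; [exact: inD | exact: inD|].
have := c11_lip tc e1 e2; rewrite /= (coordsK ds) (coordsK ds') => h.
by apply: le_trans h _; rewrite -mulrA ler_wpM2l.
Qed.

Lemma msol_near w a b q t (O : set M) : msol w a b q -> a <= t <= b -> nbhs (q t) O ->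
  exists2 r, 0 < r & forall s, a <= s <= b -> t - r < s < t + r -> O (q s).
Proof.
move=> [qw _] tab Oq; set c := chart_at (q t).
have cq : dom c (q t) by exact: mem_chart_at.
have pc : nbhs (c (q t)) (param c @^-1` O).
  have /= := @continuous_param _ _ _ c (c (q t)) (imageP c cq); apply.
  by rewrite coordsK.
move/nbhs_ballP: pc => [e /= e0 eP].
have e20 : 0 < e / 2 by rewrite divr_gt0.
have [r r0 rP] := wlip_at_dist tab (qw t c tab (chart_at_atlas _) cq) e20.
exists r => // s sab st; have [ds h] := rP s sab st.
have /= := eP (c (q s)); rewrite coordsK//; apply.
rewrite -ball_normE/= distrC; apply: le_lt_trans h _.
by rewrite ltr_pdivrMr// ltr_pMr// ltr1n.
Qed.

Lemma msol_near_dom w a b q t c : msol w a b q -> a < t < b -> dom c (q t) ->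
  \forall s \near t, dom c (q s).
Proof.
move=> qs /andP[at_ tb] cq.
have tab : a <= t <= b by rewrite !ltW.
have Oc : nbhs (q t) (dom c) by apply: open_nbhs_nbhs; split; [exact: open_dom|].
have [r r0 rP] := msol_near qs tab Oc.
near=> s; apply: rP.
  by apply/andP; split; apply: ltW; near: s; [exact: lt_nbhsr|exact: lt_nbhsl].
apply/andP; split; near: s; [apply: lt_nbhsr | apply: lt_nbhsl].
  by rewrite ltrBlDr ltrDl.
by rewrite ltrDl.
Unshelve. all: by end_near. Qed.

Lemma msol_chart_derive w a b q c : msol w a b q -> atlas c ->
  {ae mu, forall t, a < t < b -> dom c (q t) ->
     is_derive t (1 : R) (c \o q) (\sum_i w i t *: vfield_in c (X i) (c (q t)))}.
Proof.
move=> qs ac; apply: aeS qs.2 => t qd tab cq.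
have cat := mem_chart_at (q t); have acat := chart_at_atlas (q t).
have := is_derive_change acat ac cat cq (msol_near_dom qs tab cat) (qd tab).
congr is_derive; rewrite mulmx_suml; apply: eq_bigr => i _.
by rewrite -scalemxAl vfield_in_coords.
Qed.

Lemma msol_local_sol w a b q c t r C rho a' b' : msol w a b q -> atlas c ->
  (forall s s', a <= s -> s <= s' -> s' <= b -> t - r < s -> s' < t + r ->
    [/\ dom c (q s), dom c (q s') & `|c (q s') - c (q s)| <= C * (W s' - W s)]) -> 0 <= C ->
  a <= a' -> b' <= b -> t - r < a' -> b' < t + r ->
  (forall s, a' <= s <= b' -> `|c (q s) - c (q t)| <= rho) ->
  local_sol om (fun i => vfield_in c (X i)) (c (q t)) rho w a' b' (c \o q).
Proof.
move=> qs ac rP C0 aa' b'b ta' b't qr; split => //.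
  exists C => // s s' as_ ss' s'b; have [|||||//] := rP s s'; try order_lra.
apply: aeS (msol_chart_derive qs ac) => s qd /andP[sa' sb'].
apply: qd; first by apply/andP; order_lra.
by have [|||||//] := rP s s; order_lra.
Qed.

Lemma local_sol_msol w a b c x0 rho Xs : atlas c ->
  (forall x, `|x - x0| <= rho -> (c @` dom c) x) ->
  local_sol om (fun i => vfield_in c (X i)) x0 rho w a b Xs ->
  msol w a b (param c \o Xs).
Proof.
move=> ac rhoU [[C C0 XC] Xr Xd].
have inD t : a <= t <= b -> dom c (param c (Xs t)) /\ c (param c (Xs t)) = Xs t.
  by move=> /Xr /rhoU [p cp <-]; rewrite coordsK.
have q1 t c' : a <= t <= b -> atlas c' -> dom c' (param c (Xs t)) ->
    wlip_at c' (param c \o Xs) a b t.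
  move=> tab ac' c'q; apply: (wlip_at_change tab ac ac' (inD t tab).1 c'q).
  exists 1, C; split => // s s' as_ ss' s'b _ _ /=.
  have [|d1 e1] := inD s; first by apply/andP; order_lra.
  have [|d2 e2] := inD s'; first by apply/andP; order_lra.
  by split => //; rewrite e1 e2; exact: XC.
split=> //; apply: aeS Xd => t Xd /[dup] tab /andP[at_ tb].
have tab' : a <= t <= b by rewrite !ltW.
have [ct cE] := inD t tab'; set p := param c (Xs t) in ct cE *.
have qd : is_derive t (1 : R) (c \o (param c \o Xs)) (\sum_i w i t *: vfield_in c (X i) (Xs t)).
  apply: near_eq_is_derive (Xd tab).
  near=> s; rewrite /= (inD s _).2//; apply/andP; split; apply: ltW; near: s;
    [exact: lt_nbhsr|exact: lt_nbhsl].
have nd : \forall s \near t, dom c ((param c \o Xs) s).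
  near=> s; apply: (inD s _).1; apply/andP; split; apply: ltW; near: s;
    [exact: lt_nbhsr|exact: lt_nbhsl].
have := is_derive_change (q := param c \o Xs) ac (chart_at_atlas p) ct (mem_chart_at p) nd qd.
congr is_derive; rewrite mulmx_suml; apply: eq_bigr => i _.
rewrite -scalemxAl -cE vfield_in_coords//; congr (_ *: _).
by rewrite (tangent_in_change _ ac (chart_at_atlas p) ct (mem_chart_at p)) tangent_in_chart_at.
Unshelve. all: by end_near. Qed.

End ManifoldSolution.

Section ManifoldGluing.
Context {R : realType} {n l : nat} {M : smooth_manifold R n}.
Variable (om : R -> R).
Hypothesis om_weight : weight om.
Local Notation W := (primitive om).
Local Notation mu := (@lebesgue_measure R).
Variable (X : 'I_l -> M -> 'rV[R]_n).
Hypothesis X_smooth : forall i, smooth_vfield (X i).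
Implicit Types (c : chart R n M) (q : R -> M) (w : 'I_l -> R -> R) (a b t : R).

Lemma msolS w a b q a' b' : a <= a' -> b' <= b -> msol om X w a b q -> msol om X w a' b' q.
Proof.
move=> aa' b'b [qw qd]; split.
  move=> t c /andP[at_ tb] ac cq.
  have [|r [C [r0 C0 rP]]] := qw t c _ ac cq; first by apply/andP; order_lra.
  by exists r, C; split => // s s' as_ ss' s'b; apply: rP => //; order_lra.
by apply: aeS qd => t qd /andP[at_ tb]; apply: qd; apply/andP; order_lra.
Qed.

Lemma is_derive_near_itv (V : normedModType R) (f g : R -> V) a b t df : a < t < b ->
  (forall s, a < s < b -> f s = g s) -> is_derive t (1 : R) f df -> is_derive t (1 : R) g df.
Proof.
move=> /andP[at_ tb] fg fd; apply: near_eq_is_derive fd.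
near=> s; rewrite fg//; apply/andP; split; near: s; [exact: lt_nbhsr|exact: lt_nbhsl].
Unshelve. all: by end_near. Qed.

Lemma msol_ext w w' a b q q' : (forall t, a <= t <= b -> q t = q' t) ->
  (forall i t, a < t < b -> w i t = w' i t) -> msol om X w a b q -> msol om X w' a b q'.
Proof.
move=> qq' ww' [qw qd]; split.
  move=> t c tab ac cq; have qt := qq' t tab.
  have [|r [C [r0 C0 rP]]] := qw t c tab ac; first by rewrite qt.
  exists r, C; split => // s s' as_ ss' s'b h1 h2.
  by rewrite -!qq'; [exact: rP | apply/andP; order_lra | apply/andP; order_lra].
apply: aeS qd => t qd tab; have tab' : a <= t <= b by case/andP: tab => *; apply/andP; lra.
have := qd tab; rewrite (qq' t tab') => h.
apply: (@is_derive_near_itv _ (chart_at (q' t) \o q) _ a b) => //.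
  by move=> s /andP[as_ sb] /=; rewrite qq'//; apply/andP; lra.
by move: h; congr is_derive; apply: eq_bigr => i _; rewrite ww'.
Qed.

(** At the junction the two Lipschitz estimates are added, through the common value at b; the
    equation is lost at time b only, a null set. *)
Lemma msol_glue w a b d q1 q2 : a <= b -> b <= d -> q1 b = q2 b ->
  msol om X w a b q1 -> msol om X w b d q2 ->
  msol om X w a d (fun t => if t <= b then q1 t else q2 t).
Proof.
move=> ab bd q12 [q1w q1d] [q2w q2d]; set q := fun t => _.
have qE1 t : t <= b -> q t = q1 t by rewrite /q => ->.
have qE2 t : b <= t -> q t = q2 t.
  by rewrite /q le_eqVlt => /orP[/eqP <-|tb]; [rewrite lexx | rewrite leNgt tb].
split.
  move=> t c /andP[at_ td] ac cq; case: (ltgtP t b) => [tb|bt|tb].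
  - have [||r [C [r0 C0 rP]]] := q1w t c _ ac; [by apply/andP; order_lra | by rewrite -qE1// ltW|].
    exists (Num.min r (b - t)), C; split => //; first by rewrite lt_min r0 subr_gt0.
    move=> s s' as_ ss' s'd; rewrite ltrBlDr -ltrBlDl lt_min => /andP[h1 h2].
    rewrite -ltrBlDl lt_min => /andP[h3 h4].
    by rewrite !qE1; [apply: rP => //; order_lra | order_lra | order_lra].
  - have [||r [C [r0 C0 rP]]] := q2w t c _ ac; [by apply/andP; order_lra | by rewrite -qE2// ltW|].
    exists (Num.min r (t - b)), C; split => //; first by rewrite lt_min r0 subr_gt0.
    move=> s s' as_ ss' s'd; rewrite ltrBlDr -ltrBlDl lt_min => /andP[h1 h2].
    rewrite -ltrBlDl lt_min => /andP[h3 h4].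
    by rewrite !qE2; [apply: rP => //; order_lra | order_lra | order_lra].
  have [||r1 [C1 [r10 C10 r1P]]] := q1w b c _ ac; [by apply/andP; order_lra | by rewrite -qE1// -tb|].
  have [||r2 [C2 [r20 C20 r2P]]] := q2w b c _ ac; [by apply/andP; order_lra | by rewrite -qE2// -tb|].
  have C120 : 0 <= C1 + C2 by exact: addr_ge0.
  have up (x y C : R) : C <= C1 + C2 -> x <= y -> C * (W y - W x) <= (C1 + C2) * (W y - W x).
    by move=> CC xy; rewrite ler_wpM2r// W_sub_ge0.
  have C1le : C1 <= C1 + C2 by rewrite lerDl.
  have C2le : C2 <= C1 + C2 by rewrite lerDr.
  exists (Num.min r1 r2), (C1 + C2); rewrite lt_min r10 r20; split => //.
  move=> s s' as_ ss' s'd; rewrite tb ltrBlDr -ltrBlDl lt_min => /andP[h1 h2].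
  rewrite -ltrBlDl lt_min => /andP[h3 h4].
  have [s'b|bs'] := leP s' b.
    have [|||||d1 d2 dle] := r1P s s' => //; try order_lra.
    by rewrite !qE1//; [split => //; apply: le_trans dle (up _ _ _ C1le ss') | order_lra].
  have [sb|bs] := leP s b.
    have [|||||d1 d2 dle] := r1P s b => //; try order_lra.
    have [|||||d3 d4 dle'] := r2P b s' => //; try order_lra.
    rewrite qE1// (qE2 s' (ltW bs')); split => //.
    rewrite -(subrK (c (q1 b)) (c (q2 s'))) -addrA [X in `|c (q2 s') - c X + _|]q12.
    apply: le_trans (ler_normD _ _) _.
    have := lerD (le_trans dle' (up _ _ _ C2le (ltW bs'))) (le_trans dle (up _ _ _ C1le sb)).
    by rewrite -mulrDr addrA subrK.
  have [|||||d1 d2 dle] := r2P s s' => //; try order_lra.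
  by rewrite (qE2 s (ltW bs)) (qE2 s' (ltW bs')); split => //; apply: le_trans dle (up _ _ _ C2le ss').
apply: aeS3 (ae_neq b) q1d q2d => t tneb q1d' q2d' /andP[at_ td].
case: (ltgtP t b) => [tb|bt|tb]; last by rewrite tb eqxx in tneb.
  rewrite (qE1 t (ltW tb)); apply: (@is_derive_near_itv _ (chart_at (q1 t) \o q1) _ a b).
  - by rewrite at_.
  - by move=> s /andP[_ sb] /=; rewrite qE1// ltW.
  - by apply: q1d'; rewrite at_.
rewrite (qE2 t (ltW bt)); apply: (@is_derive_near_itv _ (chart_at (q2 t) \o q2) _ b d).
- by rewrite bt.
- by move=> s /andP[bs _] /=; rewrite qE2// ltW.
- by apply: q2d'; rewrite bt.
Qed.

Lemma chart_bounds c p : atlas c -> dom c p -> exists rho K : R, [/\ 0 < rho, 0 <= K,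
  forall x, `|x - c p| <= rho -> (c @` dom c) x,
  forall i, c11 (vfield_in c (X i)) (c p) rho K &
  forall i j, c11 ('D_(delta_mx 0 j) (vfield_in c (X i))) (c p) rho K].
Proof.
move=> ac cp; have nU := nbhs_codom cp.
have H i := smooth_c11 (X_smooth i ac) nU.
have [rhos rhosP] := choice H; have [Ks KsP] := choice rhosP.
have /nbhs_ballP[r /= r0 rP] := nU.
pose rho := \big[Num.min/r / 2]_i rhos i; pose K := \sum_i Ks i.
have rho0 : 0 < rho.
  rewrite /rho; elim/big_ind : _ => [|x y x0 y0|i _]; first by rewrite divr_gt0.
    by rewrite lt_min x0.
  by have [] := KsP i.
have rhole i : rho <= rhos i by rewrite /rho (bigD1 i)//= ge_min lexx.
have rhor : rho <= r / 2.
  rewrite /rho; elim/big_rec : _ => // i x _ xr; rewrite ge_min xr orbT//.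
have K0 : 0 <= K by apply: sumr_ge0 => i _; have [] := KsP i.
have Kle i : Ks i <= K.
  by rewrite /K (bigD1 i)//= lerDl sumr_ge0// => j _; have [] := KsP j.
exists rho, K; split => //.
- move=> x xr; apply: rP; rewrite -ball_normE/= distrC.
  by apply: le_lt_trans xr _; order_lra.
- by move=> i; have [_ _ _ h _] := KsP i; exact: c11_mono h.
- by move=> i j; have [_ _ _ _ h] := KsP i; apply: c11_mono (h j).
Qed.

(* Smallness of the time window: the constants of [local_family]. *)
Lemma small_window K rho t : 0 <= K -> 0 < rho -> exists2 r, 0 < r &
  forall s s', t - r < s -> s <= s' -> s' < t + r ->
    l%:R * 2 * K * (W s' - W s) <= 1 / 4 /\ l%:R * 2 * K * (W s' - W s) <= rho / 2.
Proof.
move=> K0 rho0; pose D := l%:R * 2 * K + 1.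
have lK0 : 0 <= l%:R * 2 * K by nneg.
have D0 : 0 < D by rewrite ltr_wpDl.
pose m := Num.min (1 / 4) (rho / 2) / D.
have m0 : 0 < m by rewrite divr_gt0// lt_min !divr_gt0.
have [r r0 rP] := W_cont om_weight t m0; exists r => // s s' h1 h2 h3.
have := rP s s' h1 h2 h3; rewrite ltr_pdivlMr// lt_min => /andP[h4 h5].
have : l%:R * 2 * K * (W s' - W s) <= (W s' - W s) * D.
  by rewrite [leRHS]mulrC ler_wpM2r ?W_sub_ge0// lerDl.
by split; order_lra.
Qed.

(** Local uniqueness in a chart propagates coincidence in both directions of time; the Hausdorff
    property makes the set of coincidence closed. *)
Lemma msol_unique w a b q1 q2 : a <= b ->
  (forall i t, a <= t <= b -> `|w i t| <= 2 * om t) ->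
  msol om X w a b q1 -> msol om X w a b q2 -> q1 a = q2 a -> q1 b = q2 b.
Proof.
move=> ab wle s1 s2; apply: (@real_induction _ a b (fun t => q1 t = q2 t) ab) => t tab.
have [q12|/eqP q12] := pselect (q1 t = q2 t); last first.
  (* If the curves differ at t, disjoint neighbourhoods keep them apart nearby, and the premise of
     the left half of the induction step cannot hold. *)
  have hM := @manifold_hausdorff _ _ M; rewrite open_hausdorff in hM.
  have [[A B] /= [Aq Bq] [oA oB AB]] := hM _ _ q12.
  rewrite !inE in Aq Bq.
  have [r1 r10 r1P] := msol_near om_weight s1 tab (open_nbhs_nbhs (conj oA Aq)).
  have [r2 r20 r2P] := msol_near om_weight s2 tab (open_nbhs_nbhs (conj oB Bq)).
  exists (Num.min r1 r2); first by rewrite lt_min r10.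
  move=> s sab; rewrite ltrBlDr -ltrBlDl lt_min -andbA.
  split=> [/and3P[h1 h2 h3] E|_ E]; last by rewrite E eqxx in q12.
  have st : t - r1 < s < t + r1 by clear -h1 h2 h3 r10 r20; apply/andP; order_lra.
  have st2 : t - r2 < s < t + r2 by clear -h1 h2 h3 r10 r20; apply/andP; order_lra.
  have : (A `&` B) (q1 s) by split; [exact: r1P | rewrite E; exact: r2P].
  by move/eqP: AB => ->.
set c := chart_at (q1 t).
have ac : atlas c by exact: chart_at_atlas.
have cq : dom c (q1 t) by exact: mem_chart_at.
have cq2 : dom c (q2 t) by rewrite -q12.
have [rho [K [rho0 K0 rU fc _]]] := chart_bounds ac cq.
have [r1 [C1 [r10 C10 r1P]]] := s1.1 t c tab ac cq.
have [r2 [C2 [r20 C20 r2P]]] := s2.1 t c tab ac cq2.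
have [r3 r30 r3P] := wlip_at_dist om_weight tab (s1.1 t c tab ac cq) rho0.
have [r4 r40 r4P] := wlip_at_dist om_weight tab (s2.1 t c tab ac cq2) rho0.
have [r5 r50 r5P] := small_window t K0 rho0.
pose r := Num.min (Num.min r1 r2) (Num.min (Num.min r3 r4) r5).
have key s s' : a <= s -> s <= s' -> s' <= b -> t - r < s -> s' < t + r ->
    q1 s = q2 s -> q1 s' = q2 s'.
  move=> as_ ss' s'b; rewrite ltrBlDr -ltrBlDl !lt_min => /andP[/andP[h1 h2] /andP[/andP[h3 h4] h5]].
  rewrite -ltrBlDl !lt_min => /andP[/andP[g1 g2] /andP[/andP[g3 g4] g5]].
  have [|||sm _] := r5P s s'; [order_lra | exact: ss' | order_lra |].
  have l1 : local_sol om (fun i => vfield_in c (X i)) (c (q1 t)) rho w s s' (c \o q1).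
    apply: (msol_local_sol om_weight s1 ac r1P) => //; try order_lra.
    by move=> z /andP[z1 z2]; apply: (r3P z _ _).2; apply/andP; order_lra.
  have l2 : local_sol om (fun i => vfield_in c (X i)) (c (q1 t)) rho w s s' (c \o q2).
    rewrite q12; apply: (msol_local_sol om_weight s2 ac r2P) => //; try order_lra.
    by move=> z /andP[z1 z2]; apply: (r4P z _ _).2; apply/andP; order_lra.
  have wle' i z : s <= z <= s' -> `|w i z| <= 2 * om z.
    by move=> /andP[z1 z2]; apply: wle; apply/andP; order_lra.
  have ww i z : s <= z <= s' -> `|w i z - w i z| <= 0 * om z.
    by move=> _; rewrite subrr normr0 mul0r.
  have s'in : s <= s' <= s' by rewrite ss' lexx.
  have d1 : dom c (q1 s') by apply: (r3P s' _ _).1; apply/andP; order_lra.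
  have d2 : dom c (q2 s') by apply: (r4P s' _ _).1; apply/andP; order_lra.
  move=> E; have := local_sol_dist om_weight K0 fc ss' sm (lexx 0) wle' ww l1 l2 s'in.
  rewrite /= E subrr normr0 mulr0 !mul0r addr0 mulr0 normr_le0 subr_eq0 => /eqP cE.
  by rewrite -(coordsK d1) cE coordsK.
exists r; first by rewrite !lt_min r10 r20 r30 r40.
have [at_ tb] := andP tab; have r0 : 0 < r by rewrite !lt_min r10 r20 r30 r40.
move=> s /andP[as_ sb]; split=> /andP[h1 h2]; apply: key => //; order_lra.
Qed.

End ManifoldGluing.

(** * Trajectories and Pontryagin covectors seen by the clock W *)

Section TrajectorySolution.
Context {R : realType} {n l : nat} {M : smooth_manifold R n}.
Variable (om : R -> R).
Hypothesis om_weight : weight om.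
Local Notation W := (primitive om).
Local Notation mu := (@lebesgue_measure R).
Variable (X : 'I_l -> M -> 'rV[R]_n).
Hypothesis X_smooth : forall i, smooth_vfield (X i).
Variable (T : R).
Implicit Types (c : chart R n M) (q : R -> M) (a b t : R).

Let om0 t : 0 <= om t. Proof. by case: om_weight. Qed.

Lemma within_near q a b t (O : set M) : {within `[a, b], continuous q} -> a <= t <= b ->
  nbhs (q t) O -> exists2 r, 0 < r & forall s, a <= s <= b -> t - r < s < t + r -> O (q s).
Proof.
move=> /subspace_continuousP qc tab Oq.
have tab' : `[a, b]%classic t by rewrite /= in_itv.
have /nbhs_ballP[r /= r0 rP] := qc t tab' O Oq.
exists r => // s sab /andP[h1 h2]; apply: rP; last by rewrite /= in_itv.
by rewrite /ball/= ltr_distlC h1.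
Qed.

(** Near a time t continuity keeps q in a ball where the fields are bounded, so its derivative is
    O(om); together with absolute continuity this gives the Lipschitz bound. *)
Lemma trajectory_msol (q0 : M) (v : control T l) q :
  (forall i t, 0 <= t <= T -> `|v i t| <= 2 * om t) ->
  trajectory X q0 v q -> msol om X (fun i => v i) 0 T q.
Proof.
move=> vle [_ qc qac qd]; split; last first.
  by apply: aeS qd => t qd /andP[t0 tT]; apply: qd; rewrite !ltW.
move=> t c tab ac cq.
have [rho [K [rho0 K0 rU fc _]]] := chart_bounds X_smooth ac cq.
have nO : nbhs (q t) [set p | dom c p /\ `|c p - c (q t)| <= rho].
  have h1 : nbhs (q t) (dom c) by apply: open_nbhs_nbhs; split; [exact: open_dom|].
  have := continuous_coords cq => /cvgrPdist_le /(_ rho rho0); apply: filterS2 h1 => p cp.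
  by rewrite distrC.
have [r r0 rP] := within_near qc tab nO.
have C0 : 0 <= l%:R * (2 * K) by nneg.
exists r, (l%:R * (2 * K)); split => // s s' as_ ss' s'b h1 h2.
have inw z : s <= z <= s' -> dom c (q z) /\ `|c (q z) - c (q t)| <= rho.
  by move=> /andP[z1 z2]; apply: rP; apply/andP; order_lra.
have [d1 _] := inw s (introT andP (conj (lexx s) ss')).
have [d2 _] := inw s' (introT andP (conj ss' (lexx s'))).
split => //.
have fac := qac c ac s s' as_ ss' s'b (fun z zs => (inw z zs).1).
apply: (ftc_wlip om_weight ss' fac C0) => //.
apply: aeS qd => z qd /andP[z1 z2].
have zT : 0 <= z <= T by apply/andP; order_lra.
have [cz cr] := inw z (introT andP (conj (ltW z1) (ltW z2))).
have nz : \forall y \near z, dom c (q y).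
  near=> y; apply: (inw y _).1; apply/andP; split; apply: ltW; near: y;
    [exact: lt_nbhsr|exact: lt_nbhsl].
have cat := mem_chart_at (q z); have acat := chart_at_atlas (q z).
have ncat : \forall y \near z, dom (chart_at (q z)) (q y).
  have Oz : nbhs (q z) (dom (chart_at (q z))) by apply: open_nbhs_nbhs; split; [exact: open_dom|].
  have [r' r'0 r'P] := within_near qc zT Oz.
  near=> y; apply: r'P; apply/andP; split.
  - by apply: ltW; apply: (le_lt_trans as_); near: y; exact: lt_nbhsr.
  - by apply: ltW; apply: (lt_le_trans _ s'b); near: y; exact: lt_nbhsl.
  - by near: y; apply: lt_nbhsr; rewrite ltrBlDr ltrDl.
  - by near: y; apply: lt_nbhsl; rewrite ltrDl.
have := is_derive_change acat ac cat cz ncat (qd zT).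
have -> : (\sum_i v i z *: X i (q z)) *m change_of_chart (chart_at (q z)) c (q z) =
    \sum_i v i z *: vfield_in c (X i) (c (q z)).
  rewrite mulmx_suml; apply: eq_bigr => i _.
  by rewrite -scalemxAl vfield_in_coords.
move=> czd; eexists; first exact: czd.
apply: le_trans (norm_sum_scale_le (fun i => vle i z zT) (fun i => c11_bound (fc i) cr)) _.
by rewrite card_ord; apply: le_of_eq; ring.
Unshelve. all: by end_near. Qed.

Lemma wlip_cat (V : normedModType R) C C' a s t (f : R -> V) : 0 <= C -> 0 <= C' -> a <= s -> s <= t ->
  wlip om C a s f -> wlip om C' s t f -> wlip om (C + C') a t f.
Proof.
move=> C0 C'0 as_ st fC fC' x y ax xy yt.
have up D D' z z' : 0 <= D' -> z <= z' -> D * (W z' - W z) <= (D + D') * (W z' - W z).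
  by move=> D'0 zz'; rewrite ler_wpM2r ?W_sub_ge0// lerDl.
have [ys|/ltW sy] := leP y s.
  by apply: le_trans (fC _ _ ax xy ys) (up _ _ _ _ C'0 xy).
have [sx|/ltW xs] := leP s x.
  by apply: le_trans (fC' _ _ sx xy yt) _; rewrite [C + _]addrC; exact: up.
rewrite -(subrK (f s) (f y)) -addrA; apply: le_trans (ler_normD _ _) _.
have -> : (C + C') * (W y - W x) = (C + C') * (W y - W s) + (C + C') * (W s - W x) by ring.
apply: lerD.
  by apply: le_trans (fC' _ _ (lexx s) sy yt) _; rewrite [C + _]addrC; exact: up.
by apply: le_trans (fC _ _ ax xs (lexx s)) _; exact: up.
Qed.

Lemma msol_wlip w q c a b a0 b0 : msol om X w a0 b0 q -> atlas c -> a0 <= a -> a <= b -> b <= b0 ->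
  (forall t, a <= t <= b -> dom c (q t)) -> Wlip om a b (c \o q).
Proof.
move=> qs ac aa0 ab bb0 qdom.
apply: (@real_induction _ a b (fun t => Wlip om a t (c \o q)) ab); last first.
  exists 0 => // s t as_ st ta; have -> : s = t by order_lra.
  by rewrite !subrr normr0 mul0r.
move=> t tab; have [at_ tb] := andP tab.
have t0 : a0 <= t <= b0 by apply/andP; order_lra.
have [r [C [r0 C0 rP]]] := qs.1 t c t0 ac (qdom t tab).
have key s s' : a <= s -> s <= s' -> s' <= b -> t - r < s -> s' < t + r ->
    Wlip om a s (c \o q) -> Wlip om a s' (c \o q).
  move=> as_ ss' s'b h1 h2 [D D0 fD]; exists (D + C); first exact: addr_ge0.
  apply: wlip_cat fD _ => // x y sx xy ys'.
  by have [|||||//] := rP x y; order_lra.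
exists r => // s /andP[as_ sb]; split=> /andP[h1 h2]; apply: key => //; order_lra.
Qed.

Lemma msol_trajectory (v : control T l) q : msol om X (fun i => v i) 0 T q ->
  trajectory X (q 0) v q.
Proof.
move=> qs; split => //.
- apply/subspace_continuousP => t tT O Oq.
  have tT' : 0 <= t <= T by move: tT; rewrite /= in_itv.
  have [r r0 rP] := msol_near om_weight qs tT' Oq.
  apply/nbhs_ballP; exists r => //= s; rewrite /ball/= ltr_distlC => str.
  by rewrite /= in_itv/= => sT; exact: rP.
- move=> c ac a b a0 ab bT qdom.
  by apply: (Wlip_ac om_weight); apply: (msol_wlip qs).
- apply: aeS3 (ae_neq 0) (ae_neq T) qs.2 => t t0 tT qd /andP[h1 h2].
  by apply: qd; rewrite lt_neqAle eq_sym t0 h1 lt_neqAle tT h2.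
Qed.

(** The covector equation is linear, so its right-hand side is bounded only after the covector is.
    Absolute continuity with tolerance 1 first gives the bound |phi(t)| + 1 near t; the equation
    then yields the Lipschitz constant. *)
Lemma pontryagin_local (u : control T l) q (phi : R -> 'cV[R]_n) c t : 
  (forall i t, 0 <= t <= T -> `|u i t| <= om t) ->
  msol om X (fun i => u i) 0 T q -> pontryagin_covector X u q phi ->
  0 <= t <= T -> atlas c -> dom c (q t) ->
  exists r P C, [/\ 0 < r, 0 <= P, 0 <= C &
   forall a b, 0 <= a -> a <= b -> b <= T -> t - r < a -> b < t + r ->
   let pc := fun s => cotangent_in c (q s) (phi s) in
   [/\ forall s, a <= s <= b -> `|pc s| <= P, wlip om C a b pc &
     covector_sol om (fun i => vfield_in c (X i)) a b (fun i => u i) (c \o q) pc]].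
Proof.
move=> ule qs pont tT ac cq; have [t0 tT'] := andP tT.
have [rho [K [rho0 K0 rU fc _]]] := chart_bounds X_smooth ac cq.
have [r1 r10 r1P] := wlip_at_dist om_weight tT (qs.1 t c tT ac cq) rho0.
have [pac pode] := pont c ac; set pc := fun s => cotangent_in c (q s) (phi s).
pose a1 := Num.max 0 (t - r1 / 2); pose b1 := Num.min T (t + r1 / 2).
have a1t : a1 <= t by rewrite ge_max t0/= lerBlDr lerDl divr_ge0// ltW.
have tb1 : t <= b1 by rewrite le_min tT'/= lerDl divr_ge0// ltW.
have a10 : 0 <= a1 by rewrite le_max lexx.
have b1T : b1 <= T by rewrite ge_min lexx.
have a1r : t - r1 < a1 by rewrite lt_max ltrD2l ltrN2 ltr_pdivrMr// ltr_pMr// ltr1n orbT.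
have b1r : b1 < t + r1 by rewrite gt_min ltrD2l ltr_pdivrMr// ltr_pMr// ltr1n orbT.
have dom1 s : a1 <= s <= b1 -> dom c (q s) /\ `|c (q s) - c (q t)| <= rho.
  by move=> /andP[s1 s2]; apply: r1P; apply/andP; order_lra.
have pac1 := pac a1 b1 a10 (le_trans a1t tb1) b1T (fun s sab => (dom1 s sab).1).
have [d d0 dP] := pac1 1 ltr01.
pose P := `|pc t| + 1.
have P0 : 0 <= P by rewrite addr_ge0.
have near1 s s' : a1 <= s -> s <= s' -> s' <= b1 -> s' - s < d -> `|pc s' - pc s| <= 1.
  move=> h1 h2 h3 h4; have := dP 1%N (fun=> s) (fun=> s').
  rewrite !big_ord1 => /(_ _ _ h4) h; apply: ltW; apply: h => //.
  by move=> i j /andP[ij]; rewrite ltnS leqn0 => /eqP j0; rewrite j0 in ij.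
have pP s : a1 <= s <= b1 -> t - d < s < t + d -> `|pc s| <= P.
  move=> /andP[s1 s2] /andP[h1 h2]; rewrite -(subrK (pc t) (pc s)) addrC.
  apply: le_trans (ler_normD _ _) _; rewrite lerD2l.
  have [ts|/ltW st] := leP t s; first by apply: near1 => //; order_lra.
  by rewrite distrC; apply: near1 => //; order_lra.
pose C := l%:R * (n%:R * (P * K)).
have C0 : 0 <= C by rewrite /C; nneg.
exists (Num.min (r1 / 2) d), P, C; split => //; first by rewrite lt_min d0 divr_gt0.
move=> a b a0 ab bT; rewrite ltrBlDr -ltrBlDl lt_min => /andP[h1 h2].
rewrite -ltrBlDl lt_min => /andP[h3 h4] /=.
have aa1 : a1 <= a by rewrite ge_max a0/=; order_lra.
have bb1 : b <= b1 by rewrite le_min bT/=; order_lra.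
have in1 s : a <= s <= b -> a1 <= s <= b1 by move=> /andP[s1 s2]; apply/andP; order_lra.
have pP' s : a <= s <= b -> `|pc s| <= P.
  by move=> /[dup] sab /andP[s1 s2]; apply: pP; [exact: in1 | apply/andP; order_lra].
have pacab : abs_continuous a b pc.
  by apply: pac => // s /in1 /dom1[].
have ode : {ae mu, forall s, a < s < b -> exists2 dp, is_derive s (1 : R) pc dp &
    forall z : 'rV[R]_n, pairing dp z + \sum_i u i s * pairing (pc s) ('D_z (vfield_in c (X i)) (c (q s))) = 0}.
  apply: aeS pode => s pode /andP[s1 s2].
  have sab : a <= s <= b by rewrite !ltW.
  have [||dps dpE] := pode; [by apply/andP; order_lra | exact: (dom1 s (in1 s sab)).1|].
  exists (derive1 pc s); [by rewrite derive1E; exact: derivableP | exact: dpE].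
have pW : wlip om C a b pc.
  apply: ftc_wlip => //; apply: aeS ode => s ode sab; have [dp pd dpE] := ode sab.
  have sab' : a <= s <= b by case/andP: sab => *; rewrite !ltW.
  have sT : 0 <= s <= T by case/andP: sab' => *; apply/andP; order_lra.
  exists dp => //; apply: mx_norm_le; first by rewrite mulr_ge0.
  move=> i j; rewrite ord1.
  have -> : dp i 0 = pairing dp (delta_mx 0 i).
    rewrite pairingE (bigD1 i)//= mxE !eqxx mul1r big1 ?addr0// => k ki.
    by rewrite mxE eqxx (negbTE ki) mul0r.
  have /eqP := dpE (delta_mx 0 i); rewrite addr_eq0 => /eqP ->; rewrite normrN.
  have e1 : `|(delta_mx 0 i : 'rV[R]_n)| <= 1.
    by apply: mx_norm_le => // i' j'; rewrite mxE; case: (_ && _); rewrite ?normr0 ?normr1 ?ler01.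
  have hf k : `|pairing (pc s) ('D_(delta_mx 0 i) (vfield_in c (X k)) (c (q s)))| <= n%:R * (P * K).
    apply: pairing_le2; first exact: pP'.
    apply: le_trans (c11_dbound (fc k) _ (dom1 s (in1 s sab')).2) _.
    by rewrite -[leRHS]mulr1; apply: ler_wpM2l.
  apply: le_trans (norm_sum_le (fun k => ule k s sT) hf) _.
  by rewrite card_ord; apply: le_of_eq; rewrite /C; ring.
split => //; split => //; first by exists C.
Qed.

End TrajectorySolution.

(** * Transport of a family of trajectories to the final time *)

Lemma near_norm_lt (R : realType) (s d : R) : `|s| < d -> \forall s' \near s, `|s'| < d.
Proof.
move=> sd; apply/nbhs_ballP; exists (d - `|s|); first by rewrite /= subr_gt0.
move=> s'; rewrite /ball/= distrC => h; rewrite -(subrK s s').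
by apply: le_lt_trans (ler_normD _ _) _; rewrite -ltrBrDr.
Qed.

Lemma pairing_sub_le (R : realType) n (lam : 'cV[R]_n) (v w : 'rV[R]_n) x :
  x = pairing lam w -> `|pairing lam v - x| <= `|pairing lam (v - w)|.
Proof. by move=> ->; rewrite pairingBr. Qed.

Lemma le_prod4 (R : realType) (N P K C x y z : R) : 0 <= N -> 0 <= P -> 0 <= K -> 0 <= z ->
  x <= C * y -> N * (P * (K * x * z)) <= N * (P * (K * C)) * y * z.
Proof.
move=> N0 P0 K0 z0 xy.
have -> : N * (P * (K * C)) * y * z = N * (P * (K * (C * y) * z)) by ring.
by rewrite ler_wpM2l// ler_wpM2l// ler_wpM2r// ler_wpM2l.
Qed.

Section Family.
Context {R : realType} {n l : nat} {M : smooth_manifold R n}.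
Variable (om : R -> R).
Hypothesis om_weight : weight om.
Local Notation W := (primitive om).
Variable (X : 'I_l -> M -> 'rV[R]_n).
Hypothesis X_smooth : forall i, smooth_vfield (X i).
Variables (T : R) (u : control T l) (q : R -> M) (Phi : 'I_n -> R -> 'cV[R]_n).
Hypothesis ule : forall i t, 0 <= t <= T -> `|u i t| <= om t.
Hypothesis q_sol : msol om X (fun i => u i) 0 T q.
Hypothesis Phi_pont : forall a, pontryagin_covector X u q (Phi a).
Variable (v : 'I_l -> R -> R).
Implicit Types (c : chart R n M).


Definition perturbed (s : R) (i : 'I_l) (t : R) : R := u i t + s * v i t.

(** With k = 0 this records the first derivative of a curve of velocity [g] at s = 0, through its
    pairings; with k = 1 and g = O(|s|) it records a vanishing first derivative and the pairings of
    the second one. *)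
Definition leading_term (k : nat) (alpha : 'I_n -> R) (p : 'I_n -> 'cV[R]_n) (g : R -> 'rV[R]_n) :=
  forall e, 0 < e -> exists2 d, 0 < d & forall (s : R) a, `|s| < d ->
    `|pairing (p a) (g s) - s ^+ k * alpha a| <= e * `|s| ^+ k.

Definition family_in c (qs : R -> R -> M) (k : nat) alpha tau := exists d C (g : R -> 'rV[R]_n),
  [/\ 0 < d, 0 <= C, forall s, `|s| < d -> [/\ dom c (qs s tau),
     is_derive s (1 : R) (fun s => c (qs s tau)) (g s) & `|g s| <= C * `|s| ^+ k] &
   leading_term k alpha (fun a => cotangent_in c (q tau) (Phi a tau)) g].

(* The endpoints at time [tau] of the trajectories of [u + s v] form, in charts, a curve
   in [s] whose velocity is [s ^+ k] times a vector pairing to [alpha] with the frame. *)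
Definition family (k : nat) (alpha : 'I_n -> R) (tau : R) := exists (qs : R -> R -> M) e,
  [/\ 0 < e, forall s, `|s| < e -> msol om X (perturbed s) 0 tau (qs s) /\ qs s 0 = q 0,
   qs 0 tau = q tau & forall c, atlas c -> dom c (q tau) -> family_in c qs k alpha tau].

(** An error of size |s|^k times a quantity tending to 0 does not affect the coefficient of order k.
    Changes of chart and transport in time both produce errors of this shape. *)
Lemma leading_term_perturb k alpha p p' (g g' gam : R -> 'rV[R]_n) d C : 0 < d -> 0 <= C ->
  {for (0 : R), continuous gam} ->
  (forall s a, `|s| < d ->
    `|pairing (p' a) (g' s) - pairing (p a) (g s)| <= C * `|s| ^+ k * `|gam s - gam 0|) ->
  leading_term k alpha p g -> leading_term k alpha p' g'.
Proof.
move=> d0 C0 gamc gg' lt e e0.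
have [d1 d10 d1P] := lt _ (divr_gt0 e0 (ltr0n _ 2)).
have C1 : 0 < C + 1 by rewrite ltr_wpDl.
have m0 : 0 < e / 2 / (C + 1) by rewrite !divr_gt0.
move/cvgrPdist_le: gamc => /(_ _ m0) /nbhs_ballP[d2 /= d20 d2P].
exists (Num.min d (Num.min d1 d2)); first by rewrite !lt_min d0 d10.
move=> s a; rewrite !lt_min => /and3P[sd sd1 sd2].
have := d2P s; rewrite -ball_normE/= sub0r normrN distrC => /(_ sd2) h1.
have h2 := d1P s a sd1; have h3 := gg' s a sd.
have h4 : C * `|s| ^+ k * `|gam s - gam 0| <= e / 2 * `|s| ^+ k.
  rewrite mulrAC ler_wpM2r ?exprn_ge0//.
  apply: (@le_trans _ _ (C * (e / 2 / (C + 1)))); first exact: ler_wpM2l.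
  by rewrite mulrCA ler_piMr ?divr_ge0 ?(ltW e0)// ler_pdivrMr// mul1r lerDl.
rewrite -(subrK (pairing (p a) (g s)) (pairing (p' a) (g' s))) -addrA.
apply: le_trans (ler_normD _ _) _; move: h2 h3 h4; move: (_ ^+ k) (_ ^+ k) => x y; lra.
Qed.

Lemma family_in_change c c' qs k alpha tau : atlas c -> atlas c' ->
  dom c (q tau) -> dom c' (q tau) -> qs 0 tau = q tau ->
  family_in c qs k alpha tau -> family_in c' qs k alpha tau.
Proof.
move=> ac ac' cq c'q q0 [d [C [g [d0 C0 gP glt]]]].
have [rho [K [rho0 K0 nU tc _]]] := smooth_c11 (transition_smooth ac ac') (nbhs_overlap cq c'q).
pose gam s := c (qs s tau).
have gam0 : gam 0 = c (q tau) by rewrite /gam q0.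
have s0d : `|0 : R| < d by rewrite normr0.
have gamc : {for (0 : R), continuous gam}.
  have [_ [gd _] _] := gP 0 s0d.
  exact: (differentiable_continuous ((derivable1_diffP _ _).1 gd)).
have := gamc => /cvgrPdist_le /(_ _ rho0) /nbhs_ballP[d1 /= d10 d1P].
have near1 s : `|s| < d1 -> `|gam s - c (q tau)| <= rho.
  by move=> sd; have := d1P s; rewrite -ball_normE/= sub0r normrN gam0 distrC; apply.
pose th := c' \o param c.
exists (Num.min d d1), (K * C), (fun s => 'D_(g s) th (gam s)); split.
- by rewrite lt_min d0.
- exact: mulr_ge0.
- move=> s; rewrite lt_min => /andP[sd sd1]; have [cs gd gle] := gP s sd.
  have sr := near1 s sd1.
  have c's : dom c' (qs s tau).
    have [p [cp c'p] pE] := nbhs_singleton (nU _ sr).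
    by rewrite -(coordsK cs) -[c (qs s tau)]pE coordsK.
  split; first exact: c's.
    apply: (near_eq_is_derive (f := th \o gam)).
      have nd : \forall s' \near s, `|s'| < d.
        exact: near_norm_lt.
      apply: filterS nd => s' /gP[cs' _ _] /=.
      by rewrite /th /gam /= coordsK.
    by apply: is_derive_chain => //; apply: (c11_diff tc); exact: sr.
  apply: le_trans (c11_dbound tc (g s) sr) _.
  by rewrite -mulrA ler_wpM2l.
have [P P0 PP] : exists2 P, 0 <= P & forall a, `|cotangent_in c' (q tau) (Phi a tau)| <= P.
  exists (\sum_a `|cotangent_in c' (q tau) (Phi a tau)|); first exact: sumr_ge0.
  by move=> a; rewrite (bigD1 a)//= lerDl sumr_ge0.
apply: (leading_term_perturb (d := Num.min d d1) (C := n%:R * (P * (K * C))) _ _ gamc _ glt).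
- by rewrite lt_min d0.
- by nneg.
move=> s a; rewrite lt_min => /andP[sd sd1]; have [cs gd gle] := gP s sd.
have E : pairing (cotangent_in c (q tau) (Phi a tau)) (g s) =
    pairing (cotangent_in c' (q tau) (Phi a tau)) ('D_(g s) th (c (q tau))).
  rewrite -(mulmx_change_of_chart (g s) ac ac' cq c'q).
  by apply: esym; apply: pairing_change.
apply: le_trans (pairing_sub_le _ E) _.
have r0 : `|c (q tau) - c (q tau)| <= rho by rewrite subrr normr0 ltW.
have h := c11_dlip tc (g s) r0 (near1 s sd1).
rewrite gam0; apply: le_trans (pairing_le2 (PP a) h) _.
exact: le_prod4.
Qed.

Lemma frame_local c t : 0 <= t <= T -> atlas c -> dom c (q t) ->
  exists r P C, [/\ 0 < r, 0 <= P, 0 <= C &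
   forall a b, 0 <= a -> a <= b -> b <= T -> t - r < a -> b < t + r -> forall k,
   let pc := fun s => cotangent_in c (q s) (Phi k s) in
   [/\ forall s, a <= s <= b -> `|pc s| <= P, wlip om C a b pc &
     covector_sol om (fun i => vfield_in c (X i)) a b (fun i => u i) (c \o q) pc]].
Proof.
move=> tT ac cq.
have H k := pontryagin_local om_weight X_smooth ule q_sol (Phi_pont k) tT ac cq.
have [r rP] := choice H; have [P PP] := choice rP; have [C CP] := choice PP.
pose r0 := \big[Num.min/1]_k r k.
have r00 : 0 < r0.
  rewrite /r0; elim/big_ind : _ => [//|x y x0 y0|k _]; first by rewrite lt_min x0.
  by have [] := CP k.
have r0le k : r0 <= r k by rewrite /r0 (bigD1 k)//= ge_min lexx.
have P0 k : 0 <= P k by have [] := CP k.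
have C0 k : 0 <= C k by have [] := CP k.
exists r0, (\sum_k P k), (\sum_k C k); split => //; [exact: sumr_ge0 | exact: sumr_ge0|].
move=> a b a0 ab bT h1 h2 k; have [_ _ _ H2] := CP k.
have [||p1 p2 p3] := H2 a b a0 ab bT.
- by apply: le_lt_trans h1; rewrite lerD2l lerN2.
- by apply: lt_le_trans h2 _; rewrite lerD2l.
have sub (F : 'I_n -> R) : (forall k, 0 <= F k) -> F k <= \sum_k F k.
  by move=> F0; rewrite (bigD1 k)//= lerDl sumr_ge0.
split=> //.
  by move=> s sab; apply: le_trans (p1 s sab) (sub _ P0).
move=> s s' as_ ss' s'b; apply: le_trans (p2 s s' as_ ss' s'b) _.
by rewrite ler_wpM2r ?W_sub_ge0//; exact: sub.
Qed.


(** The estimates on [a, b], with constants that depend on the centre t alone. They hold on every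
    small enough interval near t, which permits both the passage from window to window and the final
    limit. The radius rho / 4 leaves room for perturbed initial points. *)
Record window c t (rho K P C a b : R) : Prop := {
  window_quarter : l%:R * 2 * K * (W b - W a) <= 1 / 4;
  window_radius : l%:R * 2 * K * (W b - W a) <= rho / 2;
  window_dom : forall s, a <= s <= b -> dom c (q s);
  window_dist : forall s, a <= s <= b -> `|c (q s) - c (q t)| <= rho / 4;
  window_sol : local_sol om (fun i => vfield_in c (X i)) (c (q t)) rho (fun i => u i) a b (c \o q);
  window_wlip : wlip om C a b (c \o q);
  window_frame : forall k, let pc := fun s => cotangent_in c (q s) (Phi k s) in
   [/\ forall s, a <= s <= b -> `|pc s| <= P, wlip om C a b pc &
     covector_sol om (fun i => vfield_in c (X i)) a b (fun i => u i) (c \o q) pc]}.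

Record window_bounds c t (rho K P C : R) : Prop := {
  wb_rho : 0 < rho;
  wb_K : 0 <= K;
  wb_P : 0 <= P;
  wb_C : 0 <= C;
  wb_codom : forall x, `|x - c (q t)| <= rho -> (c @` dom c) x;
  wb_c11 : forall i, c11 (vfield_in c (X i)) (c (q t)) rho K;
  wb_c11_derive : forall i j, c11 ('D_(delta_mx 0 j) (vfield_in c (X i))) (c (q t)) rho K}.

Lemma exists_window c t : 0 <= t <= T -> atlas c -> dom c (q t) ->
  exists rho K P C r, [/\ window_bounds c t rho K P C, 0 < r :> R &
    forall a b, 0 <= a -> a <= b -> b <= T -> t - r < a -> b < t + r ->
      window c t rho K P C a b].
Proof.
move=> tT ac cq.
have [rho [K [rho0 K0 cod fc fc2]]] := chart_bounds X_smooth ac cq.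
have [r1 [C1 [r10 C10 r1P]]] := q_sol.1 t c tT ac cq.
have rho4 : 0 < rho / 4 by rewrite divr_gt0.
have [r2 r20 r2P] := wlip_at_dist om_weight tT (q_sol.1 t c tT ac cq) rho4.
have [r3 r30 r3P] := @small_window _ l _ om_weight _ _ t K0 rho0.
have [r4 [P [C2 [r40 P0 C20 r4P]]]] := frame_local tT ac cq.
pose r := Num.min (Num.min r1 r2) (Num.min r3 r4).
have rle : [/\ r <= r1, r <= r2, r <= r3 & r <= r4] by rewrite /r !ge_min !lexx ?orbT.
exists rho, K, P, (C1 + C2), r; split.
- by split=> //; rewrite addr_ge0.
- by rewrite !lt_min r10 r20 r30.
have [l1 l2 l3 l4] := rle; move=> a b a0 ab bT ra rb.
have hl r' : r <= r' -> t - r' < a by move=> rr; apply: le_lt_trans ra; rewrite lerD2l lerN2.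
have hr r' : r <= r' -> b < t + r' by move=> rr; apply: lt_le_trans rb _; rewrite lerD2l.
have inw s : a <= s <= b -> t - r2 < s < t + r2.
  by move=> /andP[as_ sb]; rewrite (lt_le_trans (hl _ l2) as_) (le_lt_trans sb (hr _ l2)).
have in0 s : a <= s <= b -> 0 <= s <= T.
  by move=> /andP[as_ sb]; rewrite (le_trans a0 as_) (le_trans sb bT).
have near_q s : a <= s <= b -> dom c (q s) /\ `|c (q s) - c (q t)| <= rho / 4.
  by move=> sab; apply: r2P; [exact: in0 | exact: inw].
have [s1 s2] := r3P a b (hl _ l3) ab (hr _ l3).
have qC s s' : a <= s -> s <= s' -> s' <= b -> `|c (q s') - c (q s)| <= C1 * (W s' - W s).
  move=> as_ ss' s'b.
  have [||_ _ //] := r1P s s' (le_trans a0 as_) ss' (le_trans s'b bT).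
  - exact: lt_le_trans (hl _ l1) as_.
  - exact: le_lt_trans s'b (hr _ l1).
split=> //.
- by move=> s /near_q[].
- by move=> s /near_q[].
- apply: (msol_local_sol om_weight q_sol ac r1P C10 a0 bT (hl _ l1) (hr _ l1)).
  move=> s /near_q[_ h]; apply: le_trans h _.
  by rewrite ler_pdivrMr// ler_peMr ?(ltW rho0)// ler1n.
- move=> s s' as_ ss' s'b; apply: le_trans (qC s s' as_ ss' s'b) _.
  by rewrite ler_wpM2r ?W_sub_ge0// lerDl.
move=> k; have [p1 p2 p3] := r4P a b a0 ab bT (hl _ l4) (hr _ l4) k; split=> //.
move=> s s' as_ ss' s'b; apply: le_trans (p2 s s' as_ ss' s'b) _.
by rewrite ler_wpM2r ?W_sub_ge0// lerDr.
Qed.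


End Family.

Section FamilyExtension.
Context {R : realType} {n l : nat} {M : smooth_manifold R n}.
Variable (om : R -> R).
Hypothesis om_weight : weight om.
Local Notation W := (primitive om).
Variable (X : 'I_l -> M -> 'rV[R]_n).
Hypothesis X_smooth : forall i, smooth_vfield (X i).
Variables (T : R) (u : control T l) (q : R -> M) (Phi : 'I_n -> R -> 'cV[R]_n).
Hypothesis ule : forall i t, 0 <= t <= T -> `|u i t| <= om t.
Hypothesis u_meas : forall i, measurable_fun setT (u i).
Hypothesis q_sol : msol om X (fun i => u i) 0 T q.
Hypothesis Phi_pont : forall a, pontryagin_covector X u q (Phi a).
Variable (v : 'I_l -> R -> R).
Implicit Types (c : chart R n M).

Local Notation pert := (perturbed u v).
Local Notation fam := (family om X u q Phi v).

(** Trajectories on the manifold up to time a are continued by solutions in a chart;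
    differentiability in s has to be known only at the final time b. *)
Lemma family_extend c x0 rho a b k alpha d C (qs : R -> R -> M) (Z Y : R -> R -> 'rV[R]_n) :
  atlas c -> (forall x, `|x - x0| <= rho -> (c @` dom c) x) ->
  0 <= a -> a < b -> dom c (q b) -> 0 < d -> 0 <= C ->
  (forall s, `|s| < d -> [/\ msol om X (pert s) 0 a (qs s), qs s 0 = q 0 & dom c (qs s a)]) ->
  (forall s, `|s| < d -> [/\ local_sol om (fun i => vfield_in c (X i)) x0 rho (pert s) a b (Z s),
     Z s a = c (qs s a), is_derive s (1 : R) (Z ^~ b) (Y s b) & `|Y s b| <= C * `|s| ^+ k]) ->
  Z 0 b = c (q b) ->
  leading_term k alpha (fun j => cotangent_in c (q b) (Phi j b)) (Y ^~ b) ->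
  fam k alpha b.
Proof.
move=> ac cod a0 ab cqb d0 C0 qsP ZP Zb lt.
pose qs' s t := if t <= a then qs s t else param c (Z s t).
have qs'b s : qs' s b = param c (Z s b) by rewrite /qs' leNgt ab.
have Zcod s : `|s| < d -> exists2 p, dom c p & c p = Z s b.
  move=> sd; have [[_ h _] _ _ _] := ZP s sd.
  have bab : a <= b <= b by rewrite lexx ltW.
  by have [p ? ?] := cod _ (h b bab); exists p.
have cqs' s : `|s| < d -> dom c (qs' s b) /\ c (qs' s b) = Z s b.
  by move=> /Zcod[p cp pE]; rewrite qs'b -pE coordsK.
have q'0 : qs' 0 b = q b by rewrite qs'b Zb coordsK.
exists qs', d; split=> //.
- move=> s sd; have [q1 q10 cq1] := qsP s sd; have [Zs Za _ _] := ZP s sd.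
  split; last by rewrite /qs' a0.
  apply: (msol_glue om_weight a0 (ltW ab) _ q1); first by rewrite /= Za coordsK.
  exact: (local_sol_msol om_weight ac cod Zs).
- move=> c' ac' c'q; apply: (family_in_change ac ac' cqb c'q q'0).
  exists d, C, (Y ^~ b); split=> // s sd.
  have [cs csE] := cqs' s sd; have [_ _ Zd Yle] := ZP s sd; split=> //.
  apply: near_eq_is_derive Zd.
  by apply: filterS (near_norm_lt sd) => s' /cqs'[_ ->].
Qed.

Lemma perturbed0 s a b : (forall i t, a < t < b -> v i t = 0) ->
  forall i t, a < t < b -> u i t = pert s i t.
Proof. by move=> v0 i t tab; rewrite /perturbed v0// mulr0 addr0. Qed.

Lemma local_sol_ext (f : 'I_l -> 'rV[R]_n -> 'rV[R]_n) x0 rho w w' a b Z :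
  (forall i t, a < t < b -> w i t = w' i t) ->
  local_sol om f x0 rho w a b Z -> local_sol om f x0 rho w' a b Z.
Proof.
move=> ww' [h1 h2 h3]; split=> //; apply: aeS h3 => t h tab.
by rewrite -(eq_bigr _ (fun i _ => congr1 (fun z => z *: f i (Z t)) (ww' i t tab))); exact: h.
Qed.

(** Where v vanishes all members follow the same control u from different points, and
    [pairing_transport] shows that the pairings drift by o(|s|^k). *)
Lemma family_window c t rho K P C a b k alpha : atlas c -> dom c (q t) ->
  window_bounds X q c t rho K P C -> window om X u q Phi c t rho K P C a b ->
  0 <= a -> a < b -> b <= T -> (forall i t, a < t < b -> v i t = 0) ->
  fam k alpha a -> fam k alpha b.
Proof.
move=> ac cq wb win a0 ab bT v0 [qs [e [e0 qsP qs0 F]]].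
have [rho0 K0 P0 C0 cod fc fc2] := wb.
have [s1 s2 qdom qdist xsol _ frame] := win.
have aab : a <= a <= b by rewrite lexx ltW.
have bab : a <= b <= b by rewrite lexx ltW.
have [d [C' [g [d0 C'0 gP glt]]]] := F c ac (qdom a aab).
pose gam s := c (qs s a).
have gam0 : gam 0 = (c \o q) a by rewrite /gam qs0.
have ulab i s : a <= s <= b -> `|u i s| <= om s.
  by move=> /andP[h1 h2]; rewrite ule// (le_trans a0 h1) (le_trans h2 bT).
have m0 : 0 < Num.min e d by rewrite lt_min e0.
have gamd s : `|s| < Num.min e d -> is_derive s (1 : R) gam (g s).
  by rewrite lt_min => /andP[_ sd]; have [] := gP s sd.
(* The family of solutions is built with zero perturbation of the control, so s acts through the
   initial points only and the velocities solve the homogeneous linearised equation. *)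
pose z (_ : 'I_l) (_ : R) : R := 0.
have mz i : measurable_fun setT (z i) by exact: measurable_cst.
have z0 i s : a <= s <= b -> `|z i s| <= 0 * om s.
  by rewrite normr0 mul0r.
have [e' [Z [Y [e'0 e'e ZY]]]] := local_family om_weight K0 fc (ltW ab) s1 s2 rho0 (lexx 0)
  u_meas mz ulab z0 xsol (qdist a aab) m0 gam0 gamd.
have sm (s : R) : `|s| < e' -> `|s| < e /\ `|s| < d.
  by move=> se; have := lt_le_trans se e'e; rewrite lt_min => /andP.
have Z0 : Z 0 b = c (q b).
  have z00 : `|0 : R| < e' by rewrite normr0.
  have [_ _ _ h _] := ZY 0 z00.
  have := h b bab; rewrite subrr normr0 !(mul0r, mulr0, addr0) normr_le0 subr_eq0.
  by move/eqP.
have Yle (s : R) t' : `|s| < e' -> a <= t' <= b -> `|Y s t'| <= 2 * C' * `|s| ^+ k.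
  move=> se tab; have [_ _ _ _ h] := ZY s se; apply: le_trans (h _ tab) _.
  rewrite !(mulr0, mul0r) addr0 -mulrA ler_wpM2l//.
  by have [_ _] := gP s (sm s se).2.
have usol (s : R) : `|s| < e' -> local_sol om (fun i => vfield_in c (X i)) (c (q t)) rho (fun i => u i) a b (Z s).
  move=> se; have [[h _] _ _ _ _] := ZY s se.
  by apply: local_sol_ext h => i t' _; rewrite mulr0 addr0.
have gamc : {for (0 : R), continuous gam}.
  have [_ [gd _] _] := gP 0 (eq_ind_r (fun z => z < d) d0 (normr0 R)).
  exact: (differentiable_continuous ((derivable1_diffP _ _).1 gd)).
have dW0 : 0 <= W b - W a by rewrite W_sub_ge0// ltW.
have lt' : leading_term k alpha (fun j => cotangent_in c (q b) (Phi j b)) (Y ^~ b).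
  apply: (leading_term_perturb (d := e') (C := l%:R * n%:R * P * K * (2 * C') * 2 * (W b - W a)) e'0 _ gamc _ glt).
  by nneg.
move=> s a' se; have [p1 p2 p3] := frame a'.
have [[_ Za] [Ys Ya] _ hZ _] := ZY s se.
have us := usol s se.
have vs : variational_sol om (fun i => vfield_in c (X i)) a b (fun i => u i) (fun _ _ => 0) (Z s) (Y s).
  case: Ys => Y1 Y2; split=> //; apply: aeS Y2 => t' h tab.
  rewrite -(eq_bigr _ (fun i _ => congr1 (fun z => z *: 'D_(Y s t') (vfield_in c (X i)) (Z s t'))
    (_ : u i t' + s * 0 = u i t'))); first exact: h.
  by move=> i _; rewrite mulr0 addr0.
have D t' : a <= t' <= b -> `|Z s t' - (c \o q) t'| <= 2 * `|gam s - gam 0|.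
  by move=> tab; apply: le_trans (hZ _ tab) _; rewrite !(mulr0, mul0r) addr0.
have := pairing_transport om_weight K0 fc (ltW ab) ulab xsol p3 us vs p1 (fun t' => Yle s t' se) D.
rewrite Ya => h; apply: le_trans h _; apply: le_of_eq.
by move: (_ ^+ k) => x; ring.
have A s : `|s| < e' -> [/\ msol om X (pert s) 0 a (qs s), qs s 0 = q 0 & dom c (qs s a)].
  move=> se; have [h1 h2] := sm s se; have [q1 q2] := qsP s h1.
  by split=> //; have [] := gP s h2.
have B s : `|s| < e' -> [/\ local_sol om (fun i => vfield_in c (X i)) (c (q t)) rho (pert s) a b (Z s),
     Z s a = c (qs s a), is_derive s (1 : R) (Z ^~ b) (Y s b) & `|Y s b| <= 2 * C' * `|s| ^+ k].
  move=> se; have [[_ h] _ hd _ _] := ZY s se; split.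
  - by apply: local_sol_ext (usol s se); exact: perturbed0.
  - exact: h.
  - exact: hd.
  - exact: Yle.
have C20 : 0 <= 2 * C' by rewrite mulr_ge0.
exact: (family_extend ac cod a0 ab (qdom b bab) e'0 C20 A B Z0 lt').
Qed.

Lemma family_transport a b k alpha : 0 <= a -> a <= b -> b <= T ->
  (forall i t, a < t < b -> v i t = 0) -> fam k alpha a -> fam k alpha b.
Proof.
move=> a0 ab bT v0; apply: (real_induction ab) => t /andP[at_ tb].
have tT : 0 <= t <= T by rewrite (le_trans a0 at_) (le_trans tb bT).
have ac := chart_at_atlas (q t); have cq := mem_chart_at (q t).
have [rho [K [P [C [r [wb r0 rP]]]]]] := exists_window om_weight X_smooth ule q_sol Phi_pont tT ac cq.
exists r => // s /andP[as_ sb].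
have step s1 s2 : a <= s1 -> s1 <= s2 -> s2 <= b -> t - r < s1 -> s2 < t + r ->
    fam k alpha s1 -> fam k alpha s2.
  move=> as1; rewrite le_eqVlt => /predU1P[->//|s12] s2b h1 h2.
  have s10 := le_trans a0 as1; have s2T := le_trans s2b bT.
  apply: (family_window ac cq wb (rP s1 s2 s10 (ltW s12) s2T h1 h2)) => // i t' /andP[h3 h4].
  by rewrite v0// (le_lt_trans as1 h3) (lt_le_trans h4 s2b).
split.
- by move=> /andP[h1 h2]; apply: step => //; rewrite ltrDl.
- move=> /andP[h1 h2]; apply: step => //; rewrite ?gtrBl//.
Qed.

End FamilyExtension.

Lemma leading_term_sub (R : realType) n m k alpha (p : 'I_m -> 'cV[R]_n) g d C : 0 < d -> 0 <= C ->
  (forall (s : R) a, `|s| < d ->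
    `|pairing (p a) (g s) - s ^+ k * alpha a| <= C * `|s| ^+ k.+1) ->
  forall e, 0 < e -> exists2 d, 0 < d & forall (s : R) a, `|s| < d ->
    `|pairing (p a) (g s) - s ^+ k * alpha a| <= e * `|s| ^+ k.
Proof.
move=> d0 C0 gC e e0; have C1 : 0 < C + 1 by rewrite ltr_wpDl.
exists (Num.min d (e / (C + 1))); first by rewrite lt_min d0 divr_gt0.
move=> s a; rewrite lt_min => /andP[sd]; rewrite ltr_pdivlMr// => sC.
apply: le_trans (gC s a sd) _; rewrite exprS mulrA ler_wpM2r ?exprn_ge0//.
apply: le_trans _ (ltW sC); rewrite mulrC ler_wpM2l// lerDl//.
Qed.

(** * A perturbation switched on at time a *)

Section Entry.
Context {R : realType} {n l : nat} {M : smooth_manifold R n}.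
Variable (om : R -> R).
Hypothesis om_weight : weight om.
Local Notation W := (primitive om).
Variable (X : 'I_l -> M -> 'rV[R]_n).
Variables (T : R) (u : control T l) (q : R -> M) (Phi : 'I_n -> R -> 'cV[R]_n).
Hypothesis ule : forall i t, 0 <= t <= T -> `|u i t| <= om t.
Hypothesis u_meas : forall i, measurable_fun setT (u i).
Hypothesis q_sol : msol om X (fun i => u i) 0 T q.
Variables (c : chart R n M) (t0 rho K P C a b : R).
Hypotheses (ac : atlas c) (wb : window_bounds X q c t0 rho K P C)
  (win : window om X u q Phi c t0 rho K P C a b).
Hypotheses (a0 : 0 <= a) (ab : a < b) (bT : b <= T).
Variables (v : 'I_l -> R -> R) (V : R) (y : R -> 'rV[R]_n).
Hypothesis v_meas : forall i, measurable_fun setT (v i).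
Hypothesis V0 : 0 <= V.
Hypothesis vle : forall i t, a <= t <= b -> `|v i t| <= V * om t.
Hypothesis v0 : forall i t, 0 < t < a -> v i t = 0.
Local Notation f := (fun i => vfield_in c (X i)).
Local Notation pc := (fun k s => cotangent_in c (q s) (Phi k s)).
Hypothesis ysol : variational_sol om f a b (fun i => u i) v (c \o q) y.
Hypothesis ya : y a = 0.
Local Notation pert := (perturbed u v).
Local Notation dW := (W b - W a).

Let om0 t : 0 <= om t. Proof. by case: om_weight. Qed.
Let ab' : a <= b. Proof. exact: ltW. Qed.
Let dW0 : 0 <= dW. Proof. exact: W_sub_ge0. Qed.
Let ulab i t : a <= t <= b -> `|u i t| <= om t.
Proof. by move=> /andP[h1 h2]; rewrite ule// (le_trans a0 h1) (le_trans h2 bT). Qed.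
Let aab : a <= a <= b. Proof. by rewrite lexx ltW. Qed.
Let bab : a <= b <= b. Proof. by rewrite lexx ltW. Qed.

(** [B] bounds Y and the quotient of Z - x by |s|; [D1] bounds the quotient of Y - y by |s|. All
    members start at x(a), so no initial terms enter. *)
Let B := 2 * (l%:R * V * K * dW).
Let D1 := 2 * (l%:R * K * (B * B + V * B + V * B) * dW).

Let K0 : 0 <= K. Proof. by case: wb. Qed.
Let B0 : 0 <= B. Proof. by rewrite /B; nneg. Qed.
Let D10 : 0 <= D1. Proof. by rewrite /D1; nneg. Qed.

Lemma entry_family : exists d (Z Y : R -> R -> 'rV[R]_n), [/\ 0 < d, d <= 1 &
  forall s, `|s| < d -> [/\ local_sol om f (c (q t0)) rho (pert s) a b (Z s) /\
       Z s a = c (q a), is_derive s (1 : R) (Z ^~ b) (Y s b) /\ Y s a = 0,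
     variational_sol om f a b (pert s) v (Z s) (Y s),
     forall t, a <= t <= b -> `|Z s t - (c \o q) t| <= B * `|s| &
     (forall t, a <= t <= b -> `|Y s t| <= B) /\
     (forall t, a <= t <= b -> `|Y s t - y t| <= D1 * `|s|)]].
Proof.
have [rho0 _ P0 C0 cod fc fc2] := wb.
have [s1 s2 qdom qdist xsol _ frame] := win.
have gd (s : R) : `|s| < 1 -> is_derive s (1 : R) (fun _ : R => (c \o q) a) (0 : 'rV[R]_n).
  by move=> _; exact: is_derive_cst.
have [d [Z [Y [d0 d1 ZY]]]] := local_family om_weight K0 fc (ltW ab) s1 s2 rho0 V0
  u_meas v_meas ulab vle xsol (qdist a aab) ltr01 erefl gd.
exists d, Z, Y; split; [exact: d0|exact: d1|] => s sd; have [[Zs Za] [Ys Ya] Zd Zle Yle] := ZY s sd.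
have hZ t : a <= t <= b -> `|Z s t - (c \o q) t| <= B * `|s|.
  move=> tab; apply: le_trans (Zle t tab) _; rewrite subrr normr0 add0r.
  by apply: le_of_eq; rewrite /B; ring.
have hY t : a <= t <= b -> `|Y s t| <= B.
  move=> tab; apply: le_trans (Yle t tab) _.
  by apply: le_of_eq; rewrite /B normr0 add0r.
split; [by []|split; [exact: Zd|by []]|exact: Ys|exact: hZ|split; first exact: hY].
move=> t tab.
have := variational_dist om_weight K0 fc ab' s1 ulab xsol V0 (fun _ _ => erefl) vle Zs Ys ysol hY hZ tab.
rewrite Ya ya subrr normr0 add0r => h; apply: le_trans h _; apply: le_of_eq.
by rewrite /D1; move: `|s| B dW => x z w; ring.
Qed.

(** Before time a the perturbed control equals u, and q itself is the trajectory for every s. *)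
Lemma entry_start (Z Y : R -> R -> 'rV[R]_n) d k alpha C' : 0 < d -> 0 <= C' ->
  (forall s, `|s| < d -> [/\ local_sol om f (c (q t0)) rho (pert s) a b (Z s),
     Z s a = c (q a), is_derive s (1 : R) (Z ^~ b) (Y s b) & `|Y s b| <= C' * `|s| ^+ k]) ->
  Z 0 b = c (q b) ->
  leading_term k alpha (pc ^~ b) (Y ^~ b) ->
  family om X u q Phi v k alpha b.
Proof.
move=> d0 C'0 ZP Zb lt.
have [rho0 _ P0 C0 cod fc fc2] := wb.
have [s1 s2 qdom qdist xsol _ frame] := win.
apply: (family_extend (qs := fun _ => q) om_weight ac cod a0 ab (qdom b bab) d0 C'0 _ ZP Zb lt).
move=> s _; split=> //; last exact: qdom.
apply: msol_ext (msolS (lexx 0) (le_trans ab' bT) q_sol) => // i t ta.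
by rewrite /perturbed v0// mulr0 addr0.
Qed.

Lemma entry_order0 : family om X u q Phi v 0 (fun k => pairing (pc k b) (y b)) b.
Proof.
have [rho0 _ P0 C0 cod fc fc2] := wb.
have [s1 s2 qdom qdist xsol _ frame] := win.
have [d [Z [Y [d0 _ ZY]]]] := entry_family.
apply: (entry_start (Z := Z) (Y := Y) d0 B0).
- move=> s sd; have [[Zs Za] [Zd _] _ _ [YB _]] := ZY s sd; split=> //.
  by rewrite expr0 mulr1; exact: YB.
- have z00 : `|0 : R| < d by rewrite normr0.
  have [_ _ _ h _] := ZY 0 z00; have := h b bab.
  by rewrite normr0 mulr0 normr_le0 subr_eq0 => /eqP.
apply: (leading_term_sub (d := d) (C := n%:R * (P * D1)) d0).
  by nneg.
move=> s k sd; rewrite expr0 mul1r expr1.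
have [_ _ _ _ [_ hY]] := ZY s sd; have [pP _ _] := frame k.
apply: le_trans (pairing_sub_le _ erefl) _.
apply: le_trans (pairing_le2 (pP b bab) (hY b bab)) _.
by apply: le_of_eq; rewrite !mulrA.
Qed.

(** Since y b = 0, the velocity at b is O(|s|), and its pairings are s times the integrated second
    variation up to O(s^2). *)
Lemma entry_order1 (be : 'I_n -> R -> R) : y b = 0 ->
  (forall k, [/\ be k a = 0, Wlip om a b (be k) & {ae lebesgue_measure, forall t, a < t < b ->
     is_derive t (1 : R) (be k) (second_variation f (fun i => u i) (c \o q) v (pc k) y t)}]) ->
  family om X u q Phi v 1 (fun k => be k b) b.
Proof.
move=> yb beP.
have [rho0 _ P0 C0 cod fc fc2] := wb.
have [s1 s2 qdom qdist xsol _ frame] := win.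
have [d [Z [Y [d0 d1 ZY]]]] := entry_family.
have z00 : `|0 : R| < d by rewrite normr0.
(* At s = 0 the family estimate reads Y 0 = y, so y inherits the bound on Y. *)
have yB t : a <= t <= b -> `|y t| <= B.
  move=> tab; have [_ _ _ _ [h1 h2]] := ZY 0 z00.
  have := h2 t tab; rewrite normr0 mulr0 normr_le0 subr_eq0 => /eqP <-; exact: h1.
apply: (entry_start (Z := Z) (Y := Y) d0 D10).
- move=> s sd; have [[Zs Za] [Zd _] _ _ [_ YD]] := ZY s sd; split=> //.
  by have := YD b bab; rewrite yb subr0 expr1.
- have [_ _ _ h _] := ZY 0 z00; have := h b bab.
  by rewrite normr0 mulr0 normr_le0 subr_eq0 => /eqP.
pose E := 2 * (l%:R * K * (2 * B ^+ 2 + V * B) * dW).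
have E0 : 0 <= E by rewrite /E; nneg.
(* One constant for the errors in Z, in Y and in the first-order expansion of Z, as
   [second_order_error] expects. *)
pose D := B + D1 + E.
have DB : B <= D by rewrite /D -addrA lerDl addr_ge0.
have DD : D1 <= D by rewrite /D addrAC lerDr addr_ge0.
have DE : E <= D by rewrite /D lerDr addr_ge0.
have D0 : 0 <= D by rewrite /D !addr_ge0.
pose F := l%:R * n%:R * P * (K * (D ^+ 2 + n%:R * D ^+ 2 * B + n%:R * D * B)
      + V * (K * D + K * B * D) + V * (K * D ^+ 2 + K * D)) * dW.
have F0 : 0 <= F by rewrite /F; nneg.
apply: (leading_term_sub (d := d) d0 F0).
move=> s k sd; rewrite expr1.
have [[Zs Za] [_ Ya] Ys hZ [_ hY]] := ZY s sd.
have [pP _ pcov] := frame k; have [bea beW bed] := beP k.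
have hZy t : a <= t <= b -> `|Z s t - (c \o q) t - s *: y t| <= D * `|s| ^+ 2.
  move=> tab; have ul2 i t' : a <= t' <= b -> `|u i t'| <= 2 * om t'.
    by move=> h; apply: le_trans (ulab i h) _; rewrite ler_peMl// ler1n.
  have Bs0 : 0 <= B * `|s| by rewrite mulr_ge0.
  have := variational_error om_weight K0 fc ab' s1 V0 Bs0 ul2 vle xsol Zs ysol hZ tab.
  rewrite Za ya scaler0 subr0 subrr normr0 add0r => h; apply: le_trans h _.
  apply: (@le_trans _ _ (E * `|s| ^+ 2)); last by rewrite ler_wpM2r ?exprn_ge0.
  by apply: le_of_eq; rewrite /E; move: `|s| B dW => x z w; ring.
have sD D' : D' <= D -> D' * `|s| <= D * `|s| by move=> h; rewrite ler_wpM2r.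
have := second_order_error om_weight K0 fc fc2 ab' ulab xsol V0 (fun _ _ => erefl) vle pcov
  Zs Ys ysol Ya ya bea beW bed pP yB (fun t h => le_trans (hZ t h) (sD _ DB))
  (fun t h => le_trans (hY t h) (sD _ DD)) hZy.
by rewrite yb pairing0r subr0.
Qed.

End Entry.

(** * Derivatives of the end-point map *)

Section Endpoint.
Context {R : realType} {n l : nat} {M : smooth_manifold R n}.
Variable (om : R -> R).
Hypothesis om_weight : weight om.
Variable (X : 'I_l -> M -> 'rV[R]_n).
Hypothesis X_smooth : forall i, smooth_vfield (X i).
Variables (T : R) (q0 : M) (u : control T l) (q : R -> M) (Phi : 'I_n -> R -> 'cV[R]_n).
Hypothesis T_gt0 : 0 < T.
Hypothesis ule : forall i t, 0 <= t <= T -> `|u i t| <= om t.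
Hypothesis q_traj : trajectory X q0 u q.
Variables (v : control T l) (V : R).
Hypothesis V0 : 0 <= V.
Hypothesis vle : forall i t, 0 <= t <= T -> `|v i t| <= V * om t.
Implicit Types (c : chart R n M).

Let om0 t : 0 <= om t. Proof. by case: om_weight. Qed.
Let vf i t : R := v i t.

Lemma controlE s i t : (u + s *: v) i t = perturbed u vf s i t.
Proof. by rewrite !ffunE. Qed.

Lemma control_le (s : R) i t : `|s| * V <= 1 -> 0 <= t <= T -> `|(u + s *: v) i t| <= 2 * om t.
Proof.
move=> sV tT; rewrite controlE mulrDl mul1r; apply: le_trans (ler_normD _ _) _.
apply: lerD; first exact: ule.
rewrite normrM; apply: (@le_trans _ _ (`|s| * (V * om t))); first by rewrite ler_wpM2l// vle.
by rewrite mulrA ler_piMl.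
Qed.

(** [End] picks an arbitrary trajectory of the control, and uniqueness identifies its final point.
    The bound |s| V <= 1 puts the control below 2 om, where uniqueness applies. *)
Lemma End_msol (s : R) (q' : R -> M) : `|s| * V <= 1 -> msol om X (perturbed u vf s) 0 T q' -> q' 0 = q 0 ->
  End X q0 T (u + s *: v) = q' T.
Proof.
move=> sV q's q'0.
have E : (fun i => perturbed u vf s i) = (fun i => (u + s *: v) i : R -> R).
  by apply/funext => i; apply/funext => t; rewrite controlE.
have q's' : msol om X (fun i => (u + s *: v) i : R -> R) 0 T q' by rewrite -E.
have [q00 _ _ _] := q_traj.
have tr := msol_trajectory om_weight q's'.
rewrite q'0 q00 in tr.
(* The default value of the choice is excluded by exhibiting the trajectory q'. *)
rewrite /End; case: xgetP => [p _ [q2 tr2 <-]|/(_ (q' T))]; last by case; exists q'.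
have le2 i t : 0 <= t <= T -> `|(u + s *: v) i t| <= 2 * om t by exact: control_le.
apply: (msol_unique om_weight X_smooth (ltW T_gt0) le2 _ q's').
  exact: (trajectory_msol om_weight X_smooth le2 tr2).
by case: tr2 => -> _ _ _; rewrite q'0 q00.
Qed.

Lemma endpoint_family c k alpha : atlas c -> dom c (q T) -> family om X u q Phi vf k alpha T ->
  exists d C (g : R -> 'rV[R]_n), [/\ 0 < d, 0 <= C,
    End X q0 T u = q T,
    forall s : R, `|s| < d -> is_derive s (1 : R) (fun s => c (End X q0 T (u + s *: v))) (g s) /\
      `|g s| <= C * `|s| ^+ k &
    leading_term k alpha (fun a => cotangent_in c (q T) (Phi a T)) g].
Proof.
move=> ac cq [qs [e [e0 qsP qs0 F]]].
have [d [C [g [d0 C0 gP glt]]]] := F c ac cq.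
have V1 : 0 < V + 1 by rewrite ltr_wpDl.
pose d' := Num.min (V + 1)^-1 (Num.min d e).
have d'0 : 0 < d' by rewrite !lt_min invr_gt0 V1 d0.
have EE (s : R) : `|s| < d' -> End X q0 T (u + s *: v) = qs s T.
  rewrite !lt_min => /and3P[sV sd se]; have [q1 q2] := qsP s se.
  apply: End_msol q1 q2; apply: (@le_trans _ _ (`|s| * (V + 1))).
    by rewrite ler_wpM2l// lerDl.
  by rewrite -ler_pdivlMr// mul1r ltW.
exists d', C, g; split=> //.
  have := EE 0; rewrite normr0 scale0r addr0 => ->//.
move=> s sd'; have := sd'; rewrite !lt_min => /and3P[_ sd _].
have [_ gd gle] := gP s sd; split=> //.
apply: near_eq_is_derive gd.
by apply: filterS (near_norm_lt sd') => s' /EE ->.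
Qed.

Lemma DEnd_order0 alpha : family om X u q Phi vf 0 alpha T ->
  forall a, pairing (Phi a T) (DEnd X q0 u v) = alpha a.
Proof.
move=> fam a.
have [d [C [g [d0 C0 E0 gP lt]]]] := endpoint_family (chart_at_atlas (q T)) (mem_chart_at (q T)) fam.
have [gd _] := gP 0 (eq_ind_r (fun z => z < d) d0 (normr0 R)).
rewrite /DEnd E0 derive1E derive_val.
apply/eqP; rewrite -subr_eq0 -normr_le0; apply/ler_addgt0Pr => e e0; rewrite add0r.
have [d1 d10 h] := lt e e0.
have := h 0 a; rewrite normr0 !expr0 mul1r mulr1 cotangent_in_chart_at; exact.
Qed.

(** A velocity known only through its pairings with a basis is differentiable if the pairings are.
    Existence matters: without it [derive1n 2] would not be the second derivative. *)
Lemma is_derive_frame (P : 'M[R]_n) (g : R -> 'rV[R]_n) (x : R) (al : 'rV[R]_n) : P \in unitmx ->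
  (forall a, is_derive x (1 : R) (fun s => pairing (col a P) (g s)) (al 0 a)) ->
  is_derive x (1 : R) g (al *m invmx P).
Proof.
move=> Pu gP; apply: is_derive_mx => i j; rewrite ord1 mxE.
have E : (fun s => g s 0 j) = (fun s => \sum_a (invmx P a j) *: pairing (col a P) (g s)).
  apply/funext => s; rewrite -[g s](mulmxK Pu) mxE; apply: eq_bigr => a _.
  rewrite mulrC /GRing.scale/= pairingE mxE; congr (_ * _).
  by apply: eq_bigr => k _; rewrite mulmxK// [in RHS]mxE.
rewrite E (eq_bigr (fun a => invmx P a j *: al 0 a)); last first.
  by move=> a _; rewrite mulrC.
by apply: is_derive_sumF => a; apply: is_deriveZF.
Qed.

Lemma D2End_order1 c alpha : atlas c -> dom c (q T) ->
  (\matrix_(i < n, a < n) cotangent_in c (q T) (Phi a T) i 0) \in unitmx ->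
  family om X u q Phi vf 1 alpha T ->
  DEnd X q0 u v = 0 /\
  forall a, pairing (cotangent_in c (q T) (Phi a T)) (D2End X q0 c u v) = alpha a.
Proof.
move=> ac cq Pu fam; split.
  have [d [C [g [d0 C0 E0 gP lt]]]] := endpoint_family (chart_at_atlas (q T)) (mem_chart_at (q T)) fam.
  have [gd gle] := gP 0 (eq_ind_r (fun z => z < d) d0 (normr0 R)).
  rewrite /DEnd E0 derive1E derive_val; apply/eqP.
  by move: gle; rewrite normr0 expr1 mulr0 normr_le0.
have [d [C [g [d0 C0 E0 gP lt]]]] := endpoint_family ac cq fam.
set P := \matrix_(i, a) _ in Pu.
have g0 : g 0 = 0.
  have [_ gle] := gP 0 (eq_ind_r (fun z => z < d) d0 (normr0 R)).
  by apply/eqP; move: gle; rewrite normr0 expr1 mulr0 normr_le0.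
have colP a : col a P = cotangent_in c (q T) (Phi a T).
  by apply/colP => i; rewrite !mxE.
have gd : is_derive (0 : R) (1 : R) g ((\row_a alpha a) *m invmx P).
  apply: is_derive_frame => // a; rewrite mxE; apply/is_deriveP => e e0.
  have [r r0 rP] := lt e e0; exists r => // s; rewrite subr0 => sr.
  by rewrite g0 pairing0r subr0 colP; have := rP s a sr; rewrite !expr1.
have D2 : D2End X q0 c u v = (\row_a alpha a) *m invmx P.
  rewrite /D2End /= derive1E; set F := derive1 _.
  (* The first derivative of the end-point curve equals g for all s near 0, so differentiating g at
     0 differentiates it. *)
  have Fg : \forall s \near (0 : R), g s = F s.
    have n0 : `|0 : R| < d by rewrite normr0.
    apply: filterS (near_norm_lt n0) => s /gP[hd _].
    by rewrite /F derive1E derive_val.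
  by have := near_eq_is_derive Fg gd => hd; rewrite derive_val.
move=> a; by rewrite D2 -colP /pairing colE mulmxA mulmxKV// -colE !mxE.
Qed.

End Endpoint.

(** * Linear combinations of Pontryagin covectors *)

Section Combination.
Context {R : realType} {n l : nat} {M : smooth_manifold R n}.
Variables (X : 'I_l -> M -> 'rV[R]_n) (T : R) (u : control T l) (q : R -> M).
Implicit Types (c : chart R n M).

Lemma abs_continuousD (V : normedModType R) (a b : R) (f g : R -> V) :
  abs_continuous a b f -> abs_continuous a b g -> abs_continuous a b (fun t => f t + g t).
Proof.
move=> fac gac e e0; have e2 : 0 < e / 2 by rewrite divr_gt0.
have [d1 d10 h1] := fac _ e2; have [d2 d20 h2] := gac _ e2.
exists (Num.min d1 d2); first by rewrite lt_min d10.
move=> m s t st tt; rewrite lt_min => /andP[k1 k2].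
apply: (@le_lt_trans _ _ (\sum_(i < m) `|f (t i) - f (s i)| + \sum_(i < m) `|g (t i) - g (s i)|)).
  rewrite -big_split/=; apply: ler_sum => i _; rewrite opprD addrACA; exact: ler_normD.
by have := ltrD (h1 m s t st tt k1) (h2 m s t st tt k2); rewrite -splitr.
Qed.

Lemma abs_continuousZ (V : normedModType R) (a b k : R) (f : R -> V) :
  abs_continuous a b f -> abs_continuous a b (fun t => k *: f t).
Proof.
move=> fac e e0; have k1 : 0 < `|k| + 1 by rewrite ltr_wpDl.
have [d d0 h] := fac _ (divr_gt0 e0 k1); exists d => // m s t st tt sd.
have := h m s t st tt sd; rewrite ltr_pdivlMr// => h'.
apply: le_lt_trans h'; rewrite mulr_suml; apply: ler_sum => i _.
by rewrite -scalerBr normrZ mulrC ler_wpM2l// lerDl.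
Qed.

Lemma abs_continuous_sum (V : normedModType R) (a b : R) (I : finType) (f : I -> R -> V) :
  (forall i, abs_continuous a b (f i)) -> abs_continuous a b (fun t => \sum_i f i t).
Proof.
move=> fac; elim: (index_enum I) => [|i s IH].
  move=> e e0; exists 1 => // m s t _ _ _; rewrite big1// => i _.
  by rewrite !big_nil subrr normr0.
rewrite (_ : (fun _ => _) = (fun t => f i t + \sum_(j <- s) f j t)).
  exact: abs_continuousD.
by apply/funext => t; rewrite big_cons.
Qed.

Lemma pontryagin_sum (I : finType) (a : I -> R) (phi : I -> R -> 'cV[R]_n) :
  (forall i, pontryagin_covector X u q (phi i)) ->
  pontryagin_covector X u q (fun t => \sum_i a i *: phi i t).
Proof.
move=> phiP c ac phic.
have E : phic = (fun t => \sum_i a i *: cotangent_in c (q t) (phi i t)).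
  apply/funext => t; rewrite /phic /cotangent_in mulmx_sumr; apply: eq_bigr => i _.
  by rewrite scalemxAr.
rewrite E; split.
  move=> s t s0 st tT cq; apply: abs_continuous_sum => i; apply: abs_continuousZ.
  by have [h _] := phiP i c ac; exact: h.
have /aeS : {ae @lebesgue_measure R, forall t, forall i, 0 <= t <= T -> dom c (q t) ->
    derivable (fun t => cotangent_in c (q t) (phi i t)) t 1 /\
    forall b : 'rV[R]_n,
      pairing (derive1 (fun t => cotangent_in c (q t) (phi i t)) t) b
      + \sum_(j < l) u j t
          * pairing (cotangent_in c (q t) (phi i t)) ('D_b (vfield_in c (X j)) (c (q t))) = 0}.
  by apply: ae_all => i; have [_ h] := phiP i c ac.
apply => t h tT cq.
have hd i : is_derive t (1 : R) (fun t => a i *: cotangent_in c (q t) (phi i t))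
    (a i *: derive1 (fun t => cotangent_in c (q t) (phi i t)) t).
  apply: is_deriveZF; have [hd _] := h i tT cq.
  by rewrite derive1E; exact: derivableP.
have hs := is_derive_sumF hd; split; first by case: hs.
move=> b; rewrite derive1E derive_val.
rewrite pairing_suml.
have -> : \sum_j u j t * pairing (\sum_i a i *: cotangent_in c (q t) (phi i t))
    ('D_b (vfield_in c (X j)) (c (q t))) =
  \sum_i a i * \sum_j u j t * pairing (cotangent_in c (q t) (phi i t))
    ('D_b (vfield_in c (X j)) (c (q t))).
  under eq_bigr do rewrite pairing_suml mulr_sumr.
  rewrite exchange_big/=; apply: eq_bigr => i _; rewrite mulr_sumr; apply: eq_bigr => j _.
  by rewrite pairingZl mulrCA.
rewrite -big_split/= big1// => i _; have [_ hi] := h i tT cq.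
by rewrite pairingZl -mulrDr hi mulr0.
Qed.

End Combination.

Lemma pairing_delta (R : realType) n (lam : 'cV[R]_n) j : pairing lam (delta_mx 0 j) = lam j 0.
Proof.
rewrite pairingE (bigD1 j)//= big1 => [|k kj]; last by rewrite mxE (negbTE kj) andbF mul0r.
by rewrite addr0 mxE !eqxx mul1r.
Qed.

Lemma cotangent_in_eq0 (R : realType) n (M : smooth_manifold R n) (c : chart R n M) p
  (lam : 'cV[R]_n) : atlas c -> dom c p -> cotangent_in c p lam = 0 -> lam = 0.
Proof.
move=> ac cp lam0; apply/colP => j; rewrite mxE -pairing_delta -(pairing_tangent _ _ ac cp).
by apply: etrans (congr1 (fun z => pairing z _) lam0) _; exact: pairing0l.
Qed.

(** * The frame is still a basis at the final time *)

Section FrameInvertible.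
Context {R : realType} {n l : nat} {M : smooth_manifold R n}.
Variable (om : R -> R).
Hypothesis om_weight : weight om.
Variable (X : 'I_l -> M -> 'rV[R]_n).
Hypothesis X_smooth : forall i, smooth_vfield (X i).
Variables (T : R) (u : control T l) (q : R -> M).
Hypothesis T_gt0 : 0 < T.
Hypothesis ule : forall i t, 0 <= t <= T -> `|u i t| <= om t.
Hypothesis u_meas : forall i, measurable_fun setT (u i).
Hypothesis q_sol : msol om X (fun i => u i) 0 T q.

(* Pairing with the solutions of the linearised equation, which exist for every
   initial value, propagates the vanishing of a covector backwards in time. *)
Lemma covector_sol_backward c t rho K P C a b (psi : R -> 'cV[R]_n) :
  window_bounds X q c t rho K P C -> window om X u q (fun=> psi) c t rho K P C a b ->
  0 <= a -> a <= b -> b <= T ->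
  cotangent_in c (q b) (psi b) = 0 -> cotangent_in c (q a) (psi a) = 0.
Proof.
move=> wb win a0 ab bT pb.
have [rho0 K0 P0 C0 cod fc fc2] := wb.
have [s1 s2 qdom qdist xsol _ frame] := win.
have ulab i s : a <= s <= b -> `|u i s| <= om s.
  by move=> /andP[h1 h2]; rewrite ule// (le_trans a0 h1) (le_trans h2 bT).
apply/colP => j; rewrite [RHS]mxE; have [pP _ pcov] := frame j.
have om0 s : 0 <= om s by case: om_weight.
pose z (_ : 'I_l) (_ : R) : R := 0.
have mz i : measurable_fun setT (z i) by exact: measurable_cst.
have z0 i s : a <= s <= b -> `|z i s| <= 0 * om s by rewrite normr0 mul0r.
have u2 i s : a <= s <= b -> `|u i s| <= 2 * om s.
  by move=> h; apply: le_trans (ulab i s h) _; rewrite ler_peMl// ler1n.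
have [Y [Ya Ys]] := variational_existence om_weight K0 fc ab s1 (delta_mx 0 j) (lexx 0)
  u_meas mz u2 z0 xsol.
have [B B0 YB] := wlip_bounded om_weight ab Ys.1.
have D s : a <= s <= b -> `|(c \o q) s - (c \o q) s| <= 0 by rewrite subrr normr0.
have := pairing_transport om_weight K0 fc ab ulab xsol pcov xsol Ys pP YB D.
rewrite mulr0 mul0r pb pairing0l sub0r normrN normr_le0 Ya => /eqP.
by rewrite pairing_delta.
Qed.

(** The induction runs forward on the implication from psi t = 0 to psi 0 = 0, so that each local
    step uses backward propagation of zeros. *)
Lemma pontryagin_vanish (psi : R -> 'cV[R]_n) : pontryagin_covector X u q psi ->
  psi T = 0 -> psi 0 = 0.
Proof.
move=> psiP; apply: (@real_induction R 0 T (fun t => psi t = 0 -> psi 0 = 0)) => //; first exact: ltW.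
move=> t tT; have ac := chart_at_atlas (q t); have cq := mem_chart_at (q t).
have [rho [K [P [C [r [wb r0 rP]]]]]] :=
  exists_window om_weight X_smooth ule q_sol (fun _ : 'I_n => psiP) tT ac cq.
have back s s' : 0 <= s -> s <= s' -> s' <= T -> t - r < s -> s' < t + r -> psi s' = 0 -> psi s = 0.
  move=> s0 ss' s'T h1 h2 ps'.
  have win := rP s s' s0 ss' s'T h1 h2.
  have cqs : dom (chart_at (q t)) (q s) by apply: (window_dom win); rewrite lexx.
  have p0 : cotangent_in (chart_at (q t)) (q s') (psi s') = 0 by rewrite ps' /cotangent_in mulmx0.
  move: (covector_sol_backward wb win s0 ss' s'T p0).
  exact: cotangent_in_eq0.
exists r => // s /andP[s0 sT]; have [t0 tT'] := andP tT; split.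
- move=> /andP[h1 h2] IH pt; apply: IH; apply: (back s t) => //; by rewrite ltrDl.
- move=> /andP[h1 h2] IH ps; apply: IH; apply: (back t s) => //; by rewrite gtrBl.
Qed.

Variable (Phi : 'I_n -> R -> 'cV[R]_n).
Hypothesis Phi_frame : covector_frame X u q Phi.

Lemma frame_mulmx t (a : 'cV[R]_n) : (\matrix_(i < n, k < n) Phi k t i 0) *m a = \sum_k a k 0 *: Phi k t.
Proof.
by apply/colP => i; rewrite mxE summxE; apply: eq_bigr => k _; rewrite !mxE mulrC.
Qed.

(** A linear relation between the frame covectors at T is a Pontryagin covector vanishing at T,
    hence at 0, where the frame is a basis by hypothesis. *)
Lemma frame_unit : (\matrix_(i < n, k < n) Phi k T i 0) \in unitmx.
Proof.
have [PhiP P0] := Phi_frame; set P := \matrix_(_, _) _.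
rewrite -unitmx_tr -row_free_unit -kermx_eq0; apply/eqP/row_matrixP => i; rewrite row0.
have := mulmx_ker P^T; move/(congr1 (row i)); rewrite row_mul row0.
move: (row i _) => w; move/(congr1 trmx); rewrite trmx_mul trmxK trmx0 frame_mulmx => w0.
have := pontryagin_vanish (pontryagin_sum (fun k => w^T k 0) PhiP) w0.
rewrite -frame_mulmx => /(congr1 (mulmx (invmx (\matrix_(i, k) Phi k 0 i 0)))).
by rewrite mulKmx// mulmx0 => /(congr1 trmx); rewrite trmxK trmx0.
Qed.

Lemma frame_unit_chart c : atlas c -> dom c (q T) ->
  (\matrix_(i < n, k < n) cotangent_in c (q T) (Phi k T) i 0) \in unitmx.
Proof.
move=> ac cq.
have -> : \matrix_(i < n, k < n) cotangent_in c (q T) (Phi k T) i 0 =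
    change_of_chart c (chart_at (q T)) (q T) *m \matrix_(i < n, k < n) Phi k T i 0.
  by apply/matrixP => i k; rewrite !mxE; apply: eq_bigr => j _; rewrite !mxE.
rewrite unitmx_mul frame_unit andbT.
have u0 : change_of_chart c (chart_at (q T)) (q T) *m
      change_of_chart (chart_at (q T)) c (q T) = 1%:M.
  rewrite change_of_chart_cocycle ?change_of_chart_id//; [exact: chart_at_atlas | exact: mem_chart_at].
by have [] := mulmx1_unit u0.
Qed.

Lemma frame_coordinates (phi0 : 'cV[R]_n) : phi0 != 0 ->
  exists2 a : 'I_n -> R, (exists i, a i != 0) & \sum_i a i *: Phi i T = phi0.
Proof.
move=> phi00; pose w := invmx (\matrix_(i < n, k < n) Phi k T i 0) *m phi0.
have E : \sum_i w i 0 *: Phi i T = phi0 by rewrite -frame_mulmx mulKVmx// frame_unit.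
exists (fun i => w i 0) => //; apply: contrapT => h; move/eqP: phi00; apply.
rewrite -E big1// => i _; have [->|wi] := eqVneq (w i 0) 0; first by rewrite scale0r.
by case: h; exists i.
Qed.

End FrameInvertible.

(** * Controls and the weight *)

Section Controls.
Context {R : realType}.
Local Notation mu := (@lebesgue_measure R).
Variable (T : R).
Local Notation muT := (mrestr mu (measurable_itv `[0, T])).

Lemma interval_finite : (mu `[0%R, T]%classic < +oo)%E.
Proof. by rewrite lebesgue_measure_itv/=; case: ifP => _; rewrite ltry. Qed.

(** The same measure as [muT], packaged with its finiteness: this gives access to the inclusion of
    L^2 in L^1 and to the integrability of constants. *)
Local Notation muF :=
  (@mfrestr _ (measurableTypeR R) R _ (@lebesgue_measure R) (measurable_itv `[0, T]) interval_finite).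

Lemma bounded_Lfun2 (f : R -> R) C : measurable_fun setT f -> (forall t, `|f t| <= C) ->
  f \in Lfun muT 2%:E.
Proof.
move=> mf fC.
suff : f \in Lfun muF 2%:E by [].
rewrite inE; apply/andP; split; rewrite inE//= /finite_norm unlock poweR_lty//.
apply: (@le_lt_trans _ _ (\int[muF]_(x in setT) (cst (C `^ 2)%:E) x)%E).
  apply: ge0_le_integral => //.
  - by move=> x _; rewrite poweR_ge0.
  - change (measurable_fun setT (EFin \o (fun x => `|f x| `^ 2))).
    apply/measurable_EFinP; apply: (measurableT_comp (measurable_powR _)) => //.
    exact: measurableT_comp.
  - move=> x _; rewrite lee_fin ge0_ler_powR// nnegrE// (le_trans _ (fC x))//.
by apply: integrable_lty => //; exact: (@finite_measure_integrable_cst _ _ _ muF).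
Qed.

Lemma exists_control l (v : 'I_l -> R -> R) : (forall i, measurable_fun setT (v i)) ->
  (forall i, exists C, forall t, `|v i t| <= C) ->
  exists vc : control T l, forall i t, vc i t = v i t.
Proof.
move=> mv vC.
have H i : v i \in Lfun muT 2%:E by have [C CP] := vC i; exact: bounded_Lfun2 CP.
by exists [ffun i => Lfun_Sub (lee1n 2) (H i)] => i t; rewrite ffunE.
Qed.

Lemma Lfun2_integrable (f : LfunType muT (lee1n 2)) : mu.-integrable `[0, T] (EFin \o f).
Proof.
have f2 : (f : R -> R) \in Lfun muF 2%:E by exact: LfunP.
have f1 := Lfun_subset12 (fin_num_measure muF _ measurableT) f2.
have /integrableP[mf fo] := (Lfun1_integrable muF f).1 f1.
apply/integrableP; split; first exact: measurable_funTS.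
have E : (\int[mu]_(x in `[0%R, T]) `|(EFin \o f) x| = \int[muF]_(x in `[0%R, T]) `|(EFin \o f) x|)%E.
  by apply: eq_measure_integral => A mA AD; rewrite /= /mfrestr /mrestr setIidl.
rewrite E; apply: le_lt_trans fo; apply: ge0_subset_integral => //.
exact: measurableT_comp.
Qed.

(** The function 1 + sum_i |u_i| is cut off outside [0, T], since a weight is integrable over the
    line. Integrability of |u_i| follows from square integrability on a bounded interval. *)
Lemma exists_weight l (u : control T l) : exists2 om : R -> R, weight om &
  (forall t, 0 <= t <= T -> 1 <= om t) /\ forall i t, 0 <= t <= T -> `|u i t| <= om t.
Proof.
pose D := `[0, T]%classic : set R.
pose g (t : R) := 1 + \sum_i `|u i t|.
exists (g \_ D); last first.
  have gD t : 0 <= t <= T -> (g \_ D) t = g t by move=> tT; rewrite patchE mem_set.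
  split=> [t /gD ->|i t /gD ->]; first by rewrite /g lerDl sumr_ge0.
  by rewrite /g (bigD1 i)//= addrCA lerDl addr_ge0// sumr_ge0.
split; last first.
  by move=> x; rewrite patchE; case: ifP => // _; rewrite addr_ge0// sumr_ge0.
rewrite (_ : EFin \o g \_ D = (EFin \o g) \_ D); last first.
  by apply/funext => x; rewrite /= !patchE; case: ifP.
apply/(integrable_mkcond _ _).1.
  exact: measurable_itv.
rewrite (_ : EFin \o g = (fun t => 1%:E + \sum_i (EFin \o (Num.norm \o u i)) t)%E); last first.
  by apply/funext => t; rewrite /g/= EFinD sumEFin.
apply: integrableD => //; first exact: measurable_itv.
  apply/integrableP; split => //.
  rewrite (eq_integral (cst 1%:E)) => [|x _]; last by rewrite /= normr1.
  by rewrite integral_cst ?mul1e ?interval_finite//; exact: measurable_itv.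
apply: integrable_sum => [|i _]; first exact: measurable_itv.
apply: integrable_norm.
exact: Lfun2_integrable.
Qed.

End Controls.

(** * Test functions *)

Section TestPolynomials.
Context {R : realType}.
Implicit Types (p : {poly R}).

Definition poly_primitive p : {poly R} := \poly_(i < (size p).+1) (p`_i.-1 / i%:R).

Lemma deriv_primitive p : (poly_primitive p)^`() = p.
Proof.
apply/polyP => i; rewrite coef_deriv coef_poly ltnS; case: ltnP => ip /=.
  by rewrite -[_ *+ _]mulr_natr divfK// pnatr_eq0.
by rewrite mul0rn nth_default.
Qed.

Lemma poly_primitive_coef p i : (poly_primitive p)`_i = p`_i.-1 / i%:R.
Proof.
rewrite coef_poly ltnS; case: ltnP => // ri; case: i ri => [|i] /=; first by rewrite invr0 mulr0.
by move=> ri; rewrite nth_default ?mul0r// ltnW.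
Qed.

Lemma poly_primitiveD p q : poly_primitive (p + q) = poly_primitive p + poly_primitive q.
Proof.
by apply/polyP => i; rewrite coefD !poly_primitive_coef coefD mulrDl.
Qed.

Definition poly_norm p : R := \sum_(i < size p) `|p`_i|.

Lemma horner_le p x : 0 <= x <= 1 -> `|p.[x]| <= poly_norm p.
Proof.
move=> /andP[x0 x1]; rewrite horner_coef; apply: le_trans (ler_norm_sum _ _ _) _.
apply: ler_sum => i _; rewrite normrM normrX (ger0_norm x0).
by rewrite ler_piMr// exprn_ile1.
Qed.

Lemma horner_nondecreasing p (x y : R) : (forall z, 0 <= z <= 1 -> 0 <= p^`().[z]) ->
  0 <= x -> x <= y -> y <= 1 -> p.[x] <= p.[y].
Proof.
move=> p0 x0; rewrite le_eqVlt => /predU1P[->//|xy] y1.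
have [||z] := @MVT R (fun z => p.[z]) (fun z => p^`().[z]) x y xy.
  by move=> z _; exact: is_derive_poly.
  by apply: continuous_subspaceT => z; exact: continuous_horner.
rewrite in_itv/= => /andP[xz zy]; rewrite -subr_ge0 => ->.
apply: mulr_ge0; last by rewrite subr_ge0 ltW.
by apply: p0; rewrite (le_trans x0 (ltW xz)) (le_trans (ltW zy) y1).
Qed.

Lemma poly_eq0_itv p : (forall x, 0 <= x <= 1 -> p.[x] = 0) -> p = 0.
Proof.
move=> p0; apply/eqP; apply: contraT => pn0.
(* These are [size p] distinct roots in [0, 1], more than the degree of p allows. *)
pose s : seq R := [seq k%:R / (size p)%:R | k <- iota 0 (size p)].
have sp : 0 < (size p)%:R :> R by rewrite ltr0n size_poly_gt0.
have := max_poly_roots pn0 (rs := s).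
rewrite size_map size_iota ltnn; apply.
  apply/allP => x /mapP[k]; rewrite mem_iota add0n => /andP[_ ks] ->.
  by apply/rootP; apply: p0; rewrite divr_ge0//= ler_pdivrMr// mul1r ler_nat ltnW.
rewrite map_inj_uniq ?iota_uniq// => i j /divIf; rewrite gt_eqF// => /(_ isT) /eqP.
by rewrite eqr_nat => /eqP.
Qed.

Variable n : nat.
Implicit Types (z : 'rV[R]_n).

(** The double zeros at 0 and 1 make both g and g' vanish there, so the pair (g, g') is admissible;
    the polynomial factor provides as many free coefficients as wanted. *)
Definition test_poly z : {poly R} := 'X^2 * (1 - 'X) ^+ 2 * rVpoly z.

(** The integral of g'^2 over [0, 1], obtained from a polynomial primitive. *)
Definition test_energy z : R :=
  let H := poly_primitive ((test_poly z)^`() ^+ 2) in H.[1] - H.[0].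

Lemma test_poly_ends z : [/\ (test_poly z).[0] = 0, (test_poly z).[1] = 0,
  (test_poly z)^`().[0] = 0 & (test_poly z)^`().[1] = 0].
Proof. by split; rewrite /test_poly ?derivM ?derivXn ?deriv_exp ?derivB ?derivX ?derivC !hornerE/= ?subrr ?expr0n/= ?(mul0r, mulr0, addr0). Qed.

Lemma test_poly_sum z : test_poly z = \sum_i z 0 i *: test_poly (delta_mx 0 i).
Proof.
rewrite {1}[z]row_sum_delta /test_poly linear_sum mulr_sumr; apply: eq_bigr => i _.
by rewrite linearZ/= scalerAr.
Qed.

(** Bounds g, g' and g'' on [0, 1] per unit of |z|. The second derivative enters as the control
    belonging to the component g'. *)
Definition test_const : R := \sum_i (poly_norm (test_poly (delta_mx 0 i : 'rV[R]_n)) +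
  poly_norm (test_poly (delta_mx 0 i : 'rV[R]_n))^`() +
  poly_norm (test_poly (delta_mx 0 i : 'rV[R]_n))^`()^`()).

Lemma test_poly_le z x : 0 <= x <= 1 ->
  [/\ `|(test_poly z).[x]| <= test_const * `|z|, `|(test_poly z)^`().[x]| <= test_const * `|z| &
    `|(test_poly z)^`()^`().[x]| <= test_const * `|z|].
Proof.
move=> x01; pose e i := test_poly (delta_mx 0 i : 'rV[R]_n).
have N0 p : 0 <= poly_norm p by exact: sumr_ge0.
have H (D : {poly R} -> {poly R}) : (forall p, `|(D p).[x]| <= poly_norm (D p)) ->
    (D (test_poly z) = \sum_i z 0 i *: D (e i)) ->
    (forall i, poly_norm (D (e i)) <= poly_norm (e i) + poly_norm (e i)^`() + poly_norm (e i)^`()^`()) ->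
    `|(D (test_poly z)).[x]| <= test_const * `|z|.
  move=> h1 -> h2; rewrite horner_sum; apply: le_trans (ler_norm_sum _ _ _) _.
  rewrite /test_const mulr_suml; apply: ler_sum => i _; rewrite hornerZ normrM mulrC.
  apply: ler_pM => //; last exact: mx_entry_le.
  exact: le_trans (h1 _) (h2 i).
split.
- apply: (H id) => [p|/=|i]; [exact: horner_le|exact: test_poly_sum|].
  by rewrite -addrA lerDl addr_ge0.
- apply: (H (fun p => p^`())) => [p||i]; [exact: horner_le| |].
    by rewrite test_poly_sum linear_sum; apply: eq_bigr => i _; rewrite linearZ.
  by rewrite addrAC lerDr addr_ge0.
- apply: (H (fun p => p^`()^`())) => [p||i]; [exact: horner_le| |].
    by rewrite test_poly_sum !linear_sum; apply: eq_bigr => i _; rewrite !linearZ.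
  by rewrite lerDr addr_ge0.
Qed.

(** Zero energy forces a nondecreasing primitive to be constant, hence g' = 0, then g = 0 by the end
    conditions; cancelling the fixed factor gives z = 0. *)
Lemma test_energy_gt0 z : z != 0 -> 0 < test_energy z.
Proof.
move=> z0; rewrite /test_energy; set q := (test_poly z)^`(); set H := poly_primitive _.
have H0 x : 0 <= x <= 1 -> 0 <= H^`().[x].
  by move=> _; rewrite deriv_primitive horner_exp sqr_ge0.
rewrite subr_gt0 lt_neqAle horner_nondecreasing// andbT; apply/negP => /eqP H01.
have Hc : H - (H.[0])%:P = 0.
  apply: poly_eq0_itv => x /andP[x0 x1]; rewrite !hornerE; apply/eqP; rewrite subr_eq0 eq_le.
  by rewrite {1}H01 !horner_nondecreasing.
have q0 : q = 0.
  have : H^`() = 0 by rewrite -(subrK (H.[0])%:P H) Hc add0r derivC.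
  by rewrite deriv_primitive => /eqP; rewrite expf_eq0 => /andP[_ /eqP].
have g0 : test_poly z = 0.
  have [g00 _ _ _] := test_poly_ends z.
  apply: poly_eq0_itv => x x01.
  have d0 t : 0 <= t <= 1 -> 0 <= (test_poly z)^`().[t] by rewrite -/q q0 horner0.
  have d1 t : 0 <= t <= 1 -> 0 <= (- test_poly z)^`().[t] by rewrite derivN -/q q0 oppr0 horner0.
  have [x0 x1] := andP x01; apply/eqP; rewrite eq_le -{2}g00 (horner_nondecreasing d0 (lexx 0) x0 x1) andbT.
  have := horner_nondecreasing d1 (lexx 0) x0 x1.
  by rewrite !hornerN g00 oppr0 oppr_ge0.
have nX : (1 - 'X : {poly R}) != 0.
  apply/negP => /eqP/(congr1 (fun p : {poly R} => p.[0])); rewrite !hornerE => /eqP.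
  by rewrite subr0 oner_eq0.
have nz : 'X^2 * (1 - 'X) ^+ 2 != 0 :> {poly R} by rewrite mulf_neq0 ?expf_neq0 ?polyX_eq0.
move/eqP: g0; rewrite /test_poly mulf_eq0 (negbTE nz)/=.
move=> /eqP/(congr1 (@poly_rV R n)); rewrite rVpolyK linear0 => zz.
by rewrite zz eqxx in z0.
Qed.

Lemma poly_primitiveZ (k : R) p : poly_primitive (k *: p) = k *: poly_primitive p.
Proof.
apply/polyP => i; rewrite coefZ !poly_primitive_coef coefZ mulrA.
by [].
Qed.

(** The explicit quadratic form supplies continuity and homogeneity of degree two. *)
Lemma test_energy_quadratic : exists G : 'I_n -> 'I_n -> R, forall z,
  test_energy z = \sum_i \sum_j z 0 i * (z 0 j * G i j).
Proof.
pose e i := (test_poly (delta_mx 0 i : 'rV[R]_n))^`().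
pose L (p : {poly R}) := (poly_primitive p).[1] - (poly_primitive p).[0].
have LD p q : L (p + q) = L p + L q by rewrite /L poly_primitiveD !hornerD; ring.
have LZ k p : L (k *: p) = k * L p by rewrite /L poly_primitiveZ !hornerZ; ring.
have Lsum (F : 'I_n -> {poly R}) : L (\sum_i F i) = \sum_i L (F i).
  apply: (big_morph L LD); have := LZ 0 0; rewrite scale0r mul0r; exact.
exists (fun i j => L (e i * e j)) => z.
have E : (test_poly z)^`() = \sum_i z 0 i *: e i.
  by rewrite test_poly_sum linear_sum; apply: eq_bigr => i _; rewrite linearZ.
rewrite /test_energy -/(L _) E expr2 mulr_suml Lsum; apply: eq_bigr => i _.
rewrite mulr_sumr Lsum; apply: eq_bigr => j _.
by rewrite -scalerAl -scalerAr !LZ.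
Qed.

End TestPolynomials.

(** The constant is the minimum of the energy on the compact unit sphere, positive there;
    homogeneity does the rest. Dimension n + 1 makes the sphere nonempty. *)
Lemma test_energy_ge (R : realType) n : exists2 c0 : R, 0 < c0 &
  forall z : 'rV[R]_n.+1, c0 * `|z| ^+ 2 <= test_energy z.
Proof.
have [G GE] := @test_energy_quadratic R n.+1.
have Z (k : R) (z : 'rV[R]_n.+1) : test_energy (k *: z) = k ^+ 2 * test_energy z.
  rewrite !GE mulr_sumr; apply: eq_bigr => i _; rewrite mulr_sumr; apply: eq_bigr => j _.
  by rewrite !mxE; ring.
pose A : set 'rV[R]_n.+1 := [set z | `|z| = 1].
pose nrm (z : 'rV[R]_n.+1) := `|z|^-1 *: z.
have An z : z != 0 -> A (nrm z).
  move=> z0; rewrite /A/= /nrm normrZ ger0_norm ?invr_ge0// mulVf// normr_eq0//.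
have d0 : (delta_mx 0 0 : 'rV[R]_n.+1) != 0.
  by apply/negP => /eqP/rowP/(_ 0); rewrite !mxE => /eqP; rewrite oner_eq0.
have cA : compact A.
  apply: bounded_closed_compact.
    by exists 1; split=> // M M1 z /= ->; exact: ltW.
  rewrite (_ : A = (fun z : 'rV[R]_n.+1 => `|z|) @^-1` [set 1]); last first.
    by apply/seteqP; split.
  apply: closed_comp; last exact: closed_eq.
  by move=> z _; exact: norm_continuous.
have cont : {within A, continuous (@test_energy R n.+1)}.
  apply: continuous_subspaceT.
  rewrite (_ : @test_energy R n.+1 = (fun z => \sum_i \sum_j z 0 i * (z 0 j * G i j))); last first.
    by apply/funext => z.
  apply: continuous_big => [|i _]; first exact: add_continuous.
  apply: continuous_big => [|j _]; first exact: add_continuous.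
  have cc k : continuous (fun z : 'rV[R]_n.+1 => z 0 k) by exact: coord_continuous.
  by move=> z; apply: (cvgM (cc i z)); apply: (cvgM (cc j z)); exact: cvg_cst.
have [z1] := EVT_min_rV (ex_intro _ _ (An _ d0)) cA cont.
rewrite inE => Az1 z1P.
have z10 : z1 != 0 by apply/negP => /eqP z10; move: Az1; rewrite /A/= z10 normr0 => /esym/eqP; rewrite oner_eq0.
exists (test_energy z1); first exact: test_energy_gt0.
move=> z; have [->|z0] := eqVneq z 0.
  by rewrite normr0 expr0n/= mulr0 GE big1// => i _; rewrite big1// => j _; rewrite !mxE mul0r.
have E : z = `|z| *: nrm z by rewrite /nrm scalerA mulfV ?scale1r// normr_eq0.
have := z1P (nrm z); rewrite inE => /(_ (An z z0)) h.
by rewrite {2}E Z mulrC ler_wpM2l// exprn_ge0.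
Qed.

(** * Bump controls and the necessary conditions *)

Lemma exists_bump (R : realType) (T : R) l (a b V : R) (w : 'I_l -> R -> R) : 0 <= V ->
  (forall i, measurable_fun setT (w i)) -> (forall i t, a <= t <= b -> `|w i t| <= V) ->
  exists vc : control T l, [/\ forall i t, a <= t <= b -> vc i t = w i t,
    forall i t, ~~ (a <= t <= b) -> vc i t = 0 & forall i t, `|vc i t| <= V].
Proof.
move=> V0 mw wV; pose v i (t : R) := w i t * \1_(`[a, b]%classic) t.
have vin i t : a <= t <= b -> v i t = w i t.
  by move=> tab; rewrite /v indicE mem_set ?mulr1//= in_itv.
have vout i t : ~~ (a <= t <= b) -> v i t = 0.
  by move=> tab; rewrite /v indicE memNset ?mulr0//= in_itv/=; exact/negP.
have vV i t : `|v i t| <= V.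
  by have [tab|tab] := boolP (a <= t <= b); [rewrite vin// wV | rewrite vout// normr0].
have mv i : measurable_fun setT (v i).
  by apply: measurable_funM => //; apply: measurable_indic; exact: measurable_itv.
have [vc vcE] := @exists_control R T l v mv (fun i => ex_intro _ V (vV i)).
by exists vc; split=> i t *; rewrite vcE; [exact: vin | exact: vout | exact: vV].
Qed.

(** This is the limit over shrinking windows. The estimate is given at the left end a of a window,
    which cannot be t itself when t is the last time, so the Lipschitz bound on h carries it from a
    to t. *)
Lemma vanish_of_small (R : realType) (om : R -> R) a0 b0 t (h : R -> R) E : weight om ->
  a0 < b0 -> a0 <= t <= b0 -> 0 <= E -> Wlip om a0 b0 h ->
  (forall a b, a0 <= a -> a < b -> b <= b0 ->
    `|h a| <= E * (primitive om b - primitive om a)) -> h t = 0.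
Proof.
move=> omw ab0 /andP[a0t tb0] E0 [E' E'0 hW] hE; apply/eqP; rewrite -normr_le0.
apply/ler_addgt0Pr => e e0; rewrite add0r.
have E1 : 0 < E + E' + 1 by rewrite ltr_wpDl// addr_ge0.
have [r r0 rP] := W_cont omw t (divr_gt0 e0 E1).
(* A window around t clipped to [a0, b0]; it stays nondegenerate when t is an end point. *)
pose a := Num.max a0 (t - r / 2); pose b := Num.min b0 (t + r / 2).
have r2 : 0 < r / 2 by rewrite divr_gt0.
have r2r : r / 2 < r by rewrite ltr_pdivrMr// ltr_pMr// ltr1n.
have a0a : a0 <= a by rewrite /a le_max lexx.
have bb0 : b <= b0 by rewrite /b ge_min lexx.
have at_ : a <= t by rewrite /a ge_max a0t/= gerBl ltW.
have tb : t <= b by rewrite /b le_min tb0/= lerDl ltW.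
have ab : a < b.
  rewrite /a /b gt_max !lt_min ab0/=.
  rewrite (le_lt_trans a0t) ?ltrDl//= (lt_le_trans _ tb0) ?gtrBl//=.
  by rewrite (@lt_trans _ _ t)// ?gtrBl ?ltrDl.
have ra : t - r < a by rewrite /a lt_max ltrD2l ltrN2 r2r orbT.
have rb : b < t + r by rewrite /b gt_min ltrD2l r2r orbT.
have := rP a b ra (ltW ab) rb; rewrite ltr_pdivlMr// => h1.
have h2 := hE a b a0a ab bb0.
have h3 : `|h t - h a| <= E' * (primitive om b - primitive om a).
  apply: le_trans (hW a t a0a at_ tb0) _; apply: ler_wpM2l => //.
  by rewrite lerD2r W_mono.
have d0 : 0 <= primitive om b - primitive om a by rewrite W_sub_ge0// ltW.
rewrite -(subrK (h a) (h t)); apply: le_trans (ler_normD _ _) _.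
apply: le_trans (lerD h3 h2) _; apply: le_trans _ (ltW h1).
by rewrite -mulrDl mulrC ler_wpM2l// [E' + _]addrC lerDl.
Qed.

Lemma variational_sol_ext (R : realType) (om : R -> R) n l (f : 'I_l -> 'rV[R]_n -> 'rV[R]_n)
  (a b : R) (u v v' : 'I_l -> R -> R) x y : (forall i t, a < t < b -> v i t = v' i t) ->
  variational_sol om f a b u v x y -> variational_sol om f a b u v' x y.
Proof.
move=> vv' [yW yd]; split=> //; apply: aeS yd => t h tab.
by rewrite -(eq_bigr _ (fun i _ => congr1 (fun z => z *: f i (x t)) (vv' i t tab))); exact: h.
Qed.

(** * Response of the end point to a control supported in [a, b] *)

Section BumpControl.
Context {R : realType} {n l : nat} {M : smooth_manifold R n}.
Variable (om : R -> R).
Hypothesis om_weight : weight om.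
Local Notation W := (primitive om).
Variable (X : 'I_l -> M -> 'rV[R]_n).
Hypothesis X_smooth : forall i, smooth_vfield (X i).
Variables (T : R) (q0 : M) (u : control T l) (q : R -> M) (Phi : 'I_n -> R -> 'cV[R]_n).
Hypothesis T_gt0 : 0 < T.
Hypothesis om1 : forall t, 0 <= t <= T -> 1 <= om t.
Hypothesis ule : forall i t, 0 <= t <= T -> `|u i t| <= om t.
Hypothesis q_traj : trajectory X q0 u q.
Hypothesis Phi_frame : covector_frame X u q Phi.
Variables (al : 'I_n -> R).
Implicit Types (c : chart R n M).
Local Notation phi := (fun t => \sum_k al k *: Phi k t).

Let om0 t : 0 <= om t. Proof. by case: om_weight. Qed.

Lemma control_measurable i : measurable_fun setT (u i).
Proof. exact: measurable_funPT. Qed.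

Lemma trajectory_solution : msol om X (fun i => u i) 0 T q.
Proof.
apply: (trajectory_msol om_weight X_smooth _ q_traj) => i t tT.
by apply: le_trans (ule i tT) _; rewrite ler_peMl// ler1n.
Qed.

Variables (c : chart R n M) (t0 rho K P C a b : R).
Hypotheses (ac : atlas c) (cq0 : dom c (q t0)) (wb : window_bounds X q c t0 rho K P C)
  (win : window om X u q Phi c t0 rho K P C a b).
Hypotheses (a0 : 0 <= a) (ab : a < b) (bT : b <= T).
Local Notation f := (fun i => vfield_in c (X i)).
Local Notation x := (c \o q).
Local Notation pc := (fun k s => cotangent_in c (q s) (Phi k s)).
Local Notation dW := (W b - W a).

Let K0 : 0 <= K. Proof. by case: wb. Qed.
Let ab' : a <= b. Proof. exact: ltW. Qed.
Let dW0 : 0 <= dW. Proof. exact: W_sub_ge0. Qed.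
Let ulab i t : a <= t <= b -> `|u i t| <= om t.
Proof. by move=> /andP[h1 h2]; rewrite ule// (le_trans a0 h1) (le_trans h2 bT). Qed.
Let om1ab t : a <= t <= b -> 1 <= om t.
Proof. by move=> /andP[h1 h2]; rewrite om1// (le_trans a0 h1) (le_trans h2 bT). Qed.

Section Response.
Variables (vc : control T l) (V : R) (y : R -> 'rV[R]_n).
Hypothesis V0 : 0 <= V.
Hypothesis vout : forall i t, ~~ (a <= t <= b) -> vc i t = 0.
Hypothesis vV : forall i t, `|vc i t| <= V.
Hypothesis ysol : variational_sol om f a b (fun i => u i) (fun i t => vc i t) x y.
Hypothesis ya : y a = 0.

Let vle i t : 0 <= t <= T -> `|vc i t| <= V * om t.
Proof. by move=> tT; apply: le_trans (vV i t) _; rewrite ler_peMr// om1. Qed.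

Let vlab i t : a <= t <= b -> `|vc i t| <= V * om t.
Proof. by move=> tT; apply: le_trans (vV i t) _; rewrite ler_peMr// om1ab. Qed.

Let vbefore i t : 0 < t < a -> vc i t = 0.
Proof. by move=> /andP[_ ta]; apply: vout; rewrite (leNgt a) ta. Qed.

Let vafter i t : b < t < T -> vc i t = 0.
Proof. by move=> /andP[bt _]; apply: vout; rewrite (leNgt t) bt andbF. Qed.

Let mv i : measurable_fun setT (fun t => vc i t). Proof. exact: measurable_funPT. Qed.

Lemma bump_order0 k : pairing (Phi k T) (DEnd X q0 u vc) = pairing (pc k b) (y b).
Proof.
have b0 : 0 <= b by exact: le_trans a0 ab'.
have fb := entry_order0 om_weight ule control_measurable trajectory_solution ac wb win
  a0 ab bT mv V0 vlab vbefore ysol ya.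
have fT := family_transport om_weight X_smooth ule control_measurable trajectory_solution
  Phi_frame.1 b0 bT (lexx T) vafter fb.
exact: (DEnd_order0 om_weight X_smooth T_gt0 ule q_traj V0 vle fT).
Qed.

Lemma bump_order1 (be : 'I_n -> R -> R) c' : y b = 0 ->
  (forall k, [/\ be k a = 0, Wlip om a b (be k) & {ae lebesgue_measure, forall t, a < t < b ->
     is_derive t (1 : R) (be k)
       (second_variation f (fun i => u i) x (fun i t => vc i t) (pc k) y t)}]) ->
  atlas c' -> dom c' (q T) ->
  DEnd X q0 u vc = 0 /\
  forall k, pairing (cotangent_in c' (q T) (Phi k T)) (D2End X q0 c' u vc) = be k b.
Proof.
move=> yb beP ac' c'q; have b0 : 0 <= b by exact: le_trans a0 ab'.
have fb := entry_order1 om_weight ule control_measurable trajectory_solution ac wb win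
  a0 ab bT mv V0 vlab vbefore ysol ya yb beP.
have fT := family_transport om_weight X_smooth ule control_measurable trajectory_solution
  Phi_frame.1 b0 bT (lexx T) vafter fb.
apply: (D2End_order1 om_weight X_smooth T_gt0 ule q_traj V0 vle ac' c'q _ fT).
exact: (frame_unit_chart om_weight X_smooth T_gt0 ule control_measurable trajectory_solution Phi_frame).
Qed.

End Response.

(** The control equal to 1 / (b - a) in direction i has a first variation whose pairing with phi is
    close to the wanted one by [constant_control_estimate], and zero by hypothesis. *)
Lemma field_estimate i : (forall w, im_DEnd X q0 u w -> pairing (phi T) w = 0) ->
  `|\sum_k al k * pairing (pc k a) (f i (x a))| <=
    (\sum_k `|al k|) * (n%:R * (C * K + P * (K * C))) * dW.
Proof.
move=> im0.
have [rho0 _ P0 C0 cod fc fc2] := wb.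
have [s1 s2 qdom qdist xsol xC frame] := win.
have d0 : 0 < b - a by rewrite subr_gt0.
pose V := (b - a)^-1; have V0 : 0 <= V by rewrite invr_ge0 ltW.
pose w := single_control i (fun _ : R => V).
have wE j t : w j t = if j == i then V else 0 by [].
have mw j : measurable_fun setT (w j).
  rewrite (_ : w j = cst (if j == i then V else 0)); first exact: measurable_cst.
  by apply/funext => t; rewrite wE.
have wV j t : a <= t <= b -> `|w j t| <= V.
  by move=> _; rewrite wE; case: ifP; rewrite ?normr0// ger0_norm.
have [vc [vin vout vV]] := exists_bump T V0 mw wV.
have vlab j t : a <= t <= b -> `|vc j t| <= V * om t.
  by move=> tT; apply: le_trans (vV j t) _; rewrite ler_peMr// om1ab.
have u2 j t : a <= t <= b -> `|u j t| <= 2 * om t.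
  by move=> h; apply: le_trans (ulab j h) _; rewrite ler_peMl// ler1n.
have mv j : measurable_fun setT (fun t => vc j t) by exact: measurable_funPT.
have [y [ya ysol]] := variational_existence om_weight K0 fc ab' s1 (0 : 'rV[R]_n) V0
  control_measurable mv u2 vlab xsol.
have ysol' : variational_sol om f a b (fun i => u i) w x y.
  apply: variational_sol_ext ysol => j t /andP[h1 h2]; apply: vin; by rewrite !ltW.
(* The pairings at b are those of D End (vc) at T, which phi(T) annihilates. *)
have E0 : \sum_k al k * pairing (pc k b) (y b) = 0.
  under eq_bigr => k _ do rewrite -(bump_order0 V0 vout vV ysol ya k) -pairingZl.
  by rewrite -pairing_suml; apply: im0; exists vc.
rewrite -normrN.
have -> : - (\sum_k al k * pairing (pc k a) (f i (x a))) =
    \sum_k al k * (pairing (pc k b) (y b) - pairing (pc k a) (f i (x a))).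
  by under [RHS]eq_bigr do rewrite mulrBr; rewrite sumrB E0 sub0r.
rewrite -mulrA mulr_suml; apply: le_trans (ler_norm_sum _ _ _) _; apply: ler_sum => k _.
have [pP pC pcov] := frame k.
rewrite normrM ler_wpM2l//.
exact: (constant_control_estimate om_weight K0 fc ab om1ab xsol pcov pP pC xC C0 C0 ysol' ya).
Qed.

End BumpControl.

(** A line suffices. The value of Q at 0 shows that w is nonzero, hence independent. *)
Lemma negative_index_gt0 (R : realType) (V : lmodType R) (A : set V) (Q : V -> R) w :
  A w -> Q 0 = 0 -> (forall k, k != 0 -> Q (k *: w) < 0) -> negative_index A Q <> 0%E.
Proof.
move=> Aw Q0 Qw.
suff h : (1%:E <= negative_index A Q)%E by move=> E; move: h; rewrite E lee_fin ler10.
apply: ereal_sup_ubound; exists 1%N => //; exists (fun _ => w); split=> // k.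
  rewrite big_ord1 => kw i; rewrite ord1; apply/eqP; apply: contraT => /Qw.
  by rewrite kw Q0 ltxx.
rewrite big_ord1 => kw; apply: Qw; apply: contra_neq kw => ->; exact: scale0r.
Qed.

Lemma D2End_0 (R : realType) n l (M : smooth_manifold R n) (T : R) (X : 'I_l -> M -> 'rV[R]_n) q0
  (c : chart R n M) (u : control T l) : D2End X q0 c u 0 = 0.
Proof.
rewrite /D2End /= (_ : (fun s : R => c (End X q0 T (u + s *: 0))) = cst (c (End X q0 T u))); last first.
  by apply/funext => s; rewrite scaler0 addr0.
rewrite (_ : derive1 (cst _) = cst 0); first exact: derive1_cst.
by apply/funext => s; exact: derive1_cst.
Qed.

(** * The bracket pairing on a short interval *)

Section Goh.
Context {R : realType} {n l : nat} {M : smooth_manifold R n}.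
Variable (om : R -> R).
Hypothesis om_weight : weight om.
Local Notation W := (primitive om).
Variable (X : 'I_l -> M -> 'rV[R]_n).
Hypothesis X_smooth : forall i, smooth_vfield (X i).
Variables (T : R) (q0 : M) (u : control T l) (q : R -> M) (Phi : 'I_n -> R -> 'cV[R]_n).
Hypothesis T_gt0 : 0 < T.
Hypothesis om1 : forall t, 0 <= t <= T -> 1 <= om t.
Hypothesis ule : forall i t, 0 <= t <= T -> `|u i t| <= om t.
Hypothesis q_traj : trajectory X q0 u q.
Hypothesis Phi_frame : covector_frame X u q Phi.
Variables (al : 'I_n -> R).
Implicit Types (c : chart R n M).
Local Notation phi := (fun t => \sum_k al k *: Phi k t).

Let om0 t : 0 <= om t. Proof. by case: om_weight. Qed.

Variables (c : chart R n M) (t0 rho K P C a b : R).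
Hypotheses (ac : atlas c) (cq0 : dom c (q t0)) (wb : window_bounds X q c t0 rho K P C)
  (win : window om X u q Phi c t0 rho K P C a b).
Hypotheses (a0 : 0 <= a) (ab : a < b) (bT : b <= T).
Local Notation f := (fun i => vfield_in c (X i)).
Local Notation x := (c \o q).
Local Notation pc := (fun k s => cotangent_in c (q s) (Phi k s)).
Local Notation dW := (W b - W a).

Let K0 : 0 <= K. Proof. by case: wb. Qed.
Let ab' : a <= b. Proof. exact: ltW. Qed.
Let dW0 : 0 <= dW. Proof. exact: W_sub_ge0. Qed.
Let ulab i t : a <= t <= b -> `|u i t| <= om t.
Proof. by move=> /andP[h1 h2]; rewrite ule// (le_trans a0 h1) (le_trans h2 bT). Qed.
Let om1ab t : a <= t <= b -> 1 <= om t.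
Proof. by move=> /andP[h1 h2]; rewrite om1// (le_trans a0 h1) (le_trans h2 bT). Qed.
Let d0 : 0 < b - a. Proof. by rewrite subr_gt0. Qed.

(** With the sign convention of [lie_bracket] this is, up to the choice of chart, the pairing of phi
    with [X_j, X_i]. The chart c is fixed along the window, so that the value is a Lipschitz
    function of t for the clock W. *)
Definition bracket_pairing (i j : 'I_l) (t : R) : R := \sum_k al k *
  (pairing (pc k t) ('D_(f j (x t)) (f i) (x t)) - pairing (pc k t) ('D_(f i (x t)) (f j) (x t))).

Variables (i1 i2 : 'I_l).
Hypothesis i12 : i1 != i2.

Let rescale (t : R) : R := (b - a)^-1 * (t - a).

Let rescale_itv t : a <= t <= b -> 0 <= rescale t <= 1.
Proof.
move=> /andP[at_ tb]; rewrite /rescale mulr_ge0 ?invr_ge0 ?subr_ge0 ?(ltW d0)//=.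
by rewrite mulrC ler_pdivrMr// mul1r lerD2r.
Qed.

Let is_derive_rescale (p : {poly R}) (t : R) :
  is_derive t (1 : R) (fun t => p.[rescale t]) ((b - a)^-1 * p^`().[rescale t]).
Proof.
have h : is_derive t (1 : R) rescale (b - a)^-1.
  have := is_deriveBF (is_derive_linear (b - a)^-1 t) (is_derive_cst ((b - a)^-1 * a) t (1 : R)).
  rewrite subr0 (_ : (fun y => _) = rescale)//; apply/funext => s.
  by rewrite /rescale mulrBr.
have := @is_derive1_comp R (fun y => p.[y]) rescale t _ _ (is_derive_poly p (rescale t)) h.
by rewrite /GRing.scale/= mulrC.
Qed.

Local Notation N := n.+1.
Implicit Types (z : 'rV[R]_N).

(* The controls are the derivatives of the rescaled pair formed by a test function and its
   derivative. *)
Let w1 z t := (test_poly z).[rescale t].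
Let w2 z t := (test_poly z)^`().[rescale t].
Let v1 z t := (b - a)^-1 * (test_poly z)^`().[rescale t].
Let v2 z t := (b - a)^-1 * (test_poly z)^`()^`().[rescale t].
Let goh_control z : 'I_l -> R -> R := two_controls i1 i2 (v1 z) (v2 z).

Let vmeas p : measurable_fun setT (fun t => (b - a)^-1 * p.[rescale t]).
Proof.
apply: continuous_measurable_fun => t.
have [h _] := is_deriveZF (b - a)^-1 (is_derive_rescale p t).
exact: (differentiable_continuous ((derivable1_diffP _ _).1 h)).
Qed.

Let cmeas z i : measurable_fun setT (goh_control z i).
Proof.
rewrite /goh_control /two_controls; case: (i == i1); first exact: vmeas.
by case: (i == i2); [exact: vmeas | exact: measurable_cst].
Qed.

Let Bz z := @test_const R N * `|z|.
Let Bz0 z : 0 <= Bz z.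
Proof.
by rewrite mulr_ge0// sumr_ge0// => i _; rewrite !addr_ge0// sumr_ge0.
Qed.

Let cle z i t : a <= t <= b -> `|goh_control z i t| <= (b - a)^-1 * Bz z.
Proof.
move=> /rescale_itv/(test_poly_le z)[_ h1 h2].
have i0 : 0 <= (b - a)^-1 by rewrite invr_ge0 ltW.
rewrite /goh_control /two_controls; case: (i == i1).
  by rewrite normrM ger0_norm// ler_wpM2l.
case: (i == i2); first by rewrite normrM ger0_norm// ler_wpM2l.
by rewrite normr0 mulr_ge0.
Qed.

(** The constant of [goh_estimate] with both Lipschitz constants equal to C and B = test_const |z|,
    summed over the frame with the weights |al k|. *)
Definition goh_const : R := (\sum_k `|al k|) *
  (l%:R * n%:R * P * (n%:R * (16 * K ^+ 3)) + 4 * (n%:R * (C * (4 * K ^+ 2) +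
    P * (4 * K ^+ 2 * C) + P * (K * (l%:R * (4 * K ^+ 2) + 2 * K * C))))) * (@test_const R N) ^+ 2.

Let P0 : 0 <= P. Proof. by case: wb. Qed.
Let C0 : 0 <= C. Proof. by case: wb. Qed.

Lemma goh_const_ge0 : 0 <= goh_const.
Proof.
rewrite /goh_const; apply: mulr_ge0; last exact: sqr_ge0.
by apply: mulr_ge0; [exact: sumr_ge0 | nneg].
Qed.

(** The condition y b = 0 is what makes the control critical and gives the second derivative of
    [End] an intrinsic pairing, computed at time b for each covector of the frame. *)
Lemma goh_value z (vc : control T l) y c' :
  (forall i t, a <= t <= b -> vc i t = goh_control z i t) ->
  (forall i t, ~~ (a <= t <= b) -> vc i t = 0) ->
  variational_sol om f a b (fun i => u i) (goh_control z) x y -> y a = 0 -> y b = 0 ->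
  atlas c' -> dom c' (q T) ->
  DEnd X q0 u vc = 0 /\
  `|pairing (cotangent_in c' (q T) (phi T)) (D2End X q0 c' u vc) -
    2 * bracket_pairing i1 i2 a * test_energy z| <= goh_const * `|z| ^+ 2 * dW.
Proof.
move=> vin vout ysol ya yb ac' c'q.
have [rho0 _ _ _ cod fc fc2] := wb.
have [s1 s2 qdom qdist xsol xC frame] := win.
pose V := (b - a)^-1 * Bz z; have V0 : 0 <= V by rewrite mulr_ge0 ?invr_ge0 ?(ltW d0).
have vV i t : `|vc i t| <= V.
  have [tab|tab] := boolP (a <= t <= b); first by rewrite vin//; exact: cle.
  by rewrite vout// normr0.
have vin' i t : a < t < b -> goh_control z i t = vc i t.
  by move=> /andP[h1 h2]; rewrite vin// !ltW.
have ysol' : variational_sol om f a b (fun i => u i) (fun i t => vc i t) x y.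
  exact: variational_sol_ext ysol.
have clab i t : a <= t <= b -> `|goh_control z i t| <= V * om t.
  by move=> tab; apply: le_trans (cle z i tab) _; rewrite ler_peMr// om1ab.
have pW k : Wlip om a b (pc k) by have [_ pC _] := frame k; exists C.
have [be beP] := second_variation_primitive om_weight K0 fc fc2 ab' ulab xsol V0
  (control_measurable u) (cmeas z) clab pW ysol.1.
have beP' k : [/\ be k a = 0, Wlip om a b (be k) & {ae lebesgue_measure, forall t, a < t < b ->
     is_derive t (1 : R) (be k)
       (second_variation f (fun i => u i) x (fun i t => vc i t) (pc k) y t)}].
  have [h1 h2 h3] := beP k; split=> //; apply: aeS h3 => t h tab.
  rewrite /second_variation -(eq_bigr _ (fun i _ => congr1 (fun w => w * (2 * pairing (pc k t)
    ('D_(y t) (f i) (x t)))) (vin' i t tab))); exact: h.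
have [D0 D2] := bump_order1 om_weight X_smooth T_gt0 om1 ule q_traj Phi_frame ac wb win
  a0 ab bT V0 vout vV ysol' ya yb beP' ac' c'q.
split=> //.
have E : pairing (cotangent_in c' (q T) (phi T)) (D2End X q0 c' u vc) = \sum_k al k * be k b.
  rewrite /cotangent_in mulmx_sumr pairing_suml; apply: eq_bigr => k _.
  by rewrite -scalemxAr pairingZl -D2.
(* After rescaling, the area integral of w1' w2 is the energy of the test function, whatever the
   length of [a, b]. *)
pose H := poly_primitive ((test_poly z)^`() ^+ 2).
have Hd t : is_derive t (1 : R) (fun t => H.[rescale t]) (v1 z t * w2 z t).
  have := is_derive_rescale H t; rewrite deriv_primitive horner_exp /v1 /w2 expr2 mulrA; exact.
have ra : rescale a = 0 by rewrite /rescale subrr mulr0.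
have rb : rescale b = 1 by rewrite /rescale mulVf// gt_eqF.
have [e1 e2 e3 e4] := test_poly_ends z.
have hk k : `|be k b - 2 * (pairing (pc k a) ('D_(f i2 (x a)) (f i1) (x a)) -
    pairing (pc k a) ('D_(f i1 (x a)) (f i2) (x a))) * test_energy z| <=
   (l%:R * n%:R * P * (n%:R * (16 * K ^+ 3)) + 4 * (n%:R * (C * (4 * K ^+ 2) +
    P * (4 * K ^+ 2 * C) + P * (K * (l%:R * (4 * K ^+ 2) + 2 * K * C))))) * Bz z ^+ 2 * dW.
  have [pP pC pcov] := frame k; have [bea beW bed] := beP k.
  have hB t (tab : a <= t <= b) := test_poly_le z (rescale_itv tab).
  have w1d t : a <= t <= b -> is_derive t (1 : R) (w1 z) (v1 z t).
    by move=> _; exact: is_derive_rescale.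
  have w2d t : a <= t <= b -> is_derive t (1 : R) (w2 z) (v2 z t).
    by move=> _; exact: is_derive_rescale.
  have w1a : w1 z a = 0 by rewrite /w1 ra.
  have w1b : w1 z b = 0 by rewrite /w1 rb.
  have w2a : w2 z a = 0 by rewrite /w2 ra.
  have w2b : w2 z b = 0 by rewrite /w2 rb.
  have w2B t : a <= t <= b -> `|w2 z t| <= Bz z by move=> /hB[].
  have i0 : 0 <= (b - a)^-1 by rewrite invr_ge0 ltW.
  have v1B t : a <= t <= b -> `|v1 z t| <= (b - a)^-1 * Bz z.
    by move=> /hB[_ h _]; rewrite /v1 normrM ger0_norm// ler_wpM2l.
  have v2B t : a <= t <= b -> `|v2 z t| <= (b - a)^-1 * Bz z.
    by move=> /hB[_ _ h]; rewrite /v2 normrM ger0_norm// ler_wpM2l.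
  have := goh_estimate om_weight K0 fc fc2 ab s1 ulab om1ab xsol i12 pP pC xC C0 C0
    (Bz0 z) w1d w2d (fun t _ => Hd t) w1a w2a w1b w2b w2B v1B v2B ysol ya bea beW bed.
  by rewrite ra rb.
have -> : pairing (cotangent_in c' (q T) (phi T)) (D2End X q0 c' u vc) -
    2 * bracket_pairing i1 i2 a * test_energy z =
  \sum_k al k * (be k b - 2 * (pairing (pc k a) ('D_(f i2 (x a)) (f i1) (x a)) -
    pairing (pc k a) ('D_(f i1 (x a)) (f i2) (x a))) * test_energy z).
  rewrite E /bracket_pairing mulr_sumr mulr_suml -sumrB; apply: eq_bigr => k _.
  by move: (pairing _ _ - _) (test_energy z) (be k b) (al k) => r1 r2 r3 r4; ring.
rewrite /goh_const -!mulrA mulr_suml; apply: le_trans (ler_norm_sum _ _ _) _.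
apply: ler_sum => k _; rewrite normrM ler_wpM2l//; apply: le_trans (hk k) _.
apply: le_of_eq; rewrite /Bz exprMn !mulrA; congr (_ * _).
Qed.

Let control_sum z i t : goh_control z i t = \sum_j z 0 j * goh_control (delta_mx 0 j) i t.
Proof.
have E (D : {poly R} -> {poly R}) : D (test_poly z) = \sum_j z 0 j *: D (test_poly (delta_mx 0 j)) ->
    (b - a)^-1 * (D (test_poly z)).[rescale t] =
    \sum_j z 0 j * ((b - a)^-1 * (D (test_poly (delta_mx 0 j))).[rescale t]).
  move=> ->; rewrite horner_sum mulr_sumr; apply: eq_bigr => j _.
  by rewrite hornerZ mulrCA.
rewrite /goh_control /two_controls; case: (i == i1).
  apply: (E (fun p => p^`())).
  by rewrite {1}test_poly_sum linear_sum; apply: eq_bigr => j _; rewrite linearZ.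
case: (i == i2); last by rewrite big1// => j _; rewrite mulr0.
apply: (E (fun p => p^`()^`())).
by rewrite {1}test_poly_sum !linear_sum; apply: eq_bigr => j _; rewrite !linearZ.
Qed.

Lemma variational_sol_sum (v : 'I_N -> 'I_l -> R -> R) (y : 'I_N -> R -> 'rV[R]_n) z w :
  (forall j, variational_sol om f a b (fun i => u i) (v j) x (y j)) ->
  (forall i t, w i t = \sum_j z 0 j * v j i t) ->
  variational_sol om f a b (fun i => u i) w x (fun t => \sum_j z 0 j *: y j t).
Proof.
move=> ysol wE; have [rho0 _ _ _ cod fc fc2] := wb.
have [s1 s2 qdom qdist [xW xr xd] xC frame] := win.
split; first by apply: Wlip_sum => j; apply: WlipZ; case: (ysol j).
have H : {ae lebesgue_measure, forall t, forall j, a < t < b -> is_derive t (1 : R) (y j)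
    (\sum_i u i t *: 'D_(y j t) (f i) (x t) + \sum_i v j i t *: f i (x t))}.
  by apply: ae_all => j; case: (ysol j).
apply: aeS H => t h tab.
have tab' : a <= t <= b by case/andP: tab => /ltW -> /ltW ->.
apply: is_derive_eq.
  by apply: is_derive_sumF => j; apply: is_deriveZF; exact: h.
have fd i := c11_diff (fc i) (xr t tab').
transitivity (\sum_j (z 0 j *: (\sum_i u i t *: 'D_(y j t) (f i) (x t)) +
    z 0 j *: (\sum_i v j i t *: f i (x t)))); first by apply: eq_bigr => j _; rewrite scalerDr.
rewrite big_split; congr (_ + _).
  under eq_bigr do rewrite scaler_sumr.
  rewrite exchange_big; apply: eq_bigr => i _.
  rewrite (deriveE _ (fd i)) linear_sum scaler_sumr; apply: eq_bigr => j _.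
  by rewrite -(deriveE _ (fd i)) (deriveZr _ _ (fd i)) !scalerA mulrC.
under eq_bigr do rewrite scaler_sumr.
rewrite exchange_big; apply: eq_bigr => i _; rewrite wE scaler_suml; apply: eq_bigr => j _.
by rewrite scalerA.
Qed.

(** If the bracket pairing were more negative than the error permits, the second derivative would be
    negative on the line of a critical control, and the index would be at least one. *)
Lemma bracket_pairing_ge (eta : R) c' : 0 < eta -> (forall z, eta * `|z| ^+ 2 <= test_energy z) ->
  atlas c' -> dom c' (q T) ->
  negative_index (ker_DEnd X q0 u)
    (fun v => pairing (cotangent_in c' (q T) (phi T)) (D2End X q0 c' u v)) = 0%E ->
  - bracket_pairing i1 i2 a <= goh_const / (2 * eta) * dW.
Proof.
move=> eta0 etaP ac' c'q; apply: contraPT; rewrite -ltNge => hlt.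
have [rho0 _ _ _ cod fc fc2] := wb.
have [s1 s2 qdom qdist xsol xC frame] := win.
pose V (z : 'rV[R]_N) := (b - a)^-1 * Bz z.
have V0 z : 0 <= V z by rewrite mulr_ge0 ?invr_ge0 ?(ltW d0).
have clab z i t : a <= t <= b -> `|goh_control z i t| <= V z * om t.
  by move=> tab; apply: le_trans (cle z i tab) _; rewrite -/(V z) ler_peMr// om1ab.
have u2 i t : a <= t <= b -> `|u i t| <= 2 * om t.
  by move=> tab; apply: le_trans (ulab i tab) _; rewrite ler_peMl// ler1n.
have yex j := variational_existence om_weight K0 fc ab' s1 (0 : 'rV[R]_n) (V0 (delta_mx 0 j))
  (control_measurable u) (cmeas (delta_mx 0 j)) u2 (clab (delta_mx 0 j)) xsol.
have [y yP] := choice yex.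
pose Y : 'M[R]_(N, n) := \matrix_j y j b.
(* The first variation at b is linear in z, with matrix [Y] having n + 1 rows and n columns, so some
   nonzero z makes it vanish exactly. *)
have [z zY z0] : exists2 z : 'rV[R]_N, z *m Y = 0 & z != 0.
  have : kermx Y != 0.
    rewrite -mxrank_eq0 mxrank_ker subn_eq0 -ltnNge ltnS; exact: rank_leq_col.
  by move=> /rowV0Pn[z /sub_kermxP zY z0]; exists z.
have [vc [vin vout vV]] := exists_bump T (V0 z) (cmeas z) (cle z).
(* The estimate is applied to every multiple of the control separately: negativity is needed on the
   whole line, and homogeneity of the second derivative has not been established. *)
have val (k : R) := @goh_value (k *: z) (k *: vc) (fun t => \sum_j (k *: z) 0 j *: y j t) c'.
have valP (k : R) : DEnd X q0 u (k *: vc) = 0 /\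
  `|pairing (cotangent_in c' (q T) (phi T)) (D2End X q0 c' u (k *: vc)) -
    2 * bracket_pairing i1 i2 a * test_energy (k *: z)| <= goh_const * `|k *: z| ^+ 2 * dW.
  have vE i t : (k *: vc) i t = k * vc i t by rewrite ffunE.
  apply: val => //.
  - move=> i t tab; rewrite vE vin// !control_sum mulr_sumr; apply: eq_bigr => j _.
    by rewrite mxE mulrA.
  - by move=> i t tab; rewrite vE vout// mulr0.
  - apply: (@variational_sol_sum (fun j => goh_control (delta_mx 0 j))) => [j|]; last exact: control_sum.
    by have [] := yP j.
  - by rewrite big1// => j _; have [-> _] := yP j; rewrite scaler0.
  - have := congr1 (fun w => k *: w) zY; rewrite scaler0 scalemxAl mulmx_sum_row => E; apply: etrans E.
    by apply: eq_bigr => j _; rewrite rowK.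
apply: (negative_index_gt0 (w := vc)).
- by have [h _] := valP 1; rewrite scale1r in h.
- by rewrite D2End_0 pairing0r.
- move=> k k0; have [_ h] := valP k.
  have kz : 0 < `|k *: z| ^+ 2 by rewrite exprn_gt0// normr_gt0 scaler_eq0 negb_or k0.
  have F := etaP (k *: z).
  move: hlt; rewrite mulrAC ltr_pdivrMr ?mulr_gt0// => hlt.
  move: h; rewrite ler_norml => /andP[_]; rewrite lerBlDr.
  have h0 : bracket_pairing i1 i2 a < 0.
    rewrite -oppr_gt0 -(pmulr_lgt0 _ (mulr_gt0 (ltr0n _ 2) eta0)).
    exact: le_lt_trans (mulr_ge0 goh_const_ge0 dW0) hlt.
  move: hlt h0 kz F; move: (bracket_pairing _ _ _) (test_energy _) (`|_| ^+ 2) goh_const dW (pairing _ _).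
  move=> h e s G w Q hlt h0 kz F hQ.
  apply: le_lt_trans hQ _.
  (* As h is negative, the energy may be replaced by its lower bound eta s; then s factors out of
     the whole expression. *)
  have e1 : 2 * h * e <= 2 * h * (eta * s) by rewrite ler_wnM2l// pmulr_rle0// ltW.
  apply: le_lt_trans (lerD (lexx _) e1) _.
  have -> : G * s * w + 2 * h * (eta * s) = (G * w - - h * (2 * eta)) * s by ring.
  by rewrite pmulr_llt0// subr_lt0.
Qed.

End Goh.

(** * Both conditions at every time *)

Section Conclusion.
Context {R : realType} {n l : nat} {M : smooth_manifold R n}.
Variable (om : R -> R).
Hypothesis om_weight : weight om.
Local Notation W := (primitive om).
Variable (X : 'I_l -> M -> 'rV[R]_n).
Hypothesis X_smooth : forall i, smooth_vfield (X i).
Variables (T : R) (q0 : M) (u : control T l) (q : R -> M) (Phi : 'I_n -> R -> 'cV[R]_n).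
Hypothesis T_gt0 : 0 < T.
Hypothesis om1 : forall t, 0 <= t <= T -> 1 <= om t.
Hypothesis ule : forall i t, 0 <= t <= T -> `|u i t| <= om t.
Hypothesis q_traj : trajectory X q0 u q.
Hypothesis Phi_frame : covector_frame X u q Phi.
Variables (al : 'I_n -> R).
Implicit Types (c : chart R n M).
Local Notation phi := (fun t => \sum_k al k *: Phi k t).

Lemma bracket_pairingC c i j s :
  bracket_pairing X q Phi al c j i s = - bracket_pairing X q Phi al c i j s.
Proof.
by rewrite /bracket_pairing -sumrN; apply: eq_bigr => k _; rewrite -mulrN opprB.
Qed.

Lemma bracket_pairing_chart_at i j t :
  bracket_pairing X q Phi al (chart_at (q t)) j i t = pairing (phi t) (lie_bracket (X i) (X j) (q t)).
Proof.
rewrite pairing_suml; apply: eq_bigr => k _.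
by rewrite pairingZl /lie_bracket pairingBr cotangent_in_chart_at.
Qed.

Lemma field_pairing_chart_at i t :
  \sum_k al k * pairing (cotangent_in (chart_at (q t)) (q t) (Phi k t))
    (vfield_in (chart_at (q t)) (X i) (chart_at (q t) (q t))) = pairing (phi t) (X i (q t)).
Proof.
rewrite pairing_suml; apply: eq_bigr => k _.
by rewrite pairingZl cotangent_in_chart_at vfield_in_coords ?tangent_in_chart_at//; exact: mem_chart_at.
Qed.

(** The interval is clipped to [0, T], so the end times are covered as well. *)
Lemma centered_window t r : 0 <= t <= T -> 0 < r -> exists a b, [/\ 0 <= a, a < b, b <= T,
  a <= t <= b & t - r < a /\ b < t + r].
Proof.
move=> /andP[t0 tT] r0; have r2 : 0 < r / 2 by rewrite divr_gt0.
have r2r : r / 2 < r by rewrite ltr_pdivrMr// ltr_pMr// ltr1n.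
exists (Num.max 0 (t - r / 2)), (Num.min T (t + r / 2)); split.
- by rewrite le_max lexx.
- rewrite gt_max !lt_min T_gt0/= (le_lt_trans t0) ?ltrDl//= (lt_le_trans _ tT) ?gtrBl//=.
  by rewrite (@lt_trans _ _ t)// ?gtrBl ?ltrDl.
- by rewrite ge_min lexx.
- by rewrite ge_max t0/= gerBl (ltW r2)/= le_min tT/= lerDl ltW.
- by rewrite lt_max ltrD2l ltrN2 r2r orbT gt_min ltrD2l r2r orbT.
Qed.

Lemma annihilates_fields i t : 0 <= t <= T ->
  (forall w, im_DEnd X q0 u w -> pairing (phi T) w = 0) -> pairing (phi t) (X i (q t)) = 0.
Proof.
move=> tT im0; have ac := chart_at_atlas (q t); have cq := mem_chart_at (q t).
have q_sol := trajectory_solution om_weight X_smooth ule q_traj.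
have [rho [K [P [C [r [wb r0 rP]]]]]] :=
  exists_window om_weight X_smooth ule q_sol Phi_frame.1 tT ac cq.
have [a [b [a0 ab bT tab [ra rb]]]] := centered_window tT r0.
have [rho0 K0 P0 C0 cod fc fc2] := wb.
have [_ _ _ _ [xW xr _] _ frame] := rP a b a0 (ltW ab) bT ra rb.
rewrite -field_pairing_chart_at.
pose h s := \sum_k al k * pairing (cotangent_in (chart_at (q t)) (q s) (Phi k s))
  (vfield_in (chart_at (q t)) (X i) (chart_at (q t) (q s))).
have hW : Wlip om a b h.
  apply: Wlip_sum => k; apply: (@WlipZ _ _ R).
  apply: Wlip_pairing => //; [exact: ltW | | exact: (Wlip_c11 K0 (fc i) xW xr)].
  by have [_ pC _] := frame k; exists C.
pose E := (\sum_k `|al k|) * (n%:R * (C * K + P * (K * C))).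
have E0 : 0 <= E by rewrite /E mulr_ge0 ?sumr_ge0//; nneg.
apply: (vanish_of_small om_weight ab tab E0 hW) => a' b' aa' ab' bb'.
have a'0 := le_trans a0 aa'; have b'T := le_trans bb' bT.
have win' := rP a' b' a'0 (ltW ab') b'T (lt_le_trans ra aa') (le_lt_trans bb' rb).
exact: (field_estimate om_weight X_smooth T_gt0 om1 ule q_traj Phi_frame ac wb win' a'0 ab' b'T i im0).
Qed.

Lemma annihilates_brackets i j t c' : 0 <= t <= T -> atlas c' -> dom c' (q T) ->
  negative_index (ker_DEnd X q0 u)
    (fun v => pairing (cotangent_in c' (q T) (phi T)) (D2End X q0 c' u v)) = 0%E ->
  pairing (phi t) (lie_bracket (X i) (X j) (q t)) = 0.
Proof.
move=> tT ac' c'q index0; have [->|ij] := eqVneq i j.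
  by rewrite /lie_bracket subrr pairing0r.
have ac := chart_at_atlas (q t); have cq := mem_chart_at (q t).
have q_sol := trajectory_solution om_weight X_smooth ule q_traj.
have [rho [K [P [C [r [wb r0 rP]]]]]] :=
  exists_window om_weight X_smooth ule q_sol Phi_frame.1 tT ac cq.
have [a [b [a0 ab bT tab [ra rb]]]] := centered_window tT r0.
have [rho0 K0 P0 C0 cod fc fc2] := wb.
have [_ _ _ _ [xW xr _] _ frame] := rP a b a0 (ltW ab) bT ra rb.
rewrite -bracket_pairing_chart_at.
have hW : Wlip om a b (bracket_pairing X q Phi al (chart_at (q t)) j i).
  apply: Wlip_sum => k; apply: (@WlipZ _ _ R).
  have pW : Wlip om a b (fun s => cotangent_in (chart_at (q t)) (q s) (Phi k s)).
    by have [_ pC _] := frame k; exists C.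
  have fW i' := Wlip_c11 K0 (fc i') xW xr.
  have dW i' j' : Wlip om a b (fun s => 'D_(vfield_in (chart_at (q t)) (X j') (chart_at (q t) (q s)))
      (vfield_in (chart_at (q t)) (X i')) (chart_at (q t) (q s))).
    exact: (Wlip_c11_derive om_weight (ltW ab) K0 (fc i') xW xr (fW j')).
  by apply: WlipB; apply: Wlip_pairing => //; exact: ltW.
have [eta eta0 etaP] := test_energy_ge R n.
pose E := @goh_const R n l al K P C / (2 * eta).
have E0 : 0 <= E.
  apply: divr_ge0; first exact: (goh_const_ge0 al wb).
  by apply: mulr_ge0 => //; exact: ltW.
apply: (vanish_of_small om_weight ab tab E0 hW) => a' b' aa' ab' bb'.
have a'0 := le_trans a0 aa'; have b'T := le_trans bb' bT.
have win' := rP a' b' a'0 (ltW ab') b'T (lt_le_trans ra aa') (le_lt_trans bb' rb).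
(* The same one-sided bound for (i, j) and for (j, i): exchanging the indices changes the sign of
   the pairing, and the two together bound its absolute value. *)
have side i1 i2 (i12 : i1 != i2) := bracket_pairing_ge om_weight X_smooth T_gt0 om1 ule q_traj
  Phi_frame ac wb win' a'0 ab' b'T i12 eta0 etaP ac' c'q index0.
rewrite ler_norml; apply/andP; split.
  by rewrite lerNl; apply: side; rewrite eq_sym.
by rewrite bracket_pairingC; exact: side.
Qed.

End Conclusion.

Theorem lemma4p6 (R : realType) (n l : nat) (M : smooth_manifold R n)
    (X : 'I_l -> M -> 'rV[R]_n)
    (X_smooth : forall i, smooth_vfield (X i))
    (X_indep : forall p : M, row_free (\matrix_(i < l) X i p))
    (T : R) (T_gt0 : 0 < T) (q0 : M)
    (u : control T l) (q : R -> M) (q_traj : trajectory X q0 u q)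
    (Phi : 'I_n -> R -> 'cV[R]_n) (Phi_frame : covector_frame X u q Phi)
    (phi0 : 'cV[R]_n) (phi0_neq0 : phi0 != 0)
    (phi0_im : forall w, im_DEnd X q0 u w -> pairing phi0 w = 0)
    (c : chart R n M) (c_atlas : atlas c) (c_qT : dom c (q T))
    (phi0_index : negative_index (ker_DEnd X q0 u)
       (fun v => pairing (cotangent_in c (q T) phi0) (D2End X q0 c u v)) = 0%E) :
  exists a : 'I_n -> R, (exists i, a i != 0) /\
    let phi := fun t => \sum_(i < n) a i *: Phi i t in
    pontryagin_covector X u q phi /\
    forall (i j : 'I_l) (t : R), 0 <= t <= T ->
      pairing (phi t) (X i (q t)) = 0 /\
      pairing (phi t) (lie_bracket (X i) (X j) (q t)) = 0.
Proof.
have [om omw [om1 ule]] := exists_weight u.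
have q_sol := trajectory_solution omw X_smooth ule q_traj.
(* The coefficients are the coordinates of [phi0] in the frame at time T, so the combination is the
   Pontryagin covector that ends at [phi0]. *)
have [al al0 alE] := frame_coordinates omw X_smooth T_gt0 ule (control_measurable u) q_sol
  Phi_frame phi0_neq0.
exists al; split=> //; split; first exact: (pontryagin_sum al Phi_frame.1).
move=> i j t tT; rewrite -{}alE in phi0_im phi0_index; split.
  exact: (annihilates_fields omw X_smooth T_gt0 om1 ule q_traj Phi_frame i tT phi0_im).
exact: (annihilates_brackets omw X_smooth T_gt0 om1 ule q_traj Phi_frame i j tT c_atlas c_qT
  phi0_index).
Qed.
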